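(* Let $d \in \{2, 3, \ldots\}$ and $p \in [1, \infty) \setminus \{2\}$. Let $B = \overline{M}^p_{\mathbb Z_{\ge 0}} \otimes_p D$ be the stabilized spatial $L^p$ UHF algebra of type $d^\infty$, with the isometric automorphism $\beta$, as constructed in the context. Then the canonical map $\kappa_{\mathrm r} \colon F^p(\mathbb Z, B, \beta) \to F^p_{\mathrm r}(\mathbb Z, B, \beta)$ from the full to the reduced $L^p$ operator crossed product is an isometric bijection.
   Context: Construction of $B$ and $\beta$. Let $Z=\{0,1,\dots,d-1\}$ with normalized counting measure $\lambda$, and $X_0=Z^{\mathbb Z_{>0}}$ with the product topology and infinite product measure $\mu_0$. For $r\ge1$, $L^p(X_0,\mu_0)$ is identified with $L^p(Z^r,\lambda^r)\otimes_pL^p(X_r,\mu_r)$ (functions of the first $r$ and of the remaining coordinates), and $D_r$ is the set of operators $a\otimes1$ with $a\in L(L^p(Z^r,\lambda^r))$. Set $D=\overline{\bigcup_{r\ge1}D_r}\subset L(L^p(X_0,\mu_0))$; it is the spatial $L^p$ UHF algebra of type $d^\infty$. $\overline M^p_{\mathbb Z_{\ge0}}\subset L(l^p(\mathbb Z_{\ge0}))$ is the norm closure of the linear span of the standard matrix units $e_{j,k}$, $j,k\in\mathbb Z_{\ge0}$. Let $X=\mathbb Z_{\ge0}\times X_0$ with $\mu$ = (counting measure)$\times\mu_0$. $B=\overline M^p_{\mathbb Z_{\ge0}}\otimes_pD\subset L(L^p(X,\mu))$ is the closed linear span of all $a\otimes b$ with $a\in\overline M^p_{\mathbb Z_{\ge0}}$,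 $b\in D$, acting on $l^p(\mathbb Z_{\ge0})\otimes_pL^p(X_0,\mu_0)=L^p(X,\mu)$. Define a homeomorphism $h\colon X\to X$ by $h(m,k_1,k_2,\dots)=(m_0,k_0,k_1,k_2,\dots)$ where $m=dm_0+k_0$ with $m_0\in\mathbb Z_{\ge0}$, $k_0\in Z$. Define the isometric bijection $v\in L(L^p(X,\mu))$ by $(v\xi)(x)=d^{1/p}\xi(h^{-1}(x))$. Then $vBv^{-1}=B$, and $\beta\in\mathrm{Aut}(B)$ is $\beta(b)=vbv^{-1}$, an isometric automorphism, generating an action of $\mathbb Z$. Crossed products. A representation of $B$ on $L^p(Y,\nu)$ is a continuous homomorphism $\pi\colon B\to L(L^p(Y,\nu))$; contractive means $\|\pi(b)\|\le\|b\|$, nondegenerate means the span of $\{\pi(b)\xi\}$ is dense, $\sigma$-finite means $\nu$ is $\sigma$-finite. A contractive covariant representation $(w,\pi)$ consists of a representation $n\mapsto w_n$ of $\mathbb Z$ by invertible operators with $\|w_n\|\le1$ and a contractive representation $\pi$ of $B$ on the same $L^p$ space with $\pi(\beta^n(b))=w_n\pi(b)w_n^{-1}$. The regular covariant representation associated to a contractive representation $\pi_0$ of $B$ on $L^p(Y,\nu)$ acts on $l^p(\mathbb Z,L^p(Y,\nu))$ by $(w_n\xi)(m)=\xi(m-n)$, $(\pi(b)\xi)(m)=\pi_0(\beta^{-m}(b))(\xi(m))$. $C_{\mathrm c}(\mathbb Z,B,\beta)$ is the algebra of finite sums $\sum_nb_nu_n$ with $(bu_n)(cu_m)=b\beta^n(c)u_{n+m}$,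 and $(w\ltimes\pi)(\sum_nb_nu_n)=\sum_n\pi(b_n)w_n$. $F^p(\mathbb Z,B,\beta)$ (respectively $F^p_{\mathrm r}(\mathbb Z,B,\beta)$) is the Hausdorff completion of $C_{\mathrm c}(\mathbb Z,B,\beta)$ in the seminorm $a\mapsto\sup\|(w\ltimes\pi)(a)\|$ over all nondegenerate $\sigma$-finite contractive covariant representations (respectively all regular ones coming from nondegenerate $\sigma$-finite contractive $\pi_0$). $\kappa_{\mathrm r}$ is the contractive homomorphism extending the identity of $C_{\mathrm c}(\mathbb Z,B,\beta)$. *)

(* Defs.v *)
From HB Require Import structures.
From mathcomp Require Import all_boot all_order all_algebra.
From mathcomp Require Import complex.
From mathcomp Require Import all_classical all_reals all_analysis.
From mathcomp Require Import measurable_realfun ring lra.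

Set Implicit Arguments.
Unset Strict Implicit.
Unset Printing Implicit Defensive.

Import Order.TTheory GRing.Theory Num.Theory.
Import numFieldNormedType.Exports.

Local Open Scope classical_set_scope.
Local Open Scope ring_scope.

(* Complex-valued p-integrable functions, before the quotient. *)
Section LpFun.
Context d (T : measurableType d) (R : realType).
Variables (mu : {measure set T -> \bar R}) (p : R).

Definition cmeasurable (f : T -> R[i]) :=
  measurable_fun setT (@complex.Re R \o f) /\
  measurable_fun setT (@complex.Im R \o f).

Definition cLnorm (f : T -> R[i]) : \bar R :=
  'N[mu]_(p%:E)[EFin \o (@Normc.normc R \o f)].

Definition in_Lp (f : T -> R[i]) := cmeasurable f /\ (cLnorm f < +oo)%E.

Record LpFun := MkLpFun { LpFun_fun :> T -> R[i] ; LpFunP : in_Lp LpFun_fun }.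

HB.instance Definition _ := gen_eqMixin LpFun.
HB.instance Definition _ := gen_choiceMixin LpFun.

Lemma cmeasurable_normc f : cmeasurable f ->
  measurable_fun setT (@Normc.normc R \o f).
Proof.
move=> [mr mi].
rewrite (_ : _ \o _ = fun x => Num.sqrt
    ((complex.Re (f x)) ^+ 2 + (complex.Im (f x)) ^+ 2)); last first.
  by apply/funext => x /=; case: (f x).
apply: (@measurableT_comp _ _ _ _ _ _ (@Num.sqrt R)).
  by apply: continuous_measurable_fun; exact: sqrt_continuous.
by apply: measurable_funD; exact: measurable_funX.
Qed.

Lemma cmeasurableD f g : cmeasurable f -> cmeasurable g ->
  cmeasurable (fun x => f x + g x).
Proof.
move=> [fr fi] [gr gi]; split.
  rewrite (_ : _ \o _ =
    (@complex.Re R \o f) \+ (@complex.Re R \o g)); last first.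
    by apply/funext => x /=; case: (f x) (g x) => ? ? [].
  exact: measurable_funD.
rewrite (_ : _ \o _ = (@complex.Im R \o f) \+ (@complex.Im R \o g)); last first.
  by apply/funext => x /=; case: (f x) (g x) => ? ? [].
exact: measurable_funD.
Qed.

Lemma cmeasurableZ a f : cmeasurable f -> cmeasurable (fun x => a * f x).
Proof.
case: a => a b [fr fi]; split.
  rewrite (_ : _ \o _ = (fun x => a * (@complex.Re R \o f) x) \-
    (fun x => b * (@complex.Im R \o f) x)); last first.
    by apply/funext => x /=; case: (f x).
  by apply: measurable_funB; exact: measurable_funM.
rewrite (_ : _ \o _ = (fun x => a * (@complex.Im R \o f) x) \+
    (fun x => b * (@complex.Re R \o f) x)); last first.
  by apply/funext => x /=; case: (f x).
by apply: measurable_funD; exact: measurable_funM.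
Qed.

Lemma cmeasurable_cst a : cmeasurable (cst a).
Proof. by split; exact: measurable_cst. Qed.

Lemma normc_ge0 (z : R[i]) : 0 <= Normc.normc z.
Proof. by case: z => a b; rewrite sqrtr_ge0. Qed.

Lemma cLnorm_eq_ae f g : cmeasurable f -> cmeasurable g ->
  {ae mu, forall x, f x = g x} -> cLnorm f = cLnorm g.
Proof.
move=> mf mg fg; rewrite /cLnorm unlock; congr (_ `^ _)%E.
apply: ae_eq_integral => //.
- apply: (@measurableT_comp _ _ _ _ _ _ (@poweR R ^~ p)).
    exact: measurable_poweR.
  apply: measurableT_comp => //; apply/measurable_EFinP.
  exact: cmeasurable_normc.
- apply: (@measurableT_comp _ _ _ _ _ _ (@poweR R ^~ p)).
    exact: measurable_poweR.
  apply: measurableT_comp => //; apply/measurable_EFinP.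
  exact: cmeasurable_normc.
by apply: filterS fg => x /= ->.
Qed.

Hypothesis p1 : 1 <= p.

Let p0 : 0 < p. Proof. exact: lt_le_trans p1. Qed.

Lemma cLnormD f g : cmeasurable f -> cmeasurable g ->
  (cLnorm (fun x => f x + g x)%R <= cLnorm f + cLnorm g)%E.
Proof.
move=> mf mg.
apply: le_trans (minkowski_EFin mu (cmeasurable_normc mf)
  (cmeasurable_normc mg) p1).
rewrite /cLnorm unlock; apply: gt0_ler_poweR.
- by rewrite invr_ge0 ltW.
- by rewrite in_itv/= leey integral_ge0// => x _; exact: poweR_ge0.
- by rewrite in_itv/= leey integral_ge0// => x _; exact: poweR_ge0.
apply: ge0_le_integral => //=.
- apply/measurable_EFinP/(@measurableT_comp _ _ _ _ _ _ (@powR R ^~ p))/measurableT_comp => //.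
  exact/cmeasurable_normc/cmeasurableD.
- apply/measurable_EFinP/(@measurableT_comp _ _ _ _ _ _ (@powR R ^~ p))/measurableT_comp => //.
  by apply: measurable_funD; exact: cmeasurable_normc.
move=> x _; rewrite !lee_fin ge0_ler_powR ?nnegrE ?normr_ge0//; first exact: ltW.
rewrite ger0_norm ?normc_ge0// ger0_norm ?addr_ge0 ?normc_ge0//.
exact: le_normcD.
Qed.

Lemma cLnormZ a f : in_Lp f ->
  cLnorm (fun x => a * f x) = ((Normc.normc a)%:E * cLnorm f)%E.
Proof.
move=> [mf foo].
have hf : (@Normc.normc R \o f) \in Lfun mu p%:E.
  rewrite inE; apply/andP; split; rewrite inE/=; last exact: foo.
  exact: cmeasurable_normc.
have q1 : (1 <= p%:E)%E by rewrite lee_fin.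
have := LnormZ (p1 := q1) (Lfun_Sub q1 hf) (Normc.normc a).
rewrite ger0_norm ?normc_ge0// => <-; rewrite /cLnorm.
by congr Lnorm; apply/funext => x /=; rewrite Normc.normcM.
Qed.

Lemma cLnorm0 : cLnorm (cst 0) = 0%E.
Proof.
rewrite /cLnorm (_ : _ \o _ = cst 0%E) ?Lnorm0//.
  by rewrite eqe gt_eqF.
by apply/funext => x /=; rewrite expr0n/= addr0 sqrtr0.
Qed.

Lemma in_Lp0 : in_Lp (cst 0).
Proof. by split; [exact: cmeasurable_cst|rewrite cLnorm0]. Qed.

Lemma in_LpD f g : in_Lp f -> in_Lp g -> in_Lp (fun x => f x + g x).
Proof.
move=> [mf foo] [mg goo]; split; first exact: cmeasurableD.
by apply: le_lt_trans (cLnormD mf mg) _; rewrite lte_add_pinfty.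
Qed.

Lemma in_LpZ a f : in_Lp f -> in_Lp (fun x => a * f x).
Proof.
move=> hf; split; first by apply: cmeasurableZ; case: hf.
by rewrite cLnormZ// lte_mul_pinfty ?lee_fin ?normc_ge0//; case: hf.
Qed.

Definition aeeq (f g : LpFun) : bool := `[< {ae mu, forall x, f x = g x} >].

Let aeeq_refl : reflexive aeeq.
Proof. by move=> f; apply/asboolP; exact: aeW. Qed.

Let aeeq_sym : symmetric aeeq.
Proof.
by move=> f g; apply/asboolP/asboolP; apply: filterS => x ->.
Qed.

Let aeeq_trans : transitive aeeq.
Proof.
move=> g f h /asboolP fg /asboolP gh; apply/asboolP.
by apply: filterS2 fg gh => x -> ->.
Qed.

Canonical aeeq_equiv := EquivRel aeeq aeeq_refl aeeq_sym aeeq_trans.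

End LpFun.

(* L^p(T, mu): a.e. classes of p-integrable functions; p1 gives the norm. *)
Section Lp.
Context d (T : measurableType d) (R : realType).
Variables (mu : {measure set T -> \bar R}) (p : R) (p1 : 1 <= p).
Local Open Scope quotient_scope.

Definition Lp of (1 <= p) : Type := {eq_quot (@aeeq _ T R mu p)}.

Local Notation L := (Lp p1).
HB.instance Definition _ := Choice.on L.
HB.instance Definition _ := EqQuotient.on L.

Definition Lp_rep (xi : L) : LpFun mu p := repr xi.
Coercion Lp_rep : Lp >-> LpFun.

Lemma Lp_eqP (f g : LpFun mu p) :
  (\pi_L f = \pi_L g) <-> {ae mu, forall x, f x = g x}.
Proof. by split=> [/eqmodP/asboolP|h]//; apply/eqmodP/asboolP. Qed.

Lemma Lp_repK (xi : L) : \pi_L (Lp_rep xi) = xi.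
Proof. exact: reprK. Qed.

Lemma Lp_piE (f : LpFun mu p) : {ae mu, forall x, (\pi_L f : L) x = f x}.
Proof. by apply/Lp_eqP; rewrite Lp_repK. Qed.

Lemma Lp_ext (xi eta : L) : {ae mu, forall x, xi x = eta x} -> xi = eta.
Proof. by move=> h; rewrite -(Lp_repK xi) -(Lp_repK eta); exact/Lp_eqP. Qed.

Definition Lp_zero : L := \pi_L (MkLpFun (in_Lp0 mu p1)).
Definition Lp_add (xi eta : L) : L :=
  \pi_L (MkLpFun (in_LpD p1 (LpFunP xi) (LpFunP eta))).
Definition Lp_scale (a : R[i]) (xi : L) : L :=
  \pi_L (MkLpFun (in_LpZ p1 a (LpFunP xi))).
Definition Lp_opp (xi : L) : L := Lp_scale (-1) xi.

Let zeroE : {ae mu, forall x, Lp_zero x = 0}.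
Proof. exact: Lp_piE. Qed.
Let addE xi eta : {ae mu, forall x, Lp_add xi eta x = xi x + eta x}.
Proof. exact: Lp_piE. Qed.
Let scaleE a xi : {ae mu, forall x, Lp_scale a xi x = a * xi x}.
Proof. exact: Lp_piE. Qed.

Let addA : associative Lp_add.
Proof.
move=> x y z; apply: Lp_ext.
have h1 := addE x (Lp_add y z); have h2 := addE (Lp_add x y) z.
have h3 := addE y z; have h4 := addE x y.
apply: filterS2 (filterI h1 h3) (filterI h2 h4) => t [-> ->] [-> ->].
exact: addrA.
Qed.

Let addC : commutative Lp_add.
Proof.
move=> x y; apply: Lp_ext.
by apply: filterS2 (addE x y) (addE y x) => t -> ->; exact: addrC.
Qed.

Let add0 : left_id Lp_zero Lp_add.
Proof.
move=> x; apply: Lp_ext.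
by apply: filterS2 (addE Lp_zero x) zeroE => t -> ->; exact: add0r.
Qed.

Let addN : left_inverse Lp_zero Lp_opp Lp_add.
Proof.
move=> x; apply: Lp_ext; have h := scaleE (-1) x.
apply: filterS2 (addE (Lp_opp x) x) (filterI h zeroE) => t -> [-> ->].
by rewrite mulN1r addNr.
Qed.

HB.instance Definition _ := GRing.isZmodule.Build L addA addC add0 addN.

Let scaleA a b (x : L) : Lp_scale a (Lp_scale b x) = Lp_scale (a * b) x.
Proof.
apply: Lp_ext; have h := scaleE b x.
apply: filterS2 (scaleE a (Lp_scale b x)) (filterI h (scaleE (a * b) x)).
by move=> t -> [-> ->]; exact: mulrA.
Qed.

Let scale1 : left_id 1 Lp_scale.
Proof.
by move=> x; apply: Lp_ext; apply: filterS (scaleE 1 x) => t ->; exact: mul1r.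
Qed.

Let scaleDr : right_distributive Lp_scale +%R.
Proof.
move=> a x y; apply: Lp_ext.
have h1 := scaleE a (x + y); have h2 := addE x y.
have h3 := addE (Lp_scale a x) (Lp_scale a y).
have h4 := scaleE a x; have h5 := scaleE a y.
apply: filterS2 (filterI h1 h2) (filterI h3 (filterI h4 h5)).
by move=> t [-> ->] [-> [-> ->]]; exact: mulrDr.
Qed.

Let scaleDl x : {morph Lp_scale^~ x : a b / a + b}.
Proof.
move=> a b; apply: Lp_ext.
have h1 := scaleE (a + b) x; have h2 := addE (Lp_scale a x) (Lp_scale b x).
have h4 := scaleE a x; have h5 := scaleE b x.
apply: filterS2 (filterI h1 h2) (filterI h4 h5).
by move=> t [-> ->] [-> ->]; exact: mulrDl.
Qed.

HB.instance Definition _ := GRing.Zmodule_isLmodule.Build R[i] L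
  scaleA scale1 scaleDr scaleDl.

Lemma Lp0E : {ae mu, forall x, (0 : L) x = 0}.
Proof. exact: zeroE. Qed.

Lemma LpDE (xi eta : L) : {ae mu, forall x, (xi + eta : L) x = xi x + eta x}.
Proof. exact: addE. Qed.

Lemma LpZE a (xi : L) : {ae mu, forall x, (a *: xi : L) x = a * xi x}.
Proof. exact: scaleE. Qed.

Definition Lp_norm (xi : L) : R := fine (cLnorm mu p xi).

Lemma Lp_normE (xi : L) : (Lp_norm xi)%:E = cLnorm mu p xi.
Proof.
rewrite fineK// ge0_fin_numE ?Lnorm_ge0//.
by case: (LpFunP xi).
Qed.

Let mLp (xi : L) : cmeasurable xi. Proof. by case: (LpFunP xi). Qed.

Let normD (xi eta : L) : (Lp_norm (xi + eta))%:C%C <=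
  (Lp_norm xi)%:C%C + (Lp_norm eta)%:C%C.
Proof.
rewrite -rmorphD/= lecR -lee_fin EFinD !Lp_normE.
rewrite (@cLnorm_eq_ae _ _ _ _ _ _ (fun x => xi x + eta x)) ?cLnormD//.
  exact: cmeasurableD.
Qed.

Let normZ a (xi : L) : (Lp_norm (a *: xi))%:C%C = `|a| * (Lp_norm xi)%:C%C.
Proof.
have -> : `|a| = (Normc.normc a)%:C%C by [].
rewrite -rmorphM/=; congr (_%:C)%C; apply: EFin_inj.
rewrite EFinM !Lp_normE -cLnormZ//; last exact: LpFunP.
apply: cLnorm_eq_ae => //; exact: cmeasurableZ.
Qed.

Let norm0 (xi : L) : (Lp_norm xi)%:C%C = 0 -> xi = 0.
Proof.
move=> [] h; apply: Lp_ext.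
have : cLnorm mu p xi = 0%E by rewrite -Lp_normE h.
have p0 : (0 < p%:E)%E by rewrite lte_fin (lt_le_trans _ p1).
move=> /(Lnorm_eq0_eq0 _ p0) h1.
have {}h1 := h1 _; apply: filterS2 Lp0E (h1 _) => [x -> /(_ I)[]|].
  by move=> /Normc.eq0_normc.
by apply/measurable_EFinP; exact: cmeasurable_normc.
Qed.

HB.instance Definition _ := Lmodule_isNormed.Build R[i] L normD normZ norm0.

End Lp.

(* Z = {0, .., d-1}; the proof hd makes it pointed. *)
Definition Zset (d : nat) (hd : (1 < d)%N) : Type := 'I_d.

Section Zset.
Variables (d : nat) (hd : (1 < d)%N).
Local Notation Z := (Zset hd).

HB.instance Definition _ := Finite.on Z.
HB.instance Definition _ := isPointed.Build Z (Ordinal (ltnW hd)).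
HB.instance Definition _ := @isMeasurable.Build default_measure_display
  Z discrete_measurable discrete_measurable0
  discrete_measurableC discrete_measurableU.

(* The index i : nat stands for the coordinate i + 1. *)
Definition cylinder (r : nat) (w : nat -> Z) : set (nat -> Z) :=
  [set x | forall i, (i < r)%N -> x i = w i].

Definition cylinders : set (set (nat -> Z)) :=
  [set C | exists r w, C = cylinder r w].

Definition X0 : Type := g_sigma_algebraType cylinders.
HB.instance Definition _ := Measurable.on X0.

Definition is_product_measure (R : realType) (mu : probability X0 R) :=
  forall (r : nat) (w : nat -> Z), mu (cylinder r w) = ((d%:R ^- r)%:E)%E.

Section existence.
Variable R : realType.
Implicit Types x a : R.

Let d0 : 0 < d%:R :> R. Proof. by rewrite ltr0n; apply: ltnW. Qed.

Let dig x : Z := Ordinal (ltn_pmod `|Num.floor (d%:R * x)|%N (ltnW hd)).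
Let tail x : R := d%:R * x - (Num.floor (d%:R * x))%:~R.
Let digits x : X0 :=
  if (0 <= x < 1) then (fun i => dig (iter i tail x)) else point.

Let digP x (k : Z) a b : 0 <= a -> b <= 1 ->
  (0 <= x < 1 /\ dig x = k /\ a <= tail x < b) <->
  ((k : nat)%:R + a) / d%:R <= x < ((k : nat)%:R + b) / d%:R.
Proof.
move=> a0 b1; rewrite ler_pdivrMr// ltr_pdivlMr// [x * _]mulrC.
split.
  move=> [/andP[x0 x1]] [kE]; rewrite /tail => /andP[h1 h2].
  have f0 : 0 <= Num.floor (d%:R * x) by rewrite floor_ge0 mulr_ge0// ltW.
  have fd : Num.floor (d%:R * x) < d.
    by rewrite -(@ltr_int R) (le_lt_trans (floor_le _))// gtr_pMr.
  have -> : (k : nat)%:R = (Num.floor (d%:R * x))%:~R :> R.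
    rewrite -kE /=; move: f0 fd; case: (Num.floor _) => // n _ nd.
    by rewrite modn_small.
  by move: h1 h2; set u := _%:~R; set y := _ * x => h1 h2; apply/andP; lra.
move=> /andP[h1 h2].
have fE : Num.floor (d%:R * x) = (k : nat)%:Z.
  apply: floor_def; rewrite intrD -[(k : nat)%:~R]/((k : nat)%:R).
  by move: h1 h2; set u := _%:R; set y := _ * x => h1 h2; apply/andP; lra.
have kd : (k < d)%N := ltn_ord (k : 'I_d).
split.
  have h3 : 0 <= (k : nat)%:R :> R by [].
  have h4 : (k : nat)%:R + 1 <= d%:R :> R by rewrite natr1 ler_nat.
  have x0 : 0 <= d%:R * x by lra.
  have x1 : d%:R * x < d%:R * 1 by rewrite mulr1; lra.
  by rewrite -(pmulr_rge0 _ d0) x0 /= -(ltr_pM2l d0).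
split; first by apply: val_inj; rewrite /= fE/= modn_small.
rewrite /tail fE -[(k : nat)%:~R]/((k : nat)%:R).
by move: h1 h2; set u := _%:R; set y := _ * x => h1 h2; apply/andP; lra.
Qed.

Let cylP r : forall w : nat -> Z, exists a : R,
  [/\ 0 <= a, a + d%:R ^- r <= 1 &
   forall x, (0 <= x < 1 /\ forall i, (i < r)%N -> dig (iter i tail x) = w i)
     <-> a <= x < a + d%:R ^- r].
Proof.
elim: r => [w|r IH w].
  exists 0; rewrite expr0 invr1 add0r; split => // x; split; first by case.
  by move=> ->.
have [a [a0 a1 aP]] := IH (w \o S).
exists (((w 0%N : nat)%:R + a) / d%:R).
have eE : ((w 0%N : nat)%:R + a) / d%:R + d%:R ^- r.+1 =
    ((w 0%N : nat)%:R + (a + d%:R ^- r)) / d%:R.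
  by rewrite exprS invfM; set u := _ ^- r; ring.
rewrite eE; split.
- by rewrite divr_ge0// ?addr_ge0// ltW.
- rewrite ler_pdivrMr// mul1r.
  have kd : (w 0%N < d)%N := ltn_ord (w 0%N : 'I_d).
  have h4 : (w 0%N : nat)%:R + 1 <= d%:R :> R by rewrite natr1 ler_nat.
  by apply: le_trans h4; rewrite lerD2l.
move=> x; rewrite -digP//; split.
  move=> [x01 h]; split => //; split; first exact: (h 0%N).
  apply/aP; split.
    by rewrite /tail subr_ge0 floor_le/= ltrBlDr addrC -intrD1 floorD1_gt.
  by move=> i ir; rewrite -iterSr; exact: h.
move=> [x01 [h0 /aP[_ h]]]; split => // -[|i] // ir.
by rewrite iterSr; exact: h.
Qed.

Let mdigits : measurable_fun setT digits.
Proof.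
apply: (@measurability _ _ _ X0 setT digits cylinders) => // _ [_ [r [w ->]] <-].
rewrite setTI; have [a [a0 a1 aP]] := cylP r w.
have m1 : measurable (`[0, 1[%classic : set R) by exact: measurable_itv.
have -> : digits @^-1` cylinder r w = `[a, a + d%:R ^- r[%classic `|`
    (if `[< cylinder r w point >] then ~` `[0, 1[%classic else set0).
  apply/seteqP; split => x.
    rewrite /digits /=; case: ifPn => x01 h.
      by left; rewrite /= in_itv/=; apply/aP.
    right; case: asboolP => //= _; rewrite in_itv/=.
    exact/negP.
  move=> [|]/=; rewrite ?in_itv/=.
    by move=> /aP[x01 h]; rewrite /digits x01.
  by case: asboolP => //= h; rewrite in_itv/= /digits => /negP/negbTE ->.
apply: measurableU; first exact: measurable_itv.
by case: asboolP => // _; exact: measurableC.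
Qed.

Let m01 : measurable (`[0, 1[%classic : set R).
Proof. exact: measurable_itv. Qed.

Let nu : set X0 -> \bar R := pushforward (mrestr lebesgue_measure m01) digits.

Let nu0 : nu set0 = 0%E.
Proof. by rewrite /nu /pushforward preimage_set0 measure0. Qed.

Let nu_ge0 A : (0 <= nu A)%E.
Proof. exact: measure_ge0. Qed.

Let nu_sigma_additive : semi_sigma_additive nu.
Proof.
move=> F mF tF mUF; rewrite /nu /pushforward preimage_bigcup.
apply: measure_semi_sigma_additive.
- by move=> n; rewrite -[X in measurable X]setTI; exact: mdigits.
- apply/trivIsetP => /= i j _ _ ij; rewrite -preimage_setI.
  by move/trivIsetP : tF => /(_ _ _ _ _ ij) ->//; rewrite preimage_set0.
- by rewrite -preimage_bigcup -[X in measurable X]setTI; exact: mdigits.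
Qed.

HB.instance Definition _ := isMeasure.Build _ _ _ nu nu0 nu_ge0
  nu_sigma_additive.

Let nu1 : nu setT = 1%E.
Proof.
rewrite /nu /pushforward preimage_setT /mrestr setTI lebesgue_measure_itv/=.
by rewrite lte_fin ltr01 oppr0 adde0.
Qed.

HB.instance Definition _ := Measure_isProbability.Build _ _ _ nu nu1.

Lemma product_measure_exists :
  exists mu : probability X0 R, is_product_measure mu.
Proof.
exists nu => r w; rewrite /= /nu /pushforward /mrestr.
have [a [a0 a1 aP]] := cylP r w.
have dr : 0 < d%:R ^- r :> R by rewrite invr_gt0 exprn_gt0.
rewrite (_ : _ `&` _ = `[a, a + d%:R ^- r[%classic); last first.
  apply/seteqP; split => x /=; rewrite !in_itv/=.
    by rewrite /digits => -[+ x01]; rewrite x01 => h; apply/aP.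
  by move=> /aP[x01 h]; rewrite /digits x01.
by rewrite lebesgue_measure_itv/= lte_fin ltrDl dr -EFinD addrAC subrr add0r.
Qed.


(* The infinite product of the uniform probabilities on Z; it is determined by
   its values on the cylinders, which generate the sigma-algebra of X0. *)
Definition mu0 : probability X0 R := sval (cid product_measure_exists).

Lemma mu0P : is_product_measure mu0.
Proof. exact: svalP (cid product_measure_exists). Qed.

End existence.
End Zset.

(* The operator norm computed from a size function N on V. *)
Definition opnorm_for (R : realType) (V : Type) (N : V -> \bar R)
    (f : V -> V) : \bar R :=
  ereal_sup [set N (f x) | x in [set x | (N x <= 1)%E]].

Section Operators.
Variable R : realType.

Definition rnorm (E : normedModType R[i]) (x : E) : R := complex.Re `|x|.

Definition opnorm (E : normedModType R[i]) (f : E -> E) : \bar R :=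
  opnorm_for (fun x => (rnorm x)%:E) f.

(* The elements of L(E), as functions; sums and scalar multiples are
   pointwise, and the product is composition. *)
Definition bounded_operator (E : normedModType R[i]) (f : E -> E) :=
  linear f /\ continuous f.

Definition lspan (V : lmodType R[i]) (S : set V) : set V :=
  [set x | exists (n : nat) (c : 'I_n -> R[i]) (s : 'I_n -> V),
    (forall i, S (s i)) /\ x = \sum_(i < n) c i *: s i].

(* Closure in L(E) for the operator norm. *)
Definition opclosure (E : normedModType R[i]) (S : set (E -> E)) :
    set (E -> E) :=
  [set f : E -> E | bounded_operator f /\
    forall e : R, 0 < e -> exists2 g, S g & (opnorm (f - g)%R < e%:E)%E].

(* Hausdorff completion of the algebra (A, mul) in the seminorm N.  A is a
   subset of V and mul, N matter only on A.  The completion is unique up to a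
   unique isometric isomorphism compatible with hc_in. *)
Record hausdorff_completion (V : lmodType R[i]) (A : set V)
    (mul : V -> V -> V) (N : V -> \bar R) := HausdorffCompletion {
  hc_sort :> completeNormedModType R[i] ;
  hc_mul : hc_sort -> hc_sort -> hc_sort ;
  hc_in : V -> hc_sort ;
  hc_inP : forall c a b, A a -> A b -> hc_in (c *: a + b) =
    c *: hc_in a + hc_in b ;
  hc_in_norm : forall a, A a -> (rnorm (hc_in a))%:E = N a ;
  hc_in_dense : closure (hc_in @` A) = setT ;
  hc_in_mul : forall a b, A a -> A b ->
    hc_in (mul a b) = hc_mul (hc_in a) (hc_in b) ;
  hc_mull : forall y, linear (hc_mul ^~ y) ;
  hc_mulr : forall x, linear (hc_mul x) ;
  hc_mul_norm : forall x y, `|hc_mul x y| <= `|x| * `|y| }.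

End Operators.
Arguments hc_mul {R V A mul N} _.
Arguments hc_in {R V A mul N} _.

(* L^p operator crossed products of A, an algebra of operators on E, by an
   action alpha of the integers.  Maps on A are represented by maps on all of
   E -> E, whose values outside A play no role. *)
Section CrossedProducts.
Context (R : realType) (p : R) (p1 : 1 <= p) (E : normedModType R[i]).
Variables (A : set (E -> E)) (alpha : int -> (E -> E) -> (E -> E)).

Definition contractive_rep (F : normedModType R[i])
    (pi : (E -> E) -> (F -> F)) :=
  [/\ forall a, A a -> bounded_operator (pi a),
      forall c a b, A a -> A b -> pi (c *: a + b) = c *: pi a + pi b,
      forall a b, A a -> A b -> pi (a \o b) = pi a \o pi b &
      forall a, A a -> (opnorm (pi a) <= opnorm a)%E].

Definition nondegenerate (F : normedModType R[i])
    (pi : (E -> E) -> (F -> F)) :=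
  closure (lspan [set y | exists a x, A a /\ y = pi a x]) = setT.

Definition contractive_covariant (F : normedModType R[i]) (w : int -> F -> F)
    (pi : (E -> E) -> (F -> F)) :=
  [/\ forall n, bounded_operator (w n) /\ (opnorm (w n) <= 1)%E,
      w 0 = id,
      forall m n, w (m + n) = w m \o w n,
      contractive_rep pi &
      forall n a, A a -> pi (alpha n a) = w n \o pi a \o w (- n)].

(* The function a stands for the formal sum of the a(n) u_n. *)
Definition Cc : set (int -> (E -> E)) :=
  [set a | finite_set [set n | a n <> 0] /\ forall n, A (a n)].

Definition Cc_mul (a b : int -> (E -> E)) : int -> (E -> E) :=
  fun n => \sum_(k \in [set: int]) (a k \o alpha k (b (n - k))).

Definition integrated (V : lmodType R[i]) (w : int -> V -> V)
    (pi : (E -> E) -> (V -> V)) (a : int -> (E -> E)) : V -> V :=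
  \sum_(n \in [set: int]) (pi (a n) \o w n).

Definition full_norm (a : int -> (E -> E)) : \bar R :=
  ereal_sup [set x | exists (dY : measure_display) (Y : measurableType dY)
    (nu : {sigma_finite_measure set Y -> \bar R})
    (w : int -> Lp nu p1 -> Lp nu p1)
    (pi : (E -> E) -> (Lp nu p1 -> Lp nu p1)),
    [/\ contractive_covariant w pi, nondegenerate pi &
        x = opnorm (integrated w pi a)]].

(* l^p(Z, F) consists of the xi with lpZ_norm xi < +oo. *)
Definition lpZ_norm (F : normedModType R[i]) (xi : int -> F) : \bar R :=
  ((\esum_(m in [set: int]) (rnorm (xi m) `^ p)%:E) `^ p^-1)%E.

Definition regular_w (F : normedModType R[i]) (n : int) (xi : int -> F) :
    int -> F := fun m => xi (m - n).

Definition regular_pi (F : normedModType R[i]) (pi0 : (E -> E) -> (F -> F))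
    (a : E -> E) (xi : int -> F) : int -> F :=
  fun m => pi0 (alpha (- m) a) (xi m).

Definition reduced_norm (a : int -> (E -> E)) : \bar R :=
  ereal_sup [set x | exists (dY : measure_display) (Y : measurableType dY)
    (nu : {sigma_finite_measure set Y -> \bar R})
    (pi0 : (E -> E) -> (Lp nu p1 -> Lp nu p1)),
    [/\ contractive_rep pi0, nondegenerate pi0 &
        x = opnorm_for (@lpZ_norm (Lp nu p1))
          (integrated (@regular_w (Lp nu p1)) (regular_pi pi0) a)]].

Definition Fp := hausdorff_completion Cc Cc_mul full_norm.
Definition Fp_r := hausdorff_completion Cc Cc_mul reduced_norm.

Definition is_kappa_r (F : Fp) (Fr : Fp_r) (kappa : F -> Fr) :=
  [/\ linear kappa,
      forall x y, kappa (hc_mul F x y) = hc_mul Fr (kappa x) (kappa y),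
      forall x, `|kappa x| <= `|x| &
      forall a, Cc a -> kappa (hc_in F a) = hc_in Fr a].

End CrossedProducts.

Section TensorOperators.
Context d (T : measurableType d) (R : realType).
Variables (mu : {measure set T -> \bar R}) (p : R) (p1 : 1 <= p).

(* The class of f if f is in L^p, and 0 otherwise. *)
Definition Lp_of (f : T -> R[i]) : Lp mu p1 :=
  if pselect (in_Lp mu p f) is left h
  then \pi_(Lp mu p1)%qT (MkLpFun h) else 0.

Context d1 (T1 : measurableType d1) (mu1 : {measure set T1 -> \bar R}).
Context d2 (T2 : measurableType d2) (mu2 : {measure set T2 -> \bar R}).

(* c is a (x) b when T is identified with T1 * T2 by x |-> (e1 x, e2 x). *)
Definition is_tensor (e1 : T -> T1) (e2 : T -> T2)
    (a : Lp mu1 p1 -> Lp mu1 p1) (b : Lp mu2 p1 -> Lp mu2 p1)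
    (c : Lp mu p1 -> Lp mu p1) :=
  forall (f : Lp mu1 p1) (g : Lp mu2 p1),
    c (Lp_of (fun x => f (e1 x) * g (e2 x))) =
    Lp_of (fun x => a f (e1 x) * b g (e2 x)).

End TensorOperators.

Section StabilizedUHF.
Context (R : realType) (p : R) (p1 : 1 <= p) (d : nat) (hd : (1 < d)%N).
Local Notation Z := (Zset hd).
Local Notation X0 := (X0 hd).

Local Notation lp_nat := (Lp (@counting nat R) p1).
Local Notation LpX0 := (Lp (mu0 hd R) p1).

Definition lambda (r : nat) : {measure set (r.-tuple Z) -> \bar R} :=
  mscale (d%:R ^- r)%:nng (@counting (r.-tuple Z) R).

Definition matrix_unit (j k : nat) (xi : lp_nat) : lp_nat :=
  Lp_of _ p1 (fun i => (i == j)%:R * xi k).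

Definition Mbar : set (lp_nat -> lp_nat) :=
  opclosure (lspan [set e | exists j k, e = matrix_unit j k]).

Definition take_seq (r : nat) (x : X0) : r.-tuple Z := [tuple x i | i < r].
Definition drop_seq (r : nat) (x : X0) : X0 := fun i => x (r + i)%N.

(* X_r is X0, the coordinate r + i being renumbered i; c = a (x) 1. *)
Definition D_ (r : nat) : set (LpX0 -> LpX0) :=
  [set c | bounded_operator c /\
    exists2 a : Lp (lambda r) p1 -> Lp (lambda r) p1, bounded_operator a &
      is_tensor (take_seq r) (drop_seq r) a (@id LpX0) c].

Definition D : set (LpX0 -> LpX0) :=
  opclosure (\bigcup_(r in [set r | (1 <= r)%N]) D_ r).

Definition muX : {measure set (nat * X0) -> \bar R} :=
  (@counting nat R \x mu0 hd R)%E.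
Local Notation LpX := (Lp muX p1).

Definition B : set (LpX -> LpX) :=
  opclosure (lspan [set c | bounded_operator c /\
    exists a b, [/\ Mbar a, D b & is_tensor fst snd a b c]]).

Definition h (x : nat * X0) : nat * X0 :=
  (x.1 %/ d, fun i => if i is j.+1 then x.2 j
                      else Ordinal (ltn_pmod x.1 (ltnW hd)))%N.

Definition h_inv (x : nat * X0) : nat * X0 :=
  (d * x.1 + x.2 0, fun i => x.2 i.+1)%N.

Lemma hK : cancel h h_inv.
Proof.
by move=> [m x]; rewrite /h/h_inv/= mulnC -divn_eq.
Qed.

Lemma h_invK : cancel h_inv h.
Proof.
move=> [m x]; rewrite /h/h_inv/=; have xd : (x 0%N < d)%N := ltn_ord (x 0%N : 'I_d).
congr pair.
  by rewrite mulnC divnMDl ?divn_small ?addn0// ltnW.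
apply/funext => -[|i]//; apply: val_inj => /=.
by rewrite mulnC modnMDl modn_small.
Qed.

Definition v (xi : LpX) : LpX :=
  Lp_of _ p1 (fun x => (d%:R `^ p^-1)%:C%C * xi (h_inv x)).

Definition v_inv (xi : LpX) : LpX :=
  Lp_of _ p1 (fun x => (d%:R `^ (- p^-1))%:C%C * xi (h x)).

(* beta is conjugation by v on all of L(L^p(X)); it maps B onto B. *)
Definition beta (b : LpX -> LpX) : LpX -> LpX := v \o b \o v_inv.
Definition beta_inv (b : LpX -> LpX) : LpX -> LpX := v_inv \o b \o v.

Definition beta_pow (n : int) : (LpX -> LpX) -> (LpX -> LpX) :=
  match n with
  | Posz k => iter k beta
  | Negz k => iter k.+1 beta_inv
  end.

End StabilizedUHF.
Arguments B {R p} p1 {d} hd _.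
Arguments beta_pow {R p} p1 {d} hd n _.

Section ShiftMeasure.
Context (R : realType) (d : nat) (hd : (1 < d)%N).
Local Notation Z := (Zset hd).
Local Notation X0 := (X0 hd).
Local Notation X := (nat * X0)%type.
Local Notation muX := (muX R hd).

Lemma measurable_cylinder r (w : nat -> Z) :
  measurable (cylinder r w : set X0).
Proof. by apply: sub_sigma_algebra; exists r, w. Qed.

Lemma measurable_coord i : measurable_fun setT (fun x : X0 => x i).
Proof.
move=> _ K _; rewrite setTI.
rewrite (_ : _ @^-1` _ = \bigcup_(t in [set t : i.+1.-tuple Z |
    K (nth point t i)]) cylinder i.+1 (nth point t)).
  by apply: fin_bigcup_measurable => // t _; exact: measurable_cylinder.
apply/seteqP; split => [x /= Kx|x [t /= Kt]]; last by rewrite /= => ->.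
exists [tuple x j | j < i.+1] => [|j ji] /=.
  by rewrite (nth_map ord0) ?size_enum_ord// nth_enum_ord.
by rewrite (nth_map ord0) ?size_enum_ord// nth_enum_ord.
Qed.

Lemma measurable_shift : measurable_fun setT (fun x : X0 => (fun i => x i.+1) : X0).
Proof.
apply: (@measurability _ _ _ X0 setT _ (@cylinders _ hd)) => // _ [_ [r [w ->]] <-].
rewrite setTI (_ : _ @^-1` _ =
    \bigcap_(i in `I_r) [set x : X0 | x i.+1 = w i]).
  apply: bigcap_measurableType => // i _.
  rewrite -[X in measurable X]setTI.
  exact: (@measurable_coord i.+1 measurableT [set w i]).
by apply/seteqP; split => x /=.
Qed.

Lemma measurable_h_inv : measurable_fun setT (@h_inv d hd).
Proof.
apply: measurable_fun_pair => //=.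
  pose f (y : nat * Z) : nat := (d * y.1 + y.2)%N.
  rewrite (_ : (fun x => _) = fun x : X => f (x.1, x.2 0%N))//.
  apply: (@measurableT_comp _ _ _ _ (nat * Z)%type _ f); last first.
    apply: measurable_fun_pair => //.
    exact: (measurableT_comp (measurable_coord 0)).
  move=> _ K _; rewrite setTI.
  rewrite (_ : _ @^-1` _ = \bigcup_k
    ([set m | K (f (m, k))] `*` [set k])); last first.
    apply/seteqP; split => [[m k]/= Kmk|[m k]/= [l _ /= [Kml ->]]]//.
    by exists k.
  by apply: fin_bigcup_measurable => // k _; exact: measurableX.
exact: (measurableT_comp measurable_shift).
Qed.

Lemma measurable_h : measurable_fun setT (@h d hd).
Proof.
apply: measurable_fun_pair => //=.
  by apply: (@measurableT_comp _ _ _ _ nat _ (divn^~ d)).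
apply: (@measurability _ _ _ X0 setT _ (@cylinders _ hd)) => // _ [_ [[|r] [w ->]] <-].
  by rewrite setTI (_ : _ @^-1` _ = setT)//; apply/seteqP.
rewrite setTI (_ : _ @^-1` _ =
  [set m | (m %% d)%N = w 0%N] `*` cylinder r (fun i => w i.+1)).
  by apply: measurableX => //; exact: measurable_cylinder.
apply/seteqP; split => [[m x] /= mx|[m x] /= [m0 mx]].
  split; first by rewrite -(mx 0%N).
  by move=> i ir; exact: (mx i.+1).
by move=> [|i] ir; [exact: val_inj|exact: mx].
Qed.

Let G : set (set X) :=
  [set A | A = set0 \/ exists m r w, A = [set m] `*` cylinder r w].

Let GE : @measurable _ X = <<s G >>.
Proof.
pose XG := g_sigma_algebraType G.
have GXG m r w : measurable ([set m] `*` cylinder r w : set XG).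
  by apply: sub_sigma_algebra; right; exists m, r, w.
have mfst : measurable_fun setT (fst : XG -> nat).
  move=> _ K _; rewrite setTI (_ : _ @^-1` _ =
     \bigcup_(m in K) ([set m] `*` cylinder 0 (point : nat -> Z)) :> set XG).
    by apply: bigcup_measurable.
  apply/seteqP; split => [[m x]/= Km|[m x] [n /= Kn [-> _]]]//.
  by exists m.
have msnd : measurable_fun setT (snd : XG -> X0).
  apply: (@measurability _ _ _ X0 setT _ (@cylinders _ hd)) => // _ [_ [r [w ->]] <-].
  rewrite setTI (_ : _ @^-1` _ =
     \bigcup_m ([set m] `*` cylinder r w) :> set XG).
    by apply: bigcup_measurable.
  apply/seteqP; split => [[m x]/= Km|[m x] [n /= _ [_ ?]]]//.
  by exists m.
rewrite measurable_prod_measurableType; apply/seteqP; split.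
  apply: smallest_sub; first exact: smallest_sigma_algebra.
  move=> _ [K mK [L mL <-]].
  rewrite (_ : _ `*` _ = (fst : XG -> nat) @^-1` K `&` (snd : XG -> X0) @^-1` L)//.
  apply: (@measurableI _ XG).
    by rewrite -[X in measurable X]setTI; exact: mfst.
  by rewrite -[X in measurable X]setTI; exact: msnd.
apply: smallest_sub; first exact: smallest_sigma_algebra.
move=> K [->|[m [r [w ->]]]].
  rewrite -measurable_prod_measurableType; exact: (@measurable0 _ X).
rewrite -measurable_prod_measurableType.
by apply: (@measurableX _ _ nat X0) => //; exact: measurable_cylinder.
Qed.

Let muXE m r w : muX ([set m] `*` cylinder r w) = (d%:R ^- r)%:E.
Proof.
transitivity ((@counting nat R [set m]) * mu0 hd R (cylinder r w))%E.
  apply: (product_measure1E (@counting nat R) (mu0 hd R)) => //.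
  exact: measurable_cylinder.
rewrite [X in (X * _)%E](_ : _ = 1%E); last first.
  by rewrite /counting asboolT// fset_set1 finmap.cardfs1.
by rewrite mul1e; exact: mu0P.
Qed.

Let muG (nu : {measure set X -> \bar R}) :
  (forall m r w, nu ([set m] `*` cylinder r w) = (d%:R ^- r.+1)%:E) ->
  forall K, measurable K -> nu K = ((d%:R^-1)%:E * muX K)%E.
Proof.
move=> nuE K mK.
have d0 : 0 <= d%:R^-1 :> R by rewrite invr_ge0.
pose mu' : {measure set X -> \bar R} := mscale (NngNum d0) muX.
rewrite -[RHS]/(mu' K).
apply: (measure_unique G (fun n => [set n] `*` cylinder 0 (point : nat -> Z))).
- exact: GE.
- move=> _ _ [->|[m1 [r1 [w1 ->]]]] [->|[m2 [r2 [w2 ->]]]];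
    rewrite ?set0I ?setI0; try by left.
  rewrite -setXI; have [h|/set0P[[m x] [[/= mm1 mm2] [xr1 xr2]]]] :=
    eqVneq (([set m1] `&` [set m2]) `*` (cylinder r1 w1 `&` cylinder r2 w2)) set0.
    by left.
  right; exists m, (maxn r1 r2), x; congr (_ `*` _).
    by apply/seteqP; split => y /= => [[]|->]; rewrite -mm1.
  apply/seteqP; split => y /=.
    move=> [y1 y2] i; rewrite leq_max => /orP[ir|ir].
      by rewrite y1// xr1.
    by rewrite y2// xr2.
  move=> h; split => i ir; rewrite h ?leq_max ?ir ?orbT//.
    exact: xr1.
  exact: xr2.
- by move=> n; right; exists n, 0%N, point.
- by apply/seteqP; split => // -[m x] _; exists m.
- move=> _ [->|[m [r [w ->]]]]; first by rewrite !measure0.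
  by rewrite nuE /mu' /= /mscale/= muXE -EFinM exprS invfM.
- by move=> k; rewrite nuE ltry.
- exact: mK.
Qed.

Let nu : set X -> \bar R := pushforward muX (@h_inv d hd).

Let nu0 : nu set0 = 0%E.
Proof. by rewrite /nu /pushforward preimage_set0 measure0. Qed.

Let nu_ge0 A : (0 <= nu A)%E.
Proof. by rewrite /nu /pushforward; apply: measure_ge0. Qed.

Let nu_sigma_additive : semi_sigma_additive nu.
Proof.
move=> F mF tF mUF; rewrite /nu /pushforward preimage_bigcup.
apply: measure_semi_sigma_additive.
- by move=> n; rewrite -[X in measurable X]setTI; exact: measurable_h_inv.
- apply/trivIsetP => /= i j _ _ ij; rewrite -preimage_setI.
  by move/trivIsetP : tF => /(_ _ _ _ _ ij) ->//; rewrite preimage_set0.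
- by rewrite -preimage_bigcup -[X in measurable X]setTI; exact: measurable_h_inv.
Qed.

HB.instance Definition _ := isMeasure.Build _ _ _ nu nu0 nu_ge0
  nu_sigma_additive.

Lemma muX_h_inv (K : set X) : measurable K ->
  muX (@h_inv d hd @^-1` K) = ((d%:R^-1)%:E * muX K)%E.
Proof.
move=> mK; apply: (muG (nu := nu)) => // m r w.
have md : (m %% d < d)%N by rewrite ltn_pmod// ltnW.
rewrite -(muXE (m %/ d)%N r.+1
  (fun i => if i is j.+1 then w j else Ordinal md : Z)).
congr (muX _); apply/seteqP; split => [[k x]|[k x]] /=.
  have xd : (x 0%N < d)%N := ltn_ord (x 0%N : 'I_d).
  move=> [mE xw]; split.
    by rewrite -mE mulnC divnMDl ?(ltnW hd)// divn_small// addn0.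
  move=> [|i] ir; last exact: xw.
  by apply: val_inj => /=; rewrite -mE mulnC modnMDl modn_small.
move=> [-> xw]; split; last by move=> i ir; exact: (xw i.+1).
by rewrite (xw 0%N)//= mulnC -divn_eq.
Qed.

Lemma muX_h (K : set X) : measurable K ->
  muX (@h d hd @^-1` K) = (d%:R%:E * muX K)%E.
Proof.
move=> mK.
have mhK : measurable (@h d hd @^-1` K).
  by rewrite -[X in measurable X]setTI; exact: measurable_h.
have dn0 : d%:R != 0 :> R by rewrite pnatr_eq0 -lt0n ltnW.
have := muX_h_inv mhK; rewrite -comp_preimage.
rewrite (_ : _ \o _ = id); last by apply/funext => x; exact: h_invK.
rewrite preimage_id => ->.
by rewrite muleA -EFinM mulfV// mul1e.
Qed.

End ShiftMeasure.

Section CompLp.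
Context d1 (T1 : measurableType d1) d2 (T2 : measurableType d2) (R : realType).
Variables (m1 : {measure set T1 -> \bar R}) (m2 : {measure set T2 -> \bar R}).
Variables (phi : T1 -> T2) (c : R) (p : R).
Hypothesis mphi : measurable_fun setT phi.
Hypothesis c0 : 0 <= c.
Hypothesis phiE : forall K, measurable K ->
  m1 (phi @^-1` K) = (c%:E * m2 K)%E.

Lemma ae_comp (P : T2 -> Prop) :
  {ae m2, forall y, P y} -> {ae m1, forall x, P (phi x)}.
Proof.
move=> [N [mN N0 PN]]; exists (phi @^-1` N); split.
- by rewrite -[X in measurable X]setTI; exact: mphi.
- by rewrite [LHS]phiE// N0 mule0.
- by move=> x /= Px; exact: PN.
Qed.

Lemma cLnorm_comp f : cmeasurable f ->
  cLnorm m1 p (f \o phi) = ((c `^ p^-1)%:E * cLnorm m2 p f)%E.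
Proof.
move=> mf; pose g y : \bar R := ((`|Normc.normc (f y)|%:E) `^ p)%E.
have mg : measurable_fun setT g.
  apply: (@measurableT_comp _ _ _ _ _ _ (@poweR R ^~ p)).
    exact: measurable_poweR.
  apply/measurable_EFinP; apply: measurableT_comp => //.
  exact: cmeasurable_normc.
have g0 y : (0 <= g y)%E by exact: poweR_ge0.
have -> : cLnorm m1 p (f \o phi) = ((\int[m1]_x (g \o phi) x) `^ p^-1)%E.
  by rewrite /cLnorm unlock.
have -> : cLnorm m2 p f = ((\int[m2]_x g x) `^ p^-1)%E.
  by rewrite /cLnorm unlock.
have -> : (\int[m1]_x (g \o phi) x = \int[mscale (NngNum c0) m2]_y g y)%E.
  rewrite -[LHS](ge0_integral_pushforward mphi m1 measurableT mg)//.
  by apply: eq_measure_integral => K mK _; exact: phiE.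
rewrite ge0_integral_mscale//= poweRM ?integral_ge0 ?lee_fin//.
Qed.

Lemma in_Lp_comp f : in_Lp m2 p f -> in_Lp m1 p (f \o phi).
Proof.
move=> [mf foo]; split.
  by case: mf => fr fi; split; [exact: (measurableT_comp fr mphi)|exact: (measurableT_comp fi mphi)].
by rewrite cLnorm_comp// lte_mul_pinfty// lee_fin powR_ge0.
Qed.

End CompLp.

Section VProperties.
Context (R : realType) (p : R) (p1 : 1 <= p) (d : nat) (hd : (1 < d)%N).
Local Notation LpX := (Lp (muX R hd) p1).
Local Notation cv := (d%:R `^ p^-1 : R).

Let p0 : 0 < p. Proof. exact: lt_le_trans p1. Qed.
Let d0 : 0 < d%:R :> R. Proof. by rewrite ltr0n ltnW. Qed.


Lemma Lp_ofE d' (T : measurableType d') (mu : {measure set T -> \bar R}) f :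
  in_Lp mu p f -> {ae mu, forall x, Lp_of mu p1 f x = f x}.
Proof. by rewrite /Lp_of => hf; case: pselect => // hf'; exact: Lp_piE. Qed.

Lemma vE (xi : LpX) : {ae muX R hd, forall x,
  v xi x = (d%:R `^ p^-1)%:C%C * xi (h_inv x)}.
Proof.
apply/Lp_ofE/in_LpZ => //; apply: (in_Lp_comp (c := d%:R^-1)) (LpFunP xi) => //.
- exact: measurable_h_inv.
- exact: muX_h_inv.
Qed.

Lemma v_invE (xi : LpX) : {ae muX R hd, forall x,
  v_inv xi x = (d%:R `^ (- p^-1))%:C%C * xi (h x)}.
Proof.
apply/Lp_ofE/in_LpZ => //; apply: (in_Lp_comp (c := d%:R)) (LpFunP xi) => //.
- exact: measurable_h.
- exact: muX_h.
Qed.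

Let cvV : ((d%:R `^ (- p^-1))%:C * (d%:R `^ p^-1)%:C)%C = 1 :> R[i].
Proof. by rewrite -rmorphM/= -powRD ?addNr ?powRr0// ?(gt_eqF d0) ?implybT. Qed.

Lemma vK : cancel (@v R p p1 d hd) (@v_inv R p p1 d hd).
Proof.
move=> xi; apply: Lp_ext.
have h1 := ae_comp (measurable_h (hd := hd)) (@muX_h R d hd) (vE xi).
apply: filterS2 (v_invE (v xi)) h1 => x -> ->.
by rewrite mulrA cvV mul1r hK.
Qed.

Lemma v_invK : cancel (@v_inv R p p1 d hd) (@v R p p1 d hd).
Proof.
move=> xi; apply: Lp_ext.
have h1 := ae_comp (measurable_h_inv (hd := hd)) (@muX_h_inv R d hd) (v_invE xi).
apply: filterS2 (vE (v_inv xi)) h1 => x -> ->.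
by rewrite mulrA [X in X * _]mulrC cvV mul1r h_invK.
Qed.

Lemma v_linear : linear (@v R p p1 d hd).
Proof.
move=> a xi eta; apply: Lp_ext.
have mh := measurable_h_inv (hd := hd); have mm := @muX_h_inv R d hd.
have h1 := ae_comp mh mm (LpDE (a *: xi) eta).
have h2 := ae_comp mh mm (LpZE a xi).
have h3 := LpDE (a *: v xi) (v eta); have h4 := LpZE a (v xi).
have h5 := vE (a *: xi + eta); have h6 := vE xi; have h7 := vE eta.
apply: filterS2 (filterI h1 (filterI h2 h5)) (filterI (filterI h3 h4) (filterI h6 h7)).
move=> x [e1 [e2 e5]] [[e3 e4] [e6 e7]].
by rewrite e5 e1 e2 e3 e4 e6 e7 mulrDr; congr (_ + _); rewrite mulrCA.
Qed.

Lemma v_isometric (xi : LpX) : rnorm (v xi) = rnorm xi.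
Proof.
have Er (eta : LpX) : rnorm eta = Lp_norm eta by [].
rewrite !Er; apply: EFin_inj; rewrite !Lp_normE.
have hxi := LpFunP xi.
have mh := measurable_h_inv (hd := hd).
have d0V : 0 <= d%:R^-1 :> R by rewrite invr_ge0 ltW.
have hc := in_Lp_comp mh d0V (@muX_h_inv R d hd) hxi.
rewrite (cLnorm_eq_ae p (LpFunP (v xi)).1 _ (vE xi)); last first.
  exact: (cmeasurableZ _ hc.1).
rewrite (cLnormZ p1 _ hc) (cLnorm_comp p mh d0V (@muX_h_inv R d hd) hxi.1).
rewrite muleA -EFinM [X in X%:E](_ : _ = 1) ?mul1e//.
rewrite /= expr0n addr0 sqrtr_sqr ger0_norm ?powR_ge0//.
by rewrite -powRM ?invr_ge0 ?ltW// mulfV ?gt_eqF// powR1.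
Qed.

End VProperties.

(* Main.v *)
(* Both seminorms on C_c(Z, B, beta) coincide because Z is amenable, and then
   the two completions are isometrically isomorphic over C_c(Z, B, beta).
   Full <= reduced: given a covariant pair (w, pi) and a vector x, evaluate the
   regular representation built from pi on the Folner vector
   eta(m) = w_{-m} x for 0 <= m < N + 2K, where [-K, K] contains the support
   of a.  On the middle N coordinates the result is w_{-m} (w |x pi)(a) x, so
   N ||(w |x pi)(a) x||^p <= (N + 2K) ||reg(a)||^p ||x||^p; let N tend to
   infinity.
   Reduced <= full: l^p(Z, L^p(nu)) is L^p(counting x nu), on which the regular
   pair is a nondegenerate contractive covariant representation.  This needs B
   to be an algebra invariant under beta and its inverse: B is the closure of
   the span of explicit matrix units e_{jk} (x) (u -> w), which beta and
   products permute up to finite sums. *)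
Require Import Defs.
From HB Require Import structures.
From mathcomp Require Import all_boot all_order all_algebra.
From mathcomp Require Import complex.
From mathcomp Require Import all_classical all_reals all_analysis.
From mathcomp Require Import measurable_realfun ring lra zify.

Set Implicit Arguments.
Unset Strict Implicit.
Unset Printing Implicit Defensive.

Import Order.TTheory GRing.Theory Num.Theory.
Import numFieldNormedType.Exports.

Local Open Scope classical_set_scope.
Local Open Scope ring_scope.

(** * Norms and bounded operators *)

(** Stability of B under [beta] cannot be read off its definition: conjugation by [v] moves one base
    d digit between the integer coordinate and the word, so the image of a (x) b is in general no
    elementary tensor. On matrix units the effect is explicit: the last digits of j and k are put in
    front of the two words, and j, k become j/d, k/d. Passing from a (x) b to matrix units needs ||a
    (x) b|| <= ||a|| ||b||, which holds because a acts fibrewise after Fubini and b acts slice by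
    slice. The Folner estimate rests on w being isometric, its inverses being contractive too, so
    that all coordinates of the test vector have the same norm. In the other direction the l^p sum
    must be the L^p space of a sigma-finite measure; the integers are enumerated by [nat] for this
    purpose. Elements of L^p are classes with chosen representatives, so every composition with a
    map of the base space must pull null sets back to null sets; [push_le] records this together
    with a norm bound. *)

Section Rnorm.
Context (R : realType) (E : normedModType R[i]).
Implicit Types x y : E.

Lemma normE x : `|x| = (rnorm x)%:C%C.
Proof.
have := normr_ge0 x; rewrite /rnorm; case: `|x| => a b.
by rewrite lecE /= => /andP[/eqP -> _].
Qed.

Lemma rnorm_ge0 x : 0 <= rnorm x.
Proof. by have := normr_ge0 x; rewrite normE lecR. Qed.

Lemma rnorm0 : rnorm (0 : E) = 0.
Proof. by rewrite /rnorm normr0. Qed.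

Lemma rnorm0_eq0 x : rnorm x = 0 -> x = 0.
Proof. by move=> h; apply/normr0_eq0; rewrite normE h. Qed.

Lemma rnormD x y : rnorm (x + y) <= rnorm x + rnorm y.
Proof. by have := ler_normD x y; rewrite !normE -rmorphD/= lecR. Qed.

Lemma rnormZ a x : rnorm (a *: x) = Normc.normc a * rnorm x.
Proof.
have := normrZ a x; rewrite !normE.
by rewrite (_ : `|a| = (Normc.normc a)%:C%C)// -rmorphM/= => -[].
Qed.

Lemma rnormN x : rnorm (- x) = rnorm x.
Proof. by rewrite /rnorm normrN. Qed.

Lemma rnormBC x y : rnorm (x - y) = rnorm (y - x).
Proof. by rewrite -rnormN opprB. Qed.

Lemma rnormB x y : rnorm (x - y) <= rnorm x + rnorm y.
Proof. by rewrite -[in leRHS](rnormN y); exact: rnormD. Qed.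

Lemma rnorm_tri z x y : rnorm (x - y) <= rnorm (x - z) + rnorm (z - y).
Proof.
rewrite [in leLHS](_ : x - y = (x - z) + (z - y)) ?rnormD//.
by rewrite addrA subrK.
Qed.

Lemma rnorm_sum (I : Type) (s : seq I) (f : I -> E) :
  rnorm (\sum_(i <- s) f i) <= \sum_(i <- s) rnorm (f i).
Proof.
elim: s => [|i s IH]; first by rewrite !big_nil rnorm0.
by rewrite !big_cons (le_trans (rnormD _ _))// lerD2l.
Qed.

Lemma closure_rnormP (S : set E) x :
  closure S x <-> forall e : R, 0 < e -> exists2 y, S y & rnorm (x - y) < e.
Proof.
split=> [cSx e e0|h].
  have e0' : 0 < e%:C%C by rewrite ltcR.
  have [y [Sy /=]] := cSx _ (nbhsx_ballx x _ e0').
  by rewrite -ball_normE/= normE ltcR => xy; exists y.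
move=> V /nbhs_ballP[[a b] /= ab0 xV].
(* The norm takes values in R[i], and a positive element of R[i] is real; complex radii thus reduce
   to real ones. *)
have [b0 a0] : b = 0 /\ 0 < a.
  by move: ab0; rewrite ltcE /= => /andP[/eqP -> ->].
have [y Sy xy] := h a a0; exists y; split => //; apply: xV.
by rewrite -ball_normE/= normE b0 ltcR.
Qed.

End Rnorm.

Section Operators.
Context (R : realType) (E : normedModType R[i]).
Implicit Types f g : E -> E.

Lemma lin0 (U V : lmodType R[i]) (f : U -> V) : linear f -> f 0 = 0.
Proof.
move=> lf; have := lf 1 0 0; rewrite !scale1r addr0 => h.
by apply: (addrI (f 0)); rewrite -h addr0.
Qed.

Lemma linD (U V : lmodType R[i]) (f : U -> V) : linear f ->
  {morph f : x y / x + y}.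
Proof. by move=> lf x y; have := lf 1 x y; rewrite !scale1r. Qed.

Lemma linZ (U V : lmodType R[i]) (f : U -> V) : linear f ->
  forall a, {morph f : x / a *: x}.
Proof. by move=> lf a x; have := lf a x 0; rewrite (lin0 lf) !addr0. Qed.

Lemma linB (U V : lmodType R[i]) (f : U -> V) : linear f ->
  {morph f : x y / x - y}.
Proof.
move=> lf x y; rewrite (linD lf) -scaleN1r (linZ lf).
by rewrite scaleN1r.
Qed.

Lemma lin_sum (U V : lmodType R[i]) (f : U -> V) : linear f ->
  forall (I : Type) (s : seq I) (g : I -> U),
  f (\sum_(i <- s) g i) = \sum_(i <- s) f (g i).
Proof.
move=> lf I s g; elim: s => [|i s IH]; first by rewrite !big_nil (lin0 lf).
by rewrite !big_cons (linD lf) IH.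
Qed.

Definition bound_by (U V : normedModType R[i]) (C : R) (f : U -> V) :=
  forall x, rnorm (f x) <= C * rnorm x.

Lemma bounded_operatorP f :
  bounded_operator f <-> linear f /\ exists2 C : R, 0 <= C & bound_by C f.
Proof.
split=> [[lf cf]|[lf [C C0 fC]]]; split => //.
  have H0 := lin0 lf.
  have := cf 0; rewrite /continuous_at H0 => /cvgrPdist_lt /(_ 1 ltr01).
  move=> /nbhs_ballP[[a b] /= ab0 xV].
  have [b0 a0] : b = 0 /\ 0 < a.
    by move: ab0; rewrite ltcE /= => /andP[/eqP -> ->].
  (* Vectors of norm a/2 lie in the ball of radius a, which f maps into the unit ball; homogeneity
     gives the constant 2/a. *)
  subst b; exists (2 / a); first by rewrite divr_ge0// ltW.
  move=> x; have [x0|x0] := eqVneq (rnorm x) 0.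
    by rewrite (rnorm0_eq0 x0) H0 !rnorm0 mulr0.
  have x1 : 0 < rnorm x by rewrite lt_neqAle eq_sym x0 rnorm_ge0.
  pose t := a / (2 * rnorm x).
  have t0 : 0 < t by rewrite divr_gt0// mulr_gt0.
  have := xV (t%:C%C *: x); rewrite -ball_normE/= !sub0r !normrN !normE.
  rewrite (linZ lf) !rnormZ /= expr0n/= addr0 sqrtr_sqr (ger0_norm (ltW t0)).
  rewrite !ltcR => h; have {}h : t * rnorm (f x) < 1.
    apply: h; rewrite (_ : t * _ = a / 2); last by rewrite /t; field.
    by rewrite ltr_pdivrMr// mulr_natr mulr2n ltrDl.
  rewrite -(ler_pM2l t0) (le_trans (ltW h))// /t.
  by rewrite le_eqVlt; apply/orP; left; apply/eqP; field; rewrite x0 gt_eqF.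
have Hf : GRing.linear_for *:%R f by [].
pose g : {linear E -> E} := HB.pack f (GRing.isLinear.Build _ _ _ _ f Hf).
apply: (@bounded_linear_continuous _ _ _ g); apply/linear_boundedP.
exists C%:C%C; split; first by rewrite realE; apply/orP; left; rewrite lecR.
move=> M CM x; rewrite !normE; apply: le_trans (_ : C%:C%C * (rnorm x)%:C%C <= _).
  by rewrite -rmorphM/= lecR; exact: fC.
by apply: ler_wpM2r; [rewrite lecR rnorm_ge0|exact: ltW].
Qed.

Lemma opnorm_ge0 f : (0 <= opnorm (f : E -> E))%E.
Proof.
apply: le_trans (_ : ((rnorm (f 0))%:E <= _)%E); first by rewrite lee_fin rnorm_ge0.
by apply: ereal_sup_ubound; exists 0 => //=; rewrite rnorm0 lee_fin.
Qed.

Lemma opnorm_le C f : 0 <= C -> bound_by C f -> (opnorm f <= C%:E)%E.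
Proof.
move=> C0 fC; apply: ge_ereal_sup => _ [x /= x1 <-]; rewrite lee_fin.
apply: (le_trans (fC x)); rewrite -[leRHS]mulr1 ler_wpM2l//.
Qed.

Lemma bound_opnorm C f : linear f -> (opnorm f <= C%:E)%E -> bound_by C f.
Proof.
move=> lf fC x; have [x0|x0] := eqVneq (rnorm x) 0.
  by rewrite x0 mulr0 (rnorm0_eq0 x0) (lin0 lf) rnorm0.
have x1 : 0 < rnorm x by rewrite lt_neqAle eq_sym x0 rnorm_ge0.
have V0 : 0 <= (rnorm x)^-1 by rewrite invr_ge0 ltW.
pose y := (rnorm x)^-1%:C%C *: x.
have y1 : rnorm y = 1.
  by rewrite /y rnormZ /= expr0n/= addr0 sqrtr_sqr ger0_norm// mulVf.
have : ((rnorm (f y))%:E <= C%:E)%E.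
  by apply: le_trans fC; apply: ereal_sup_ubound; exists y => //=; rewrite y1.
rewrite lee_fin /y (linZ lf) rnormZ /= expr0n/= addr0 sqrtr_sqr ger0_norm//.
by rewrite mulrC ler_pdivrMr.
Qed.

Lemma opnorm_fin f : bounded_operator f ->
  exists2 C, opnorm f = C%:E & 0 <= C /\ bound_by C f.
Proof.
move=> /bounded_operatorP[lf [C C0 fC]].
have := opnorm_le C0 fC; have := opnorm_ge0 f.
case E0: (opnorm f) => [r| |]//; rewrite !lee_fin => r0 _.
by exists r => //; split => //; apply: bound_opnorm => //; rewrite E0.
Qed.

End Operators.

(** * Operator norm closures and linear spans *)

Section OperatorClosure.
Context (R : realType) (E : normedModType R[i]).
Implicit Types (f g : E -> E) (S : set (E -> E)).

Lemma linear_comp f g : linear f -> linear g -> linear (f \o g).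
Proof. by move=> lf lg a x y /=; rewrite lg lf. Qed.

Lemma linear_lin a f g : linear f -> linear g -> linear (a *: f + g).
Proof.
move=> lf lg b x y.
rewrite -[LHS]/(a *: f (b *: x + y) + g (b *: x + y)).
rewrite -[RHS]/(b *: (a *: f x + g x) + (a *: f y + g y)).
rewrite lf lg !scalerDr !scalerA [a * b]mulrC.
by rewrite addrACA.
Qed.

Lemma linear_sub f g : linear f -> linear g -> linear (f - g).
Proof. by move=> lf lg; rewrite -scaleN1r addrC; exact: linear_lin. Qed.

Lemma bound_comp C D f g : 0 <= C -> bound_by C f -> bound_by D g ->
  bound_by (C * D) (f \o g).
Proof.
by move=> C0 fC gD x /=; rewrite (le_trans (fC _))// -mulrA ler_wpM2l.
Qed.

Lemma bound_lin a C D f g : bound_by C f -> bound_by D g ->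
  bound_by (Normc.normc a * C + D) (a *: f + g).
Proof.
move=> fC gD x; rewrite -[X in rnorm X]/(a *: f x + g x).
rewrite (le_trans (rnormD _ _))// mulrDl lerD// rnormZ -mulrA.
by rewrite ler_wpM2l ?normc_ge0.
Qed.

Lemma bounded_operator_comp f g :
  bounded_operator f -> bounded_operator g -> bounded_operator (f \o g).
Proof.
move=> /bounded_operatorP[lf [C C0 fC]] /bounded_operatorP[lg [D D0 gD]].
apply/bounded_operatorP; split; first exact: linear_comp.
by exists (C * D); [exact: mulr_ge0|exact: bound_comp].
Qed.

Lemma bounded_operator_lin a f g :
  bounded_operator f -> bounded_operator g -> bounded_operator (a *: f + g).
Proof.
move=> /bounded_operatorP[lf [C C0 fC]] /bounded_operatorP[lg [D D0 gD]].
apply/bounded_operatorP; split; first exact: linear_lin.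
by exists (Normc.normc a * C + D); [rewrite addr_ge0// mulr_ge0// normc_ge0|
  exact: bound_lin].
Qed.

Lemma bounded_operator_id : bounded_operator (@id E).
Proof. by split=> // x; exact: cvg_id. Qed.

Lemma bounded_operator0 : bounded_operator (0 : E -> E).
Proof.
apply/bounded_operatorP; split.
  by move=> a x y; rewrite -[RHS]/(a *: 0 + 0 : E) scaler0 addr0.
by exists 0 => // x; rewrite mul0r -[X in rnorm X]/(0 : E) rnorm0.
Qed.

(** Linearity of the members of S makes an estimate on the unit ball homogeneous, so real constants
    can replace extended real norms in the approximation arguments. *)
Lemma opclosureP S f : (forall g, S g -> linear g) ->
  opclosure S f <-> bounded_operator f /\
    forall e : R, 0 < e -> exists2 g, S g & bound_by e (f - g).
Proof.
move=> lS; split=> [[bf fS]|[bf fS]]; split=> // e e0.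
  have [g Sg fg] := fS e e0; exists g => //.
  by apply: bound_opnorm (ltW fg); apply: linear_sub (lS _ Sg); case: bf.
have e20 : 0 < e / 2 by rewrite divr_gt0.
have [g Sg fg] := fS (e / 2) e20; exists g => //.
apply: le_lt_trans (opnorm_le (ltW e20) fg) _.
by rewrite lte_fin ltr_pdivrMr// mulr_natr mulr2n ltrDl.
Qed.

Lemma opclosure_sub S : S `<=` @bounded_operator R E -> S `<=` opclosure S.
Proof.
move=> bS f Sf; apply/opclosureP; first by move=> g /bS[].
split; first exact: bS.
move=> e e0; exists f => // x; rewrite subrr -[X in rnorm X]/(0 : E) rnorm0.
by rewrite mulr_ge0 ?rnorm_ge0 ?ltW.
Qed.

Lemma opclosure_idem S T : S `<=` opclosure T -> (forall g, T g -> linear g) ->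
  opclosure S `<=` opclosure T.
Proof.
move=> ST lT f; have lS : forall g, S g -> linear g by move=> g /ST[[]].
move=> /(opclosureP _ lS)[bf fS]; apply/opclosureP => //; split => // e e0.
have e20 : 0 < e / 2 by rewrite divr_gt0.
have [g Sg fg] := fS _ e20.
have /(opclosureP _ lT)[_ /(_ _ e20)[k Tk gk]] := ST _ Sg.
exists k => // x; apply: le_trans (rnorm_tri (g x) _ _) _.
by rewrite [e]splitr mulrDl; apply: lerD; [exact: fg|exact: gk].
Qed.

Lemma opclosure_lin S : S `<=` @bounded_operator R E ->
  (forall a f g, S f -> S g -> S (a *: f + g)) ->
  forall a f g, opclosure S f -> opclosure S g -> opclosure S (a *: f + g).
Proof.
move=> bS Slin a f g; have lS : forall g, S g -> linear g by move=> k /bS[].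
move=> /(opclosureP _ lS)[bf fS] /(opclosureP _ lS)[bg gS].
apply/opclosureP => //; split; first exact: bounded_operator_lin.
move=> e e0; pose c := Normc.normc a + 1.
have c0 : 0 < c by rewrite ltr_wpDl// normc_ge0.
have ec0 : 0 < e / c / 2 by rewrite !divr_gt0.
have [f' Sf' ff'] := fS _ ec0; have [g' Sg' gg'] := gS _ ec0.
exists (a *: f' + g'); first exact: Slin.
have -> : a *: f + g - (a *: f' + g') = a *: (f - f') + (g - g').
  by rewrite scalerBr opprD addrACA.
move=> x; apply: (le_trans (bound_lin a ff' gg' x)).
rewrite ler_wpM2r ?rnorm_ge0// -[X in _ + X]mul1r -mulrDl -/c mulrCA.
rewrite (_ : e / c * _ = e / 2); last by field; rewrite gt_eqF.
by rewrite ler_pdivrMr// mulr_natr mulr2n lerDl ltW.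
Qed.

Lemma opclosure_comp S : S `<=` @bounded_operator R E ->
  (forall f g, S f -> S g -> S (f \o g)) ->
  forall f g, opclosure S f -> opclosure S g -> opclosure S (f \o g).
Proof.
move=> bS Sc f g; have lS : forall g, S g -> linear g by move=> k /bS[].
move=> /(opclosureP _ lS)[bf fS] /(opclosureP _ lS)[bg gS].
apply/opclosureP => //; split; first exact: bounded_operator_comp.
move=> e e0.
have /bounded_operatorP[lf [C C0 fC]] := bf.
have /bounded_operatorP[lg [D D0 gD]] := bg.
have e20 : 0 < e / 2 by rewrite divr_gt0.
have D10 : 0 < D + 1 by rewrite ltr_wpDl.
(* The splitting fg - f'g' = (f - f')g + f'(g - g') makes the tolerance for g depend on a bound for
   f', so f' is chosen before g'. Adding 1 avoids a division by 0. *)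
have eD0 : 0 < e / 2 / (D + 1) by rewrite divr_gt0.
have [f' Sf' ff'] := fS _ eD0.
have /bounded_operatorP[lf' [C' C'0 f'C]] := bS _ Sf'.
have C10 : 0 < C' + 1 by rewrite ltr_wpDl.
have eC0 : 0 < e / 2 / (C' + 1) by rewrite divr_gt0.
have [g' Sg' gg'] := gS _ eC0.
exists (f' \o g'); first exact: Sc.
move=> x; apply: le_trans (rnorm_tri (f' (g x)) _ _) _ => /=.
rewrite [leRHS](_ : _ = e / 2 * rnorm x + e / 2 * rnorm x); last first.
  by rewrite -mulrDl -splitr.
apply: lerD.
  apply: le_trans (ff' (g x)) _; rewrite mulrAC ler_pdivrMr//.
  rewrite -[leRHS]mulrA ler_pM2l// mulrC.
  apply: le_trans (gD x) _; rewrite ler_wpM2r ?rnorm_ge0//.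
  by rewrite lerDl.
rewrite -(linB lf'); apply: le_trans (f'C _) _.
apply: le_trans (_ : (C' + 1) * rnorm (g x - g' x) <= _).
  by rewrite ler_wpM2r ?rnorm_ge0// lerDl.
rewrite -ler_pdivlMl//; apply: le_trans (gg' x) _.
by rewrite mulrA [_^-1 * _]mulrC.
Qed.

Lemma lspan_sub (V : lmodType R[i]) (S : set V) : S `<=` lspan S.
Proof.
move=> x Sx; exists 1%N, (fun=> 1), (fun=> x); split => //.
by rewrite big_ord1 scale1r.
Qed.

Lemma lspan0 (V : lmodType R[i]) (S : set V) : lspan S 0.
Proof.
exists 0%N, (fun=> 0), (fun=> 0); split; first by case.
by rewrite big_ord0.
Qed.

Lemma lspan_lin (V : lmodType R[i]) (S : set V) a x y :
  lspan S x -> lspan S y -> lspan S (a *: x + y).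
Proof.
move=> [n [c [s [Ss ->]]]] [m [c' [s' [Ss' ->]]]].
exists (n + m)%N,
  (fun i => match fintype.split i with inl j => a * c j | inr j => c' j end),
  (fun i => match fintype.split i with inl j => s j | inr j => s' j end).
split; first by move=> i; case: (fintype.split i).
rewrite big_split_ord/= scaler_sumr; congr (_ + _).
  by apply: eq_bigr => i _; rewrite (unsplitK (inl i)) scalerA.
by apply: eq_bigr => i _; rewrite (unsplitK (inr i)).
Qed.

Lemma lspan_min (V : lmodType R[i]) (S T : set V) : S `<=` T -> T 0 ->
  (forall a x y, T x -> T y -> T (a *: x + y)) -> lspan S `<=` T.
Proof.
move=> ST T0 Tlin x [n [c [s [Ss ->]]]].
elim/big_rec: _ => // i y _ Ty; apply: Tlin => //; exact: ST.
Qed.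

Lemma lspan_sum (V : lmodType R[i]) (S : set V) (I : Type) (s : seq I)
    (f : I -> V) : (forall i, lspan S (f i)) -> lspan S (\sum_(i <- s) f i).
Proof.
move=> Sf; elim/big_rec: _ => [|i y _ Sy]; first exact: lspan0.
by rewrite -[f i]scale1r; exact: lspan_lin.
Qed.

Lemma lspan_comp (S : set (E -> E)) : (forall g, S g -> linear g) ->
  (forall f g, S f -> S g -> lspan S (f \o g)) ->
  forall f g, lspan S f -> lspan S g -> lspan S (f \o g).
Proof.
move=> lS Sc f g Sf Sg; move: f Sf; apply: lspan_min; last 2 first.
- by rewrite (_ : _ \o _ = 0)//; exact: lspan0.
- move=> a f1 f2 h1 h2; rewrite (_ : _ \o _ = a *: (f1 \o g) + (f2 \o g))//.
  exact: lspan_lin.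
move=> f Sf; move: g Sg; apply: lspan_min => [g Sg||a g1 g2 h1 h2].
- exact: Sc.
- rewrite (_ : _ \o _ = 0); first exact: lspan0.
  by apply/funext => x /=; rewrite -[0 x]/(0 : E) (lin0 (lS _ Sf)).
- rewrite (_ : _ \o _ = a *: (f \o g1) + (f \o g2)); first exact: lspan_lin.
  by apply/funext => x; exact: lS.
Qed.

End OperatorClosure.

(** * Isometric completions *)

Section CompletionExtension.
Context (R : realType) (V : lmodType R[i]) (A : set V) (mul : V -> V -> V).
Context (N1 N2 : V -> \bar R).
Variables (F1 : hausdorff_completion A mul N1)
  (F2 : hausdorff_completion A mul N2).
Hypothesis Alin : forall c a b, A a -> A b -> A (c *: a + b).
Hypothesis Amul : forall a b, A a -> A b -> A (mul a b).
Hypothesis NE : forall a, A a -> N1 a = N2 a.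

(* The closure of the graph of hc_in F1 a |-> hc_in F2 a. *)
Definition common_approx (x : F1) (y : F2) := forall e : R, 0 < e ->
  exists2 a, A a & rnorm (x - hc_in F1 a) < e /\ rnorm (y - hc_in F2 a) < e.

Lemma hc_inB N (F : hausdorff_completion A mul N) a b : A a -> A b ->
  hc_in F a - hc_in F b = hc_in F (-1 *: b + a).
Proof. by move=> Aa Ab; rewrite hc_inP// scaleN1r addrC. Qed.

Lemma hc_in_isometry a b : A a -> A b ->
  rnorm (hc_in F1 a - hc_in F1 b) = rnorm (hc_in F2 a - hc_in F2 b).
Proof.
move=> Aa Ab; rewrite !hc_inB//; have Aab := Alin (-1) Ab Aa.
by apply: EFin_inj; rewrite !hc_in_norm// NE.
Qed.

Lemma common_approx_in a : A a -> common_approx (hc_in F1 a) (hc_in F2 a).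
Proof. by move=> Aa e e0; exists a => //; rewrite !subrr !rnorm0. Qed.

Lemma common_approx_isometry x y x' y' :
  common_approx x y -> common_approx x' y' -> rnorm (x - x') = rnorm (y - y').
Proof.
move=> xy xy'; apply/eqP; rewrite eq_le; apply/andP; split;
  apply/ler_addgt0Pr => /= e e0; have e40 : 0 < e / 4 by rewrite divr_gt0.
- have [a Aa [xa ya]] := xy _ e40; have [b Ab [xb yb]] := xy' _ e40.
  have h1 := rnorm_tri (hc_in F1 a) x x'.
  have h2 := rnorm_tri (hc_in F1 b) (hc_in F1 a) x'.
  have h3 := rnorm_tri y (hc_in F2 a) (hc_in F2 b).
  have h4 := rnorm_tri y' y (hc_in F2 b).
  move: h1 h2 h3 h4.
  rewrite (hc_in_isometry Aa Ab) (rnormBC (hc_in F2 a) y) (rnormBC (hc_in F1 b) x').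
  lra.
- have [a Aa [xa ya]] := xy _ e40; have [b Ab [xb yb]] := xy' _ e40.
  have h1 := rnorm_tri (hc_in F2 a) y y'.
  have h2 := rnorm_tri (hc_in F2 b) (hc_in F2 a) y'.
  have h3 := rnorm_tri x (hc_in F1 a) (hc_in F1 b).
  have h4 := rnorm_tri x' x (hc_in F1 b).
  move: h1 h2 h3 h4.
  rewrite -(hc_in_isometry Aa Ab) (rnormBC (hc_in F1 a) x) (rnormBC (hc_in F2 b) y').
  lra.
Qed.

(** Approximants from A converging to x in F1 form a Cauchy sequence in F2, because the two
    seminorms agree on A; completeness of F2 gives the limit. *)
Lemma common_approx_exists x : exists y, common_approx x y.
Proof.
have h n : exists a, A a /\ rnorm (x - hc_in F1 a) < n.+1%:R^-1.
  have : closure (hc_in F1 @` A) x by rewrite hc_in_dense.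
  move=> /closure_rnormP/(_ n.+1%:R^-1)[|_ [a Aa <-] xa]; first by rewrite invr_gt0.
  by exists a.
have [a aP] := choice h; pose u n := hc_in F2 (a n).
have uE n m : rnorm (u n - u m) < n.+1%:R^-1 + m.+1%:R^-1.
  rewrite -hc_in_isometry; [|exact: (aP _).1|exact: (aP _).1].
  have h1 := rnorm_tri x (hc_in F1 (a n)) (hc_in F1 (a m)).
  apply: le_lt_trans h1 _; rewrite rnormBC ltrD//; [exact: (aP _).2|exact: (aP _).2].
have small (e : R) : 0 < e -> exists N, forall n, (N <= n)%N -> n.+1%:R^-1 < e.
  move=> e0; exists (Num.truncn e^-1) => n Nn.
  rewrite invf_plt ?posrE//.
  apply: lt_le_trans (truncnS_gt _) _; by rewrite ler_nat.
have cu : cvg (u @ \oo).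
  apply/cauchy_cvgP/cauchy_exP => -[e b] /= e0.
  have [b0 e1] : b = 0 /\ 0 < e.
    by move: e0; rewrite ltcE /= => /andP[/eqP -> ->].
  have [N NP] := small (e / 2) (divr_gt0 e1 (ltr0n _ 2)).
  exists (u N); exists N => // n /= Nn.
  rewrite -ball_normE/= normE b0 ltcR (lt_le_trans (uE _ _))// [leRHS]splitr.
  by rewrite lerD// ltW// NP.
exists (lim (u @ \oo)) => e e0.
have e20 : 0 < e / 2 by rewrite divr_gt0.
have [N NP] := small _ e0.
have e0' : 0 < e%:C%C by rewrite ltcR.
have /cvgrPdist_lt /(_ _ e0') [M _ MP] := cu.
exists (a (maxn N M)); first exact: (aP _).1.
split; first by apply: lt_trans (aP _).2 _; rewrite NP// leq_maxl.
by have := MP (maxn N M) (leq_maxr _ _); rewrite /= normE ltcR.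
Qed.

Lemma common_approx_lin c x y x' y' : common_approx x y ->
  common_approx x' y' -> common_approx (c *: x + x') (c *: y + y').
Proof.
move=> xy xy' e e0; pose k := Normc.normc c + 1.
have k0 : 0 < k by rewrite ltr_wpDl// normc_ge0.
have ek0 : 0 < e / k by rewrite divr_gt0.
have [a Aa [xa ya]] := xy _ ek0; have [b Ab [xb yb]] := xy' _ ek0.
have est (F : normedModType R[i]) (u u' v v' : F) : rnorm (u - u') < e / k ->
    rnorm (v - v') < e / k -> rnorm (c *: u + v - (c *: u' + v')) < e.
  move=> h1 h2; rewrite opprD addrACA -scalerBr.
  apply: le_lt_trans (rnormD _ _) _; rewrite rnormZ.
  apply: (@lt_le_trans _ _ (Normc.normc c * (e / k) + e / k)).
    by rewrite ler_ltD// ler_wpM2l ?normc_ge0// ltW.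
  by rewrite -[X in _ + X]mul1r -mulrDl -/k mulrC divfK// gt_eqF.
exists (c *: a + b); first exact: Alin.
by rewrite !hc_inP//; split; exact: est.
Qed.

Lemma common_approx_mul x y x' y' : common_approx x y ->
  common_approx x' y' -> common_approx (hc_mul F1 x x') (hc_mul F2 y y').
Proof.
move=> xy xy' e e0.
(* [k] exceeds ||u|| + ||v|| + 1 for both pairs at once. With t <= 1, the norm of uv - u'v' is at
   most (||u|| + ||v|| + 1) t < k t <= e. *)
pose k := rnorm x + rnorm x' + rnorm y + rnorm y' + 2.
have r0 := @rnorm_ge0 R.
have k0 : 0 < k.
  have := r0 _ x; have := r0 _ x'; have := r0 _ y; have := r0 _ y'.
  by rewrite /k; lra.
pose t := Num.min 1 (e / k).
have t0 : 0 < t by rewrite lt_min ltr01 divr_gt0.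
have [a Aa [xa ya]] := xy _ t0; have [b Ab [xb yb]] := xy' _ t0.
have est N (F : hausdorff_completion A mul N) (u u' v v' : F) :
    rnorm (u - u') < t -> rnorm (v - v') < t -> rnorm u + rnorm v + 1 < k ->
    rnorm (hc_mul F u v - hc_mul F u' v') < e.
  move=> h1 h2 uvk.
  have mulle (s s' : F) : rnorm (hc_mul F s s') <= rnorm s * rnorm s'.
    by have := hc_mul_norm s s'; rewrite !normE -rmorphM/= lecR.
  have -> : hc_mul F u v - hc_mul F u' v' =
      hc_mul F u (v - v') + hc_mul F (u - u') v'.
    rewrite (linB (hc_mulr u)) (linB (hc_mull v')).
    by rewrite addrA subrK.
  apply: le_lt_trans (rnormD _ _) _.
  have v'1 : rnorm v' <= rnorm v + 1.
    have := rnormB v (v - v'); rewrite subKr => h3; apply: le_trans h3 _.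
    by rewrite lerD2l (le_trans (ltW h2))// /t ge_min lexx.
  have te : t * k <= e by rewrite -ler_pdivlMr// /t ge_min lexx orbT.
  have h3 : rnorm (hc_mul F u (v - v')) <= rnorm u * t.
    by apply: le_trans (mulle _ _) _; rewrite ler_wpM2l ?r0// ltW.
  have h4 : rnorm (hc_mul F (u - u') v') <= t * (rnorm v + 1).
    apply: le_trans (mulle _ _) _; rewrite ler_pM ?r0//; exact: ltW.
  apply: le_lt_trans (lerD h3 h4) _; apply: lt_le_trans te.
  by rewrite [_ * t]mulrC -mulrDr ltr_pM2l// addrA.
exists (mul a b); first exact: Amul.
rewrite !hc_in_mul//; have := r0 _ x; have := r0 _ x'; have := r0 _ y; have := r0 _ y'.
by move=> *; split; apply: est => //; rewrite /k; lra.
Qed.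

Lemma common_approx_fun x y y' :
  common_approx x y -> common_approx x y' -> y = y'.
Proof.
move=> h h'; apply/eqP; rewrite -subr_eq0; apply/eqP/rnorm0_eq0.
by rewrite -(common_approx_isometry h h') subrr rnorm0.
Qed.

End CompletionExtension.

Lemma common_approx_sym (R : realType) (V : lmodType R[i]) (A : set V)
    (mul : V -> V -> V) (N1 N2 : V -> \bar R)
    (F1 : hausdorff_completion A mul N1) (F2 : hausdorff_completion A mul N2)
    (x : F1) (y : F2) : common_approx x y -> common_approx y x.
Proof. by move=> h e /h[a Aa []]; exists a. Qed.

(** [common_approx] is total and single-valued in both directions, since its hypotheses are
    symmetric in F1 and F2; hence it is the graph of a bijection. A linear contraction with the
    prescribed values on A has its graph inside it, which gives uniqueness. *)
Lemma completion_isometry (R : realType) (V : lmodType R[i]) (A : set V)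
    (mul : V -> V -> V) (N1 N2 : V -> \bar R)
    (F1 : hausdorff_completion A mul N1) (F2 : hausdorff_completion A mul N2) :
  (forall c a b, A a -> A b -> A (c *: a + b)) ->
  (forall a b, A a -> A b -> A (mul a b)) ->
  (forall a, A a -> N1 a = N2 a) ->
  exists kappa : F1 -> F2,
    [/\ linear kappa,
        forall x y, kappa (hc_mul F1 x y) = hc_mul F2 (kappa x) (kappa y),
        forall x, rnorm (kappa x) = rnorm x,
        forall a, A a -> kappa (hc_in F1 a) = hc_in F2 a &
        bijective kappa] /\
    forall kappa' : F1 -> F2, linear kappa' ->
      (forall x, `|kappa' x| <= `|x|) ->
      (forall a, A a -> kappa' (hc_in F1 a) = hc_in F2 a) -> kappa' = kappa.
Proof.
move=> Alin Amul NE; have NE' a : A a -> N2 a = N1 a by move=> /NE.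
have [kappa kP] := choice (fun x : F1 => common_approx_exists F2 Alin NE x).
have [eta eP] := choice (fun y : F2 => common_approx_exists F1 Alin NE' y).
have kE x y : common_approx x y -> kappa x = y.
  by move=> h; exact: (common_approx_fun Alin NE (kP x) h).
have eE x y : common_approx x y -> eta x = y.
  by move=> h; exact: (common_approx_fun Alin NE' (eP x) h).
have kl : linear kappa by move=> c x y; apply: kE; exact: common_approx_lin.
exists kappa; split; first split => //.
- by move=> x y; apply: kE; exact: common_approx_mul.
- move=> x; have := common_approx_isometry Alin NE (kP x) (kP 0).
  by rewrite (lin0 kl) !subr0.
- by move=> a Aa; apply/kE/common_approx_in.
- exists eta => x; first by apply/eE/common_approx_sym.
  by apply/kE/common_approx_sym.
move=> k' lk' ck' k'E; apply/funext => x; apply/esym/kE => e e0.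
have [a Aa [xa _]] := kP x e e0; exists a => //; split => //.
rewrite -k'E// -(linB lk'); apply: le_lt_trans xa.
by have := ck' (x - hc_in F1 a); rewrite !normE lecR.
Qed.

(** * L^p of a product with counting measure *)

Lemma powR_inj_ge0 (R : realType) (p x y : R) : 0 < p -> 0 <= x -> 0 <= y ->
  x `^ p = y `^ p -> x = y.
Proof. by move=> p0 x0 y0; apply: powR_injective; rewrite ?nnegrE. Qed.

Lemma ler_powR_ge0 (R : realType) (p x y : R) : 0 < p -> 0 <= x -> 0 <= y ->
  (x `^ p <= y `^ p) = (x <= y).
Proof.
move=> p0 x0 y0; apply/idP/idP; last first.
  by move=> xy; apply: ge0_ler_powR => //; rewrite ?nnegrE// ltW.
apply: contraTT; rewrite -!ltNge => yx.
by apply: gt0_ltr_powR; rewrite ?nnegrE.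
Qed.

Section LpNorm.
Context d (T : measurableType d) (R : realType).
Variables (nu : {measure set T -> \bar R}) (p : R) (p1 : 1 <= p).
Local Notation L := (Lp nu p1).

Let p0 : 0 < p. Proof. exact: lt_le_trans p1. Qed.

(** The p-th power of the norm, which unlike the norm is additive over slices; it stays in the
    extended reals so that it can be computed before finiteness is known. *)
Definition Lp_power (f : T -> R[i]) : \bar R :=
  (\int[nu]_x (Normc.normc (f x) `^ p)%:E)%E.

Lemma Lp_power_ge0 f : (0 <= Lp_power f)%E.
Proof. by apply: integral_ge0 => x _; rewrite lee_fin powR_ge0. Qed.

Lemma cLnormE f : cLnorm nu p f = (Lp_power f `^ p^-1)%E.
Proof.
rewrite /cLnorm unlock; congr (_ `^ _)%E; apply: eq_integral => x _ /=.
by rewrite ger0_norm ?normc_ge0.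
Qed.

Lemma Lp_powerE f : Lp_power f = (cLnorm nu p f `^ p)%E.
Proof.
by rewrite cLnormE -poweRrM mulVf ?gt_eqF// poweRe1// Lp_power_ge0.
Qed.

Lemma in_LpP f : cmeasurable f -> (Lp_power f < +oo)%E -> in_Lp nu p f.
Proof. by move=> mf h; split => //; rewrite cLnormE poweR_lty. Qed.

Lemma in_Lp_power f : in_Lp nu p f -> (Lp_power f < +oo)%E.
Proof. by move=> [_ h]; rewrite Lp_powerE poweR_lty. Qed.

Lemma measurable_Lp_power f : cmeasurable f ->
  measurable_fun setT (fun x : T => (Normc.normc (f x) `^ p)%:E).
Proof.
move=> mf; apply/measurable_EFinP.
by apply: (measurableT_comp (measurable_powR _)); exact: cmeasurable_normc.
Qed.

Lemma rnorm_power (xi : L) : (rnorm xi `^ p)%:E = Lp_power xi.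
Proof. by rewrite Lp_powerE -Lp_normE poweR_EFin. Qed.

Lemma Lp_measurable (xi : L) : cmeasurable xi.
Proof. by case: (LpFunP xi). Qed.

Lemma Lp_in_Lp (xi : L) : in_Lp nu p xi.
Proof. exact: LpFunP. Qed.

Lemma eq_Lp_power f g : cmeasurable f -> cmeasurable g ->
  {ae nu, forall x, f x = g x} -> Lp_power f = Lp_power g.
Proof. by move=> mf mg fg; rewrite !Lp_powerE (cLnorm_eq_ae p mf mg fg). Qed.

Lemma rnorm_Lp_of f : in_Lp nu p f -> (rnorm (Lp_of nu p1 f) `^ p)%:E = Lp_power f.
Proof.
move=> hf; rewrite rnorm_power; apply: eq_Lp_power (Lp_measurable _) hf.1 _.
exact: Lp_ofE.
Qed.

Lemma eq_Lp_of f g : in_Lp nu p f -> in_Lp nu p g ->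
  {ae nu, forall x, f x = g x} -> Lp_of nu p1 f = Lp_of nu p1 g.
Proof.
move=> hf hg fg; apply: Lp_ext.
by apply: filterS2 (filterI (Lp_ofE p1 hf) (Lp_ofE p1 hg)) fg => x [-> ->].
Qed.

End LpNorm.

Definition counting_sfm (R : realType) : {sigma_finite_measure set nat -> \bar R} :=
  HB.pack (@counting nat R)
    (Measure_isSigmaFinite.Build _ _ _ (@counting nat R) (sigma_finite_counting R)).

Section Slices.
Context d (T : measurableType d) (R : realType).
Variables (nu : {sigma_finite_measure set T -> \bar R}) (p : R) (p1 : 1 <= p).

(* L^p(count_prod) plays the role of l^p(nat, L^p(nu)). *)
Definition count_prod : {measure set (nat * T) -> \bar R} :=
  (@counting nat R \x nu)%E.
Local Notation M := count_prod.
Local Notation L := (Lp nu p1).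
Local Notation LM := (Lp M p1).

Let p0 : 0 < p. Proof. exact: lt_le_trans p1. Qed.

Lemma count_prodE (N : set (nat * T)) :
  M N = (\esum_(k in [set: nat]) nu (xsection N k))%E.
Proof.
rewrite /count_prod /= /product_measure1 ge0_integral_count => [|k].
  by rewrite nneseries_esumT// => k; exact: measure_ge0.
exact: measure_ge0.
Qed.

Lemma measurable_sections d' (T' : measurableType d') (f : nat * T -> T') :
  (forall k, measurable_fun setT (fun y => f (k, y))) -> measurable_fun setT f.
Proof.
move=> mf _ K mK; rewrite setTI.
rewrite (_ : _ @^-1` _ = \bigcup_k ([set k] `*` ((fun y => f (k, y)) @^-1` K))).
  apply: bigcup_measurable => k _; apply: measurableX => //.
  by rewrite -[X in measurable X]setTI; exact: mf.
by apply/seteqP; split => [[k y] /= h|[k y] [m _ [/= ->]]]//; exists k.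
Qed.

Lemma cmeasurable_sections (f : nat * T -> R[i]) :
  (forall k, cmeasurable (fun y => f (k, y))) -> cmeasurable f.
Proof.
by move=> mf; split; apply: measurable_sections => k; [case: (mf k)|case: (mf k)].
Qed.

Lemma cmeasurable_section (f : nat * T -> R[i]) k :
  cmeasurable f -> cmeasurable (fun y => f (k, y)).
Proof.
by move=> [mr mi]; split; [exact: (measurable_fun_pair2 k mr)|
  exact: (measurable_fun_pair2 k mi)].
Qed.

(** Points of [nat] have mass 1, so a null set has only null sections; countably many null sections
    make up a null set again. *)
Lemma ae_sections (P : nat * T -> Prop) :
  {ae M, forall z, P z} <-> forall k, {ae nu, forall y, P (k, y)}.
Proof.
split=> [[N [mN N0 PN]] k|h].
  exists (xsection N k); split; first exact: measurable_xsection.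
    apply/eqP; rewrite eq_le measure_ge0 andbT -N0 count_prodE.
    rewrite (esumID [set k])//=.
    by rewrite setTI esum_set1 ?measure_ge0// leeDl// esum_ge0.
  by move=> y /= Pky; rewrite /xsection/= inE; exact: PN.
have /choice[N NP] k : exists N, [/\ measurable N, nu N = 0 &
    ~` [set y | P (k, y)] `<=` N] by case: (h k) => N [? ? ?]; exists N.
exists (\bigcup_k ([set k] `*` N k)); split.
- by apply: bigcup_measurable => k _; apply: measurableX => //; case: (NP k).
- rewrite count_prodE esum1// => k _.
  rewrite (_ : xsection _ k = N k); first by case: (NP k).
  apply/seteqP; split => y; rewrite /xsection/= inE.
    by move=> [m _ [/= ->]].
  by exists k.
- move=> [k y] /= Pky; exists k => //; split => //=.
  by case: (NP k) => _ _; exact.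
Qed.

Lemma Lp_power_sections f : cmeasurable f ->
  Lp_power M p f = (\esum_(k in [set: nat]) Lp_power nu p (fun y => f (k, y)))%E.
Proof.
move=> mf.
rewrite [LHS](fubini_tonelli1 (m1 := counting_sfm R) (m2 := nu)); last 2 first.
- exact: measurable_Lp_power.
- by move=> z; rewrite lee_fin powR_ge0.
rewrite ge0_integral_count => [|k]; last first.
  by apply: integral_ge0 => y _; rewrite lee_fin powR_ge0.
by rewrite nneseries_esumT// => k; exact: Lp_power_ge0.
Qed.

(** There is no exceptional k: the p-th power of each section is one term of the sum for f. *)
Lemma in_Lp_section f k : in_Lp M p f -> in_Lp nu p (fun y => f (k, y)).
Proof.
move=> hf; have mf := hf.1; apply: in_LpP => //; first exact: cmeasurable_section.
apply: le_lt_trans (in_Lp_power p1 hf); rewrite Lp_power_sections//.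
rewrite (esumID [set k])//= => [|? _]; last exact: Lp_power_ge0.
rewrite setTI esum_set1 ?Lp_power_ge0// leeDl// esum_ge0// => ? _.
exact: Lp_power_ge0.
Qed.

Definition slice (k : nat) (xi : LM) : L := Lp_of nu p1 (fun y => xi (k, y)).

Lemma sliceE k xi : {ae nu, forall y, slice k xi y = xi (k, y)}.
Proof. by apply/Lp_ofE/in_Lp_section/Lp_in_Lp. Qed.

Lemma slice_ext (xi eta : LM) : (forall k, slice k xi = slice k eta) -> xi = eta.
Proof.
move=> h; apply: Lp_ext; apply/ae_sections => k.
by apply: filterS2 (sliceE k xi) (sliceE k eta) => y <- <-; rewrite h.
Qed.

Lemma slice_linear k : linear (slice k).
Proof.
move=> a xi eta; apply: Lp_ext.
have h1 := sliceE k (a *: xi + eta).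
have h2 := sliceE k xi; have h3 := sliceE k eta.
have h4 := (ae_sections _).1 (LpDE (a *: xi) eta) k.
have h5 := (ae_sections _).1 (LpZE a xi) k.
have h6 := LpDE (a *: slice k xi) (slice k eta).
have h7 := LpZE a (slice k xi).
apply: filterS2 (filterI h1 (filterI h2 h3)) (filterI (filterI h4 h5) (filterI h6 h7)).
by move=> y [-> [e2 e3]] [[-> ->] [-> ->]]; rewrite e2 e3.
Qed.

Lemma rnorm_slices (xi : LM) :
  ((rnorm xi `^ p)%:E = \esum_(k in [set: nat]) (rnorm (slice k xi) `^ p)%:E)%E.
Proof.
rewrite rnorm_power Lp_power_sections; last exact: Lp_measurable.
apply: eq_esum => k _; rewrite rnorm_Lp_of//.
exact/in_Lp_section/Lp_in_Lp.
Qed.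

Lemma slice_le k (xi : LM) : rnorm (slice k xi) <= rnorm xi.
Proof.
rewrite -(ler_powR_ge0 p0) ?rnorm_ge0// -lee_fin rnorm_slices.
rewrite (esumID [set k])//=; last by move=> *; rewrite lee_fin powR_ge0.
rewrite setTI esum_set1 ?lee_fin ?powR_ge0// leeDl// esum_ge0// => ? _.
by rewrite lee_fin powR_ge0.
Qed.

(** The inverse of taking slices. Families that are not p-summable fall under the default value 0 of
    [Lp_of], hence the [psummable] conditions below. *)
Definition join (g : nat -> L) : LM := Lp_of M p1 (fun z => g z.1 z.2).

Definition psummable (g : nat -> L) :=
  (\esum_(k in [set: nat]) (rnorm (g k) `^ p)%:E < +oo)%E.

Lemma in_Lp_join g : psummable g -> in_Lp M p (fun z => g z.1 z.2).
Proof.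
move=> sg; have mg : cmeasurable (fun z : nat * T => g z.1 z.2).
  by apply: cmeasurable_sections => k; exact: (Lp_measurable (g k)).
apply: in_LpP => //; rewrite Lp_power_sections//.
rewrite (eq_esum (b := fun k => (rnorm (g k) `^ p)%:E))// => k _.
by rewrite rnorm_power.
Qed.

Lemma slice_join g k : psummable g -> slice k (join g) = g k.
Proof.
move=> sg; apply: Lp_ext.
have h := (ae_sections _).1 (Lp_ofE p1 (in_Lp_join sg)) k.
by apply: filterS2 (sliceE k (join g)) h => y -> ->.
Qed.

Lemma psummable_slice (xi : LM) : psummable (slice^~ xi).
Proof. by rewrite /psummable -rnorm_slices ltry. Qed.

Lemma join_slice (xi : LM) : join (slice^~ xi) = xi.
Proof.
by apply: slice_ext => k; rewrite slice_join//; exact: psummable_slice.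
Qed.

Lemma rnorm_join g : psummable g ->
  ((rnorm (join g) `^ p)%:E = \esum_(k in [set: nat]) (rnorm (g k) `^ p)%:E)%E.
Proof.
by move=> sg; rewrite rnorm_slices; apply: eq_esum => k _; rewrite slice_join.
Qed.

Let single (k : nat) (g : L) : nat -> L := fun m => if m == k then g else 0.

Let esum_single k g :
  (\esum_(m in [set: nat]) (rnorm (single k g m) `^ p)%:E = (rnorm g `^ p)%:E)%E.
Proof.
rewrite (esumID [set k])//=; last by move=> *; rewrite lee_fin powR_ge0.
rewrite setTI esum_set1 ?lee_fin ?powR_ge0// /single eqxx.
rewrite [X in (_ + X)%E]esum1 ?adde0// => m [_ /= mk].
by rewrite (introF eqP mk) rnorm0 powR0// gt_eqF.
Qed.

Lemma psummable_single k g : psummable (single k g).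
Proof. by rewrite /psummable esum_single ltry. Qed.

Definition inject (k : nat) (g : L) : LM := join (single k g).

Lemma slice_inject m k g : slice m (inject k g) = if m == k then g else 0.
Proof. by rewrite slice_join//; exact: psummable_single. Qed.

Lemma rnorm_inject k g : rnorm (inject k g) = rnorm g.
Proof.
apply: (powR_inj_ge0 p0); rewrite ?rnorm_ge0//; apply: EFin_inj.
by rewrite rnorm_join ?esum_single//; exact: psummable_single.
Qed.

Lemma inject_linear k : linear (inject k).
Proof.
move=> a g g'; apply: slice_ext => m; rewrite slice_linear !slice_inject.
by case: eqP => // _; rewrite scaler0 addr0.
Qed.

(** The p-th power of the norm of the remainder is a tail of the convergent series of the p-th
    powers of the slice norms. *)
Lemma trunc_dense (xi : LM) e : 0 < e -> exists n : nat,
  rnorm (xi - \sum_(k < n) inject k (slice k xi)) < e.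
Proof.
move=> e0; pose a k := (rnorm (slice k xi) `^ p)%:E.
have a0 k : (0 <= a k)%E by rewrite lee_fin powR_ge0.
have tail := @nneseries_tail_cvg R a xpredT.
have /tail{}tail : (\sum_(k <oo) a k < +oo)%E.
  by rewrite nneseries_esumT// -rnorm_slices ltry.
have ep0 : 0 < e `^ p by rewrite powR_gt0.
have {}tail := tail (fun k _ => a0 k).
have /fine_cvgP[fin /cvgrPdist_lt /(_ _ ep0) [n _ nP]] := tail.
(* [fine] sends +oo to 0, so a small value counts only where the tail is known to be finite; N
   secures both. *)
case: fin => n' _ n'P; pose N := maxn n n'; exists N.
have := nP N (leq_maxl _ _); have := n'P N (leq_maxr _ _).
rewrite /= sub0r normrN => fN; rewrite ger0_norm; last first.
  by apply/fine_ge0/nneseries_ge0 => k _ _.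
rewrite -lte_fin fineK// => h.
have E0 k : slice k (xi - \sum_(j < N) inject j (slice j xi)) =
    if (k < N)%N then 0 else slice k xi.
  rewrite (linB (slice_linear k)) (lin_sum (slice_linear k)).
  under eq_bigr do rewrite slice_inject.
  case: ifPn => [kN|]; last first.
    rewrite -leqNgt => Nk; rewrite big1 ?subr0// => j _.
    by rewrite gtn_eqF// (leq_trans (ltn_ord j)).
  rewrite (bigD1 (Ordinal kN))//= eqxx big1 ?addr0 ?subrr// => j.
  by move=> /eqP jk; case: eqP => // kj; case: jk; exact: val_inj.
have : ((rnorm (xi - \sum_(j < N) inject j (slice j xi)) `^ p)%:E < (e `^ p)%:E)%E.
  rewrite rnorm_slices; apply: le_lt_trans h.
  rewrite eseries_cond nneseries_esum// [leRHS]esum_mkcond; apply: le_esum => k _.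
  rewrite E0; case: ifPn => kN; last by rewrite mem_set//= leqNgt.
  by rewrite rnorm0 powR0 ?gt_eqF//; case: ifP.
by rewrite lte_fin !ltNge (ler_powR_ge0 p0) ?rnorm_ge0// ltW.
Qed.

End Slices.

(* Otherwise unification unfolds the choice of representatives in Lp. *)
#[global] Opaque slice join inject.

(** * The full norm is at most the reduced norm *)

Section IntEnumeration.

(** Even numbers code the nonnegative integers and odd ones the negative integers; this transports
    l^p over the integers to slices over [nat]. *)
Definition nat_of_int (m : int) : nat :=
  match m with Posz k => k.*2 | Negz k => k.*2.+1 end.

Definition int_of_nat (n : nat) : int :=
  if odd n then Negz n./2 else Posz n./2.

Lemma nat_of_intK : cancel nat_of_int int_of_nat.
Proof.
by case=> k; rewrite /int_of_nat /= odd_double /= ?doubleK ?uphalf_double.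
Qed.

Lemma int_of_natK : cancel int_of_nat nat_of_int.
Proof.
move=> n; rewrite /int_of_nat; have := odd_double_half n.
by case: (odd n) => /=; rewrite ?add0n ?add1n.
Qed.

Lemma esum_int_nat (R : realType) (f : int -> \bar R) :
  (\esum_(m in [set: int]) f m = \esum_(k in [set: nat]) f (int_of_nat k))%E.
Proof.
apply: reindex_esum; split => //.
- by move=> k l _ _ /(congr1 nat_of_int); rewrite !int_of_natK.
- by move=> m _; exists (nat_of_int m) => //; exact: nat_of_intK.
Qed.

End IntEnumeration.

Section EsumSeq.
Context (R : realType) (T : choiceType).

Lemma esum_ge_seq (s : seq T) (a : T -> \bar R) : uniq s ->
  (\sum_(i <- s) a i <= \esum_(i in [set: T]) a i)%E.
Proof.
move=> us; rewrite fsbig_seq//; apply: ereal_sup_ubound => /=.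
by exists [set` s].
Qed.

Lemma esum_seq (s : seq T) (a : T -> \bar R) : uniq s ->
  (forall i, 0 <= a i)%E -> (forall i, i \notin s -> a i = 0%E) ->
  (\esum_(i in [set: T]) a i = \sum_(i <- s) a i)%E.
Proof.
move=> us a0 as0; apply/eqP; rewrite eq_le esum_ge_seq// andbT.
rewrite (esumID [set` s])// [X in (_ + X)%E]esum1 ?adde0; last first.
  by move=> i [_ /= /negP]; exact: as0.
by rewrite setTI esum_fset// -fsbig_seq.
Qed.

End EsumSeq.

Lemma finite_support_seq (T : choiceType) (V : zmodType) (a : T -> V) :
  finite_set [set n | a n <> 0] ->
  exists2 s : seq T, uniq s & forall n, n \notin s -> a n = 0.
Proof.
move=> /finite_seqP[s sE]; exists (undup s); first exact: undup_uniq.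
move=> n; rewrite mem_undup => /negP ns; apply: contrapT => an; apply: ns.
by have : [set n | a n <> 0] n by []; rewrite sE.
Qed.

(** The condition [pi 0 = 0] makes the terms vanish off the support of a, since [integrated]
    formally sums over all integers. *)
Lemma integrated_sum (R : realType) (E : normedModType R[i]) (V : lmodType R[i])
    (w : int -> V -> V) (pi : (E -> E) -> V -> V) (a : int -> E -> E)
    (s : seq int) x :
  uniq s -> (forall n, n \notin s -> a n = 0) -> pi 0 = 0 ->
  integrated w pi a x = \sum_(n <- s) pi (a n) (w n x).
Proof.
move=> us as0 pi0; rewrite /integrated.
rewrite -(fsbig_widen [set` s] setT)//; last first.
  by move=> n [_ /= /negP ns]; rewrite as0// pi0.
by rewrite -fsbig_seq// fct_sumE.
Qed.

Section FullLeReduced.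
Context (R : realType) (p : R) (p1 : 1 <= p) (E F : normedModType R[i]).
Variables (A : set (E -> E)) (alpha : int -> (E -> E) -> (E -> E)).
Variables (w : int -> F -> F) (pi : (E -> E) -> F -> F).
Hypothesis A0 : A 0.
Hypothesis cov : contractive_covariant A alpha w pi.

Let p0 : 0 < p. Proof. exact: lt_le_trans p1. Qed.

Lemma contractive_rep0 : pi 0 = 0.
Proof.
case: cov => _ _ _ [_ lpi _ _] _; have := lpi (-1) 0 0 A0 A0.
by rewrite scaler0 addr0 scaleN1r addNr.
Qed.

(** Both [w n] and its inverse [w (- n)] are contractions. *)
Lemma covariant_isometry n x : rnorm (w n x) = rnorm x.
Proof.
case: cov => wb w0 wD _ _.
have le m y : rnorm (w m y) <= rnorm y.
  have [[lw _] w1] := wb m; rewrite -[leRHS]mul1r.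
  exact: (bound_opnorm lw w1).
apply/eqP; rewrite eq_le le/=.
have h : w (- n) (w n x) = x by rewrite -[LHS]/((w (- n) \o w n) x) -wD addNr w0.
by rewrite -[in leLHS]h; exact: le.
Qed.

Let red a := opnorm_for (@lpZ_norm R p F)
  (integrated (@regular_w R F) (regular_pi alpha pi) a).

Lemma lpZ_norm_ge0 (xi : int -> F) : (0 <= lpZ_norm p xi)%E.
Proof. exact: poweR_ge0. Qed.

Lemma folner_bound a x (s : seq int) (K N : nat) r :
  (forall n, A (a n)) -> uniq s -> (forall n, n \notin s -> a n = 0) ->
  (forall n, n \in s -> `|n| <= K%:Z) -> (forall n, alpha n 0 = 0) ->
  rnorm x <= 1 -> red a = r%:E -> (0 < N)%N ->
  N%:R * rnorm (integrated w pi a x) `^ p <= (N + K + K)%:R * r `^ p.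
Proof.
move=> Aa us as0 sK alpha0 x1 redr N0; case: (cov) => wb w0 wD [pib lpi _ _] piw.
have lw n : linear (w n) by case: (wb n) => -[].
pose L := (N + K + K)%N.
have L0 : 0 < L%:R :> R by rewrite ltr0n /L !addn_gt0 N0.
(* Normalization: [eta] has L nonzero coordinates at most, each of norm c ||x||, so c^p = 1/L and
   ||x|| <= 1 put it in the unit ball. *)
pose c := L%:R `^ (- p^-1) : R.
have c0 : 0 <= c by exact: powR_ge0.
have cp : c `^ p = L%:R^-1.
  by rewrite /c -powRrM mulNr mulVf ?gt_eqF// powR_inv1// ltW.
pose eta (m : int) : F := if (0 <= m < L%:Z) then c%:C%C *: w (- m) x else 0.
have rc (y : F) : rnorm (c%:C%C *: y) = c * rnorm y.
  by rewrite rnormZ /= expr0n/= addr0 sqrtr_sqr ger0_norm.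
have rcp (y : F) : rnorm (c%:C%C *: y) `^ p = L%:R^-1 * rnorm y `^ p.
  by rewrite rc powRM ?rnorm_ge0// cp.
have e0 (f : int -> F) m : (0 <= (rnorm (f m) `^ p)%:E)%E.
  by rewrite lee_fin powR_ge0.
have sum_cst (n : nat) (y : R) (f : nat -> R) : (forall k, (k < n)%N -> f k = y) ->
    (\sum_(k <- iota 0 n) (f k)%:E = (n%:R * y)%:E)%E.
  move=> fy; rewrite sumEFin; congr _%:E.
  rewrite (eq_big_seq (fun=> y)) => [|k]; last by rewrite mem_iota => /andP[_]; exact: fy.
  by rewrite big_const_seq count_predT size_iota iter_addr_0 mulr_natl.
have x1p : rnorm x `^ p <= 1.
  by have := ler_powR_ge0 p0 (rnorm_ge0 x) ler01; rewrite powR1 => ->.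
have eta1 : (lpZ_norm p eta <= 1)%E.
  rewrite /lpZ_norm -(poweR1r p^-1).
  apply: gt0_ler_poweR.
  - by rewrite invr_ge0 ltW.
  - by rewrite in_itv/= leey esum_ge0.
  - by rewrite in_itv/= leey lee01.
  rewrite (esum_seq (s := map Posz (iota 0 L))) => //; last 2 first.
  - by rewrite map_inj_uniq ?iota_uniq// => ? ? [].
  - move=> m ms; rewrite /eta ifF ?rnorm0 ?powR0 ?gt_eqF//.
    apply: contraNF ms => /andP[]; case: m => // m _ mL.
    by apply/mapP; exists m; rewrite ?mem_iota.
  rewrite big_map (sum_cst _ (L%:R^-1 * rnorm x `^ p)) => [|k kL].
    by rewrite mulrA divff ?gt_eqF// mul1r lee_fin.
  by rewrite /eta /= ltz_nat kL rcp covariant_isometry.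
(* For m in the middle window and |n| <= K, the index m - n stays in [0, L[, so no shift used by a
   sees the ends of [eta]. *)
have etaE m n : K%:Z <= m < (K + N)%:Z -> n \in s ->
  eta (m - n) = c%:C%C *: w (- (m - n)) x.
  move=> /andP[m1 m2] /sK; rewrite ler_norml => /andP[n1 n2]; rewrite /eta ifT//.
  apply/andP; split; move: m1 m2 n1 n2; rewrite /L; lia.
have reg0 : regular_pi alpha pi 0 = 0.
  apply/funext => f; apply/funext => m.
  by rewrite /regular_pi alpha0 contractive_rep0.
pose g := integrated (@regular_w R F) (regular_pi alpha pi) a eta.
(* By covariance, pi(alpha_{-m}(a_n)) w_{n-m} x = w_{-m} pi(a_n) w_m w_{n-m} x = w_{-m} pi(a_n) w_n
   x. *)
have gE m : K%:Z <= m < (K + N)%:Z ->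
    g m = c%:C%C *: w (- m) (integrated w pi a x).
  move=> mK; rewrite /g (integrated_sum _ _ us as0 reg0) fct_sumE.
  rewrite (integrated_sum _ _ us as0 contractive_rep0).
  rewrite (lin_sum (lw (- m))) scaler_sumr; apply: eq_big_seq => n ns.
  rewrite /regular_pi /regular_w etaE// piw//= opprK.
  rewrite (linZ (lw m)) -[w m _]/((w m \o w (- (m - n))) x) -wD.
  rewrite subKr; have [lpa _] := pib _ (Aa n).
  by rewrite (linZ lpa) (linZ (lw (- m))).
have : (lpZ_norm p g <= r%:E)%E.
  by rewrite -redr; apply: ereal_sup_ubound; exists eta.
move=> /(gt0_ler_poweR (ltW p0)); rewrite !in_itv/= !leey lpZ_norm_ge0 andbT.
have r0 : 0 <= r.
  rewrite -lee_fin; apply: le_trans (lpZ_norm_ge0 g) _.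
  by rewrite -redr; apply: ereal_sup_ubound; exists eta.
rewrite lee_fin r0 => /(_ isT isT).
rewrite /lpZ_norm -poweRrM mulVf ?gt_eqF// poweRe1 ?esum_ge0//.
(* Only the N middle coordinates are kept in the lower bound for the sum. *)
move=> h; have := le_trans (esum_ge_seq _ (s := map (fun k => Posz (K + k)) (iota 0 N)) _) h.
rewrite big_map map_inj_uniq ?iota_uniq; last by move=> ? ? [] /addnI.
rewrite (sum_cst _ (L%:R^-1 * rnorm (integrated w pi a x) `^ p)) => [|k kN]; last first.
  rewrite gE ?rcp ?covariant_isometry//.
  by rewrite !lez_nat leq_addr ltz_nat ltn_add2l.
move=> /(_ isT); rewrite lee_fin mulrCA.
by rewrite ler_pdivrMl.
Qed.

Lemma full_le_reduced a : Cc A a -> (forall n, alpha n 0 = 0) ->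
  (opnorm (integrated w pi a) <= red a)%E.
Proof.
move=> [fa Aa] alpha0; have [s us as0] := finite_support_seq fa.
have [K sK] : exists K : nat, forall n, n \in s -> `|n| <= K%:Z.
  exists (\max_(n <- s) `|n|)%N => n ns; rewrite -abszE lez_nat.
  exact: (@leq_bigmax_seq _ s xpredT (fun n : int => `|n|%N) n ns isT).
have red0 : (0 <= red a)%E.
  apply: le_trans (lpZ_norm_ge0 _) _; apply: ereal_sup_ubound.
  exists 0; last by [].
  rewrite /= /lpZ_norm esum1 ?poweR0r ?lee01 ?invr_eq0 ?gt_eqF// => m _.
  by rewrite rnorm0 powR0// gt_eqF.
move: red0; case redr: (red a) => [r| |] //; last by move=> _; exact: leey.
rewrite lee_fin => r0; apply: ge_ereal_sup => _ [x /= x1 <-]; rewrite lee_fin.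
rewrite lee_fin in x1.
rewrite -(ler_powR_ge0 p0) ?rnorm_ge0// leNgt; apply/negP => rT.
set t := rnorm _ `^ p in rT; pose y := r `^ p.
have ty : 0 < t - y by rewrite subr_gt0.
(* If t > y, the Folner bound reads N (t - y) <= 2K y, which fails once N exceeds 2K y / (t - y). *)
pose N := (Num.truncn ((K + K)%:R * y / (t - y))).+1.
have := folner_bound Aa us as0 sK alpha0 x1 redr (ltn0Sn _ : (0 < N)%N).
rewrite -/t -/y -addnA natrD mulrDl -lerBlDl -mulrBr.
rewrite -ler_pdivlMr// leNgt => /negP; apply.
by rewrite truncnS_gt.
Qed.

End FullLeReduced.

(** * The reduced norm is at most the full norm *)

Lemma esumZl_nat (R : realType) (c : R) (f : nat -> \bar R) : 0 <= c ->
  (forall k, 0 <= f k)%E ->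
  (\esum_(k in [set: nat]) (c%:E * f k) = c%:E * \esum_(k in [set: nat]) f k)%E.
Proof.
move=> c0 f0; rewrite -!nneseries_esumT//; last first.
  by move=> k; rewrite mule_ge0.
by rewrite nneseriesZl.
Qed.

Section ReducedLeFull.
Context (R : realType) (p : R) (p1 : 1 <= p) (E : normedModType R[i]).
Variables (A : set (E -> E)) (alpha : int -> (E -> E) -> (E -> E)).
Hypothesis A0 : A 0.
Hypothesis Abounded : A `<=` @bounded_operator R E.
Hypothesis Alin : forall c a b, A a -> A b -> A (c *: a + b).
Hypothesis Acomp : forall a b, A a -> A b -> A (a \o b).
Hypothesis alphaA : forall n a, A a -> A (alpha n a).
Hypothesis alpha0 : forall a, alpha 0 a = a.
Hypothesis alphaD : forall m n a, alpha (m + n) a = alpha m (alpha n a).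
Hypothesis alpha_lin : forall n c a b,
  alpha n (c *: a + b) = c *: alpha n a + alpha n b.
Hypothesis alpha_comp : forall n a b, alpha n (a \o b) = alpha n a \o alpha n b.
Hypothesis alpha_norm : forall n a, (opnorm (alpha n a) <= opnorm a)%E.

Context d (Y : measurableType d) (nu : {sigma_finite_measure set Y -> \bar R}).
Variable pi0 : (E -> E) -> Lp nu p1 -> Lp nu p1.
Hypothesis pi0_rep : contractive_rep A pi0.
Hypothesis pi0_nondeg : Defs.nondegenerate A pi0.

Local Notation L := (Lp nu p1).
Local Notation M := (count_prod nu).
Local Notation LM := (Lp M p1).

Let p0 : 0 < p. Proof. exact: lt_le_trans p1. Qed.

(** A uniform bound on slices both makes the joined family p-summable and bounds its norm; it is the
    source of all bounds for operators acting slice by slice. *)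
Lemma join_bound (g : nat -> L) (eta : LM) (C : R) : 0 <= C ->
  (forall k, rnorm (g k) <= C * rnorm (slice k eta)) ->
  psummable g /\ rnorm (join g) <= C * rnorm eta.
Proof.
move=> C0 gC.
have le : (\esum_(k in [set: nat]) (rnorm (g k) `^ p)%:E <=
    ((C * rnorm eta) `^ p)%:E)%E.
  rewrite powRM ?rnorm_ge0// EFinM rnorm_slices -esumZl_nat ?powR_ge0//; last first.
    by move=> k; rewrite lee_fin powR_ge0.
  apply: le_esum => k _; rewrite -EFinM -powRM ?rnorm_ge0// lee_fin.
  by rewrite (ler_powR_ge0 p0) ?mulr_ge0 ?rnorm_ge0.
have sg : psummable g by rewrite /psummable (le_lt_trans le)// ltry.
split => //; rewrite -(ler_powR_ge0 p0) ?mulr_ge0 ?rnorm_ge0// -lee_fin.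
by rewrite rnorm_join.
Qed.

(** [translate] and [diagonal] are the regular pair [regular_w], [regular_pi] carried to L^p of
    [count_prod nu] by the enumeration of the integers. *)
Definition translate (n : int) (eta : LM) : LM :=
  join (fun k => slice (nat_of_int (int_of_nat k - n)) eta).

Definition diagonal (a : E -> E) (eta : LM) : LM :=
  join (fun k => pi0 (alpha (- int_of_nat k) a) (slice k eta)).

Lemma esum_translate n (f : nat -> \bar R) :
  (\esum_(k in [set: nat]) f (nat_of_int (int_of_nat k - n)) =
   \esum_(k in [set: nat]) f k)%E.
Proof.
apply/esym/reindex_esum; split => //.
- move=> k l _ _ /(congr1 int_of_nat); rewrite !nat_of_intK => /addIr.
  by move=> /(congr1 nat_of_int); rewrite !int_of_natK.
- move=> k _; exists (nat_of_int (int_of_nat k + n)) => //.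
  by rewrite nat_of_intK addrK int_of_natK.
Qed.

Lemma psummable_translate n (eta : LM) :
  psummable (fun k => slice (nat_of_int (int_of_nat k - n)) eta).
Proof.
rewrite /psummable (esum_translate n (fun k => (rnorm (slice k eta) `^ p)%:E)).
by rewrite -rnorm_slices ltry.
Qed.

Lemma slice_translate k n eta :
  slice k (translate n eta) = slice (nat_of_int (int_of_nat k - n)) eta.
Proof. by rewrite slice_join//; exact: psummable_translate. Qed.

Lemma rnorm_translate n eta : rnorm (translate n eta) = rnorm eta.
Proof.
apply: (powR_inj_ge0 p0); rewrite ?rnorm_ge0//; apply: EFin_inj.
rewrite rnorm_join; last exact: psummable_translate.
by rewrite (esum_translate n (fun k => (rnorm (slice k eta) `^ p)%:E)) -rnorm_slices.
Qed.

(** The constant does not depend on n, because each [alpha n] decreases operator norms; this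
    uniformity bounds [diagonal a]. *)
Lemma pi0_bound n a : A a -> linear (pi0 (alpha n a)) /\
  exists C, [/\ opnorm a = C%:E, 0 <= C & bound_by C (pi0 (alpha n a))].
Proof.
move=> Aa; have [pb _ _ pn] := pi0_rep; have Ana := alphaA n Aa.
have [lp _] := pb _ Ana; split => //.
have [C aC [C0 _]] := opnorm_fin (Abounded Aa); exists C; split => //.
apply: bound_opnorm => //; apply: le_trans (pn _ Ana) _.
by rewrite -aC alpha_norm.
Qed.

Lemma psummable_diagonal a eta : A a ->
  psummable (fun k => pi0 (alpha (- int_of_nat k) a) (slice k eta)).
Proof.
move=> Aa; have [C aC [C0 _]] := opnorm_fin (Abounded Aa).
apply: (join_bound C0 _).1 => k.
by have [_ [C' [+ _ pC]]] := pi0_bound (- int_of_nat k) Aa; rewrite aC => -[->].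
Qed.

Lemma slice_diagonal k a eta : A a ->
  slice k (diagonal a eta) = pi0 (alpha (- int_of_nat k) a) (slice k eta).
Proof. by move=> Aa; rewrite slice_join//; exact: psummable_diagonal. Qed.

Lemma diagonal_linear a : A a -> linear (diagonal a).
Proof.
move=> Aa c eta eta'; apply: slice_ext => k.
rewrite slice_linear !slice_diagonal// slice_linear.
exact: (pi0_bound (- int_of_nat k) Aa).1.
Qed.

Lemma diagonal_bound a C : A a -> opnorm a = C%:E -> 0 <= C ->
  bound_by C (diagonal a).
Proof.
move=> Aa aC C0 eta; apply: (join_bound C0 _).2 => k.
by have [_ [C' [+ _ pC]]] := pi0_bound (- int_of_nat k) Aa; rewrite aC => -[->].
Qed.

Lemma translate_linear n : linear (translate n).
Proof.
move=> c eta eta'; apply: slice_ext => k.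
by rewrite slice_linear !slice_translate slice_linear.
Qed.

Lemma regular_covariant : contractive_covariant A alpha translate diagonal.
Proof.
have [pb pl pm pn] := pi0_rep; split.
- move=> n; have b1 : bound_by 1 (translate n).
    by move=> eta; rewrite rnorm_translate mul1r.
  split; last exact: opnorm_le.
  by apply/bounded_operatorP; split; [exact: translate_linear|exists 1].
- apply/funext => eta; apply: slice_ext => k.
  by rewrite slice_translate subr0 int_of_natK.
- move=> m n; apply/funext => eta; apply: slice_ext => k /=.
  by rewrite !slice_translate nat_of_intK opprD addrA.
- split.
  + move=> a Aa; apply/bounded_operatorP; split; first exact: diagonal_linear.
    have [C aC [C0 _]] := opnorm_fin (Abounded Aa).
    by exists C => //; exact: diagonal_bound.
  + move=> c a b Aa Ab; apply/funext => eta; apply: slice_ext => k.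
    rewrite -[(c *: diagonal a + diagonal b) eta]/(c *: diagonal a eta + diagonal b eta).
    rewrite slice_linear !slice_diagonal ?alpha_lin ?pl//; [exact: alphaA..|exact: Alin].
  + move=> a b Aa Ab; apply/funext => eta; apply: slice_ext => k /=.
    rewrite (slice_diagonal k eta (Acomp Aa Ab)) alpha_comp.
    rewrite (pm _ _ (alphaA _ Aa) (alphaA _ Ab)).
    by rewrite (slice_diagonal k _ Aa) (slice_diagonal k eta Ab).
  + move=> a Aa; have [C aC [C0 _]] := opnorm_fin (Abounded Aa).
    by rewrite aC; apply: opnorm_le => //; exact: diagonal_bound.
- move=> n a Aa; apply/funext => eta; apply: slice_ext => k /=.
  rewrite slice_translate !slice_diagonal ?slice_translate//; last exact: alphaA.
  by rewrite -alphaD !nat_of_intK opprK subrK int_of_natK opprB addrC.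
Qed.

Lemma regular_nondegenerate : Defs.nondegenerate A diagonal.
Proof.
apply/seteqP; split => // eta _; apply/closure_rnormP => e e0.
have e20 : 0 < e / 2 by rewrite divr_gt0.
have [n hn] := trunc_dense eta e20.
pose S := [set y | exists a x, A a /\ y = pi0 a x].
(* Half of e is shared among the n slices; n + 1 covers n = 0. *)
pose t := e / 2 / n.+1%:R; have t0 : 0 < t by rewrite divr_gt0.
have /choice[y yP] (k : 'I_n) : exists y, lspan S y /\ rnorm (slice k eta - y) < t.
  have : closure (lspan S) (slice k eta) by rewrite pi0_nondeg.
  by move=> /closure_rnormP/(_ t t0)[y]; exists y.
exists (\sum_(k < n) inject k (y k)).
  apply: lspan_sum => k; have [Sy _] := yP k.
  have [m [c [s [Ss ->]]]] := Sy.
  rewrite (lin_sum (inject_linear (p1 := p1) k)); apply: lspan_sum => j.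
  rewrite (linZ (inject_linear (p1 := p1) k)) -[X in lspan _ X]addr0; apply: lspan_lin.
    apply: lspan_sub; have [a [x [Aa ->]]] := Ss j.
    (* Slice k of [diagonal] carries the twist by [alpha (- int_of_nat k)], which
       [alpha (int_of_nat k)] undoes; the other slices of [inject k x] are 0. *)
    exists (alpha (int_of_nat k) a), (inject k x); split; first exact: alphaA.
    apply: slice_ext => l; rewrite slice_diagonal; last exact: alphaA.
    rewrite !slice_inject; case: eqP => [->|_].
      by rewrite -alphaD addNr alpha0.
    have lp := (pi0_bound (- int_of_nat l) (alphaA (int_of_nat k) Aa)).1.
    by rewrite (lin0 lp).
  exact: lspan0.
apply: le_lt_trans (rnorm_tri (\sum_(k < n) inject k (slice k eta)) _ _) _.
rewrite [e]splitr; apply: ltr_leD => //.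
rewrite -sumrB; apply: le_trans (rnorm_sum _ _) _.
apply: (@le_trans _ _ (\sum_(k < n) t)).
  apply: ler_sum => k _; rewrite -(linB (inject_linear (p1 := p1) k)) rnorm_inject.
  exact/ltW/(yP k).2.
rewrite sumr_const card_ord -[leLHS]mulr_natr /t.
rewrite (_ : _ * _ = e / 2 * (n%:R / n.+1%:R)); last by rewrite mulrAC mulrA.
rewrite ler_piMr ?(ltW e20)//.
rewrite ler_pdivrMr// mul1r ler_nat.
exact: leqnSn.
Qed.

(** Every test vector of norm at most 1 is p-summable, and joining its coordinates preserves norms
    and intertwines the regular pair with [translate] and [diagonal]. *)
Lemma reduced_le_full a : Cc A a ->
  (opnorm_for (@lpZ_norm R p L)
     (integrated (@regular_w R L) (regular_pi alpha pi0) a) <=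
   opnorm (integrated translate diagonal a))%E.
Proof.
move=> [fa Aa]; have [s us as0] := finite_support_seq fa.
have alpha00 n : alpha n 0 = 0.
  have := alpha_lin n (-1) 0 0.
  by rewrite scaler0 addr0 scaleN1r addNr.
have pi00 : pi0 0 = 0.
  have [_ pl _ _] := pi0_rep; have := pl (-1) 0 0 A0 A0.
  by rewrite scaler0 addr0 scaleN1r addNr.
have diag0 : diagonal 0 = 0.
  apply/funext => eta; apply: slice_ext => k; rewrite slice_diagonal//.
  by rewrite alpha00 pi00 -[(0 : LM -> LM) eta]/(0 : LM) (lin0 (slice_linear (p1:=p1) k)).
have reg0 : regular_pi alpha pi0 0 = 0.
  apply/funext => f; apply/funext => m.
  by rewrite /regular_pi alpha00 pi00.
apply: ge_ereal_sup => _ [xi /= xi1 <-].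
have nE (f : int -> L) : lpZ_norm p f =
    ((\esum_(k in [set: nat]) (rnorm (f (int_of_nat k)) `^ p)%:E) `^ p^-1)%E.
  by rewrite /lpZ_norm esum_int_nat.
pose xi' := xi \o int_of_nat.
have sxi : psummable xi'.
  rewrite /psummable; apply: (@lty_poweRy _ _ p^-1); first by rewrite invr_eq0 gt_eqF.
  by rewrite -nE (le_lt_trans xi1)// ltry.
have joinE (f : nat -> L) : psummable f ->
    ((rnorm (join f))%:E = (\esum_(k in [set: nat]) (rnorm (f k) `^ p)%:E) `^ p^-1)%E.
  move=> sf; rewrite -rnorm_join// poweR_EFin -powRrM mulfV ?gt_eqF// powRr1//.
  exact: rnorm_ge0.
pose eta := join xi'; pose T := integrated translate diagonal a.
have TE : forall k, slice k (T eta) =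
    integrated (@regular_w R L) (regular_pi alpha pi0) a xi (int_of_nat k).
  move=> k; rewrite /T (integrated_sum _ _ us as0 diag0).
  rewrite (integrated_sum _ _ us as0 reg0) fct_sumE.
  rewrite (lin_sum (slice_linear (p1:=p1) k)); apply: eq_bigr => n _.
  by rewrite slice_diagonal// slice_translate slice_join// /xi' /= nat_of_intK.
rewrite nE.
under eq_esum do rewrite -TE.
rewrite -joinE ?join_slice; last exact: psummable_slice.
by apply: ereal_sup_ubound; exists eta => //=; rewrite joinE// -nE.
Qed.

End ReducedLeFull.

Lemma sigma_finite_count_prod (R : realType) d (Y : measurableType d)
    (nu : {sigma_finite_measure set Y -> \bar R}) :
  sigma_finite setT (count_prod nu).
Proof.
have /sigma_finiteP[G [TG ndG Goo]] := sigma_finiteT nu.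
(* The rectangles exhaust the product because the sets [G n] can be taken increasing. *)
exists (fun n => `I_n.+1 `*` G n).
  apply/seteqP; split => // -[k y] _.
  have [n _ Gny] : (\bigcup_n G n) y by rewrite -TG.
  exists (maxn k n) => //; split => /=; first by rewrite ltnS leq_maxl.
  by move: y Gny; exact/subsetPset/ndG/leq_maxr.
move=> n; have [mG Gn] := Goo n; split; first exact: measurableX.
have [x x0 cE] : exists2 x : R, 0 <= x & @counting nat R `I_n.+1 = x%:E.
  by rewrite /counting asboolT//; eexists; last reflexivity.
rewrite [ltLHS](product_measure1E (@counting nat R) nu)// [X in (X * _)%E]cE.
by rewrite lte_mul_pinfty// lee_fin.
Qed.

Definition count_prod_sfm (R : realType) d (Y : measurableType d)
    (nu : {sigma_finite_measure set Y -> \bar R}) :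
    {sigma_finite_measure set (nat * Y)%type -> \bar R} :=
  HB.pack (Measure.sort (count_prod nu))
    (Measure_isSigmaFinite.Build _ _ _ (count_prod nu)
       (sigma_finite_count_prod nu)).

(** * Equality of the two seminorms and the canonical map *)

Section FullEqReduced.
Context (R : realType) (p : R) (p1 : 1 <= p) (E : normedModType R[i]).
Variables (A : set (E -> E)) (alpha : int -> (E -> E) -> (E -> E)).
Hypothesis A0 : A 0.
Hypothesis Abounded : A `<=` @bounded_operator R E.
Hypothesis Alin : forall c a b, A a -> A b -> A (c *: a + b).
Hypothesis Acomp : forall a b, A a -> A b -> A (a \o b).
Hypothesis alphaA : forall n a, A a -> A (alpha n a).
Hypothesis alpha0 : forall a, alpha 0 a = a.
Hypothesis alphaD : forall m n a, alpha (m + n) a = alpha m (alpha n a).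
Hypothesis alpha_lin : forall n c a b,
  alpha n (c *: a + b) = c *: alpha n a + alpha n b.
Hypothesis alpha_comp : forall n a b, alpha n (a \o b) = alpha n a \o alpha n b.
Hypothesis alpha_norm : forall n a, (opnorm (alpha n a) <= opnorm a)%E.

Let alpha00 n : alpha n 0 = 0.
Proof.
have := alpha_lin n (-1) 0 0.
by rewrite scaler0 addr0 scaleN1r addNr.
Qed.

Lemma full_norm_eq_reduced_norm a : Cc A a ->
  full_norm p1 A alpha a = reduced_norm p1 A alpha a.
Proof.
move=> ca; apply/eqP; rewrite eq_le; apply/andP; split.
  apply: ge_ereal_sup => _ [dY [Y [nu [w [pi [cov nd ->]]]]]].
  apply: le_trans (full_le_reduced p1 A0 cov ca alpha00) _.
  apply: ereal_sup_ubound; exists dY, Y, nu, pi; split => //.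
  by case: cov.
apply: ge_ereal_sup => _ [dY [Y [nu [pi0 [rep nd ->]]]]].
apply: le_trans (reduced_le_full A0 Abounded alphaA alpha_lin alpha_norm rep ca) _.
apply: ereal_sup_ubound.
exists _, (nat * Y)%type, (count_prod_sfm nu), (translate (p1 := p1) (nu := nu)),
  (diagonal alpha pi0); split => //.
  exact: regular_covariant.
exact: regular_nondegenerate.
Qed.

Lemma Cc_lin c a b : Cc A a -> Cc A b -> Cc A (c *: a + b).
Proof.
move=> [fa Aa] [fb Ab]; split; last by move=> n; exact: Alin.
apply: (@sub_finite_set _ _ ([set n | a n <> 0] `|` [set n | b n <> 0])).
  move=> n /= h; apply: contrapT => /not_orP[/contrapT an /contrapT bn]; apply: h.
  by rewrite -[LHS]/(c *: a n + b n) an bn scaler0 addr0.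
by rewrite finite_setU.
Qed.

Lemma Cc_mul_closed a b : Cc A a -> Cc A b -> Cc A (Cc_mul alpha a b).
Proof.
move=> [fa Aa] [fb Ab]; have [s us as0] := finite_support_seq fa.
have [t ut bt0] := finite_support_seq fb.
have mulE n : Cc_mul alpha a b n = \sum_(k <- s) (a k \o alpha k (b (n - k))).
  rewrite /Cc_mul -(fsbig_widen [set` s] setT)//; last first.
    by move=> k [_ /= /negP ns]; rewrite as0.
  by rewrite -fsbig_seq.
split; last first.
  move=> n; rewrite mulE; elim/big_rec: _ => // k x _ Ax.
  rewrite -[X in X + _]scale1r; apply: Alin => //.
  by apply: Acomp => //; exact: alphaA.
apply: (@sub_finite_set _ _ [set` [seq k + l | k <- s, l <- t]]); last exact: finite_seq.
move=> n /= h; apply: contrapT => /negP nst; apply: h.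
rewrite mulE big_seq big1// => k ks; rewrite bt0 ?alpha00.
  apply/funext => x /=; have [lak _] := Abounded (Aa k).
  exact: (lin0 lak).
apply: contra nst => nt; apply/allpairsP; exists (k, n - k); split => //=.
by rewrite addrC subrK.
Qed.

Lemma kappa_r_isometric_bijection (F : Fp p1 A alpha) (Fr : Fp_r p1 A alpha) :
  exists kappa : F -> Fr,
    [/\ is_kappa_r kappa,
        forall kappa' : F -> Fr, is_kappa_r kappa' -> kappa' = kappa,
        forall x : F, `|kappa x| = `|x| &
        bijective kappa].
Proof.
have [kappa [[kl km ki ke kb] kuniq]] :=
  completion_isometry F Fr Cc_lin Cc_mul_closed full_norm_eq_reduced_norm.
exists kappa; split => //.
- by split => // x; rewrite !normE ki.
- by move=> kappa' [kl' _ kc' ke']; exact: kuniq.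
- by move=> x; rewrite !normE ki.
Qed.

End FullEqReduced.

(** * Weighted composition operators *)

Section PushLe.
Context d1 (T1 : measurableType d1) d2 (T2 : measurableType d2) (R : realType).
Variables (m1 : {measure set T1 -> \bar R}) (m2 : {measure set T2 -> \bar R}).

(* Makes composition with phi bounded from L^p(m2) to L^p(m1). *)
Definition push_le (phi : T1 -> T2) (c : R) :=
  [/\ measurable_fun setT phi, 0 <= c &
      forall K, measurable K -> (m1 (phi @^-1` K) <= c%:E * m2 K)%E].

Lemma push_le_ae phi c (P : T2 -> Prop) : push_le phi c ->
  {ae m2, forall y, P y} -> {ae m1, forall x, P (phi x)}.
Proof.
move=> [mphi c0 le] [N [mN N0 PN]]; exists (phi @^-1` N); split.
- by rewrite -[X in measurable X]setTI; exact: mphi.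
- apply/eqP; rewrite eq_le measure_ge0 andbT.
  by apply: le_trans (le _ mN) _; rewrite N0 mule0.
- by move=> x /= Px; exact: PN.
Qed.

Lemma cmeasurable_comp (phi : T1 -> T2) (f : T2 -> R[i]) :
  measurable_fun setT phi -> cmeasurable f -> cmeasurable (f \o phi).
Proof.
by move=> mphi [fr fi]; split; [exact: (measurableT_comp fr mphi)|
  exact: (measurableT_comp fi mphi)].
Qed.

(** Change of variables: the pushforward of m1 along phi is dominated by c m2, hence so are its
    integrals of nonnegative functions. *)
Lemma push_le_power phi c p (f : T2 -> R[i]) : push_le phi c ->
  cmeasurable f -> (Lp_power m1 p (f \o phi) <= c%:E * Lp_power m2 p f)%E.
Proof.
move=> [mphi c0 le] mf; have mg := measurable_Lp_power p mf.
rewrite /Lp_power.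
rewrite -[leLHS](ge0_integral_pushforward mphi m1 measurableT mg)//; last first.
  by move=> y _; rewrite lee_fin powR_ge0.
rewrite -(ge0_integral_mscale m2 measurableT (NngNum c0))//; last first.
- by move=> y _; rewrite lee_fin powR_ge0.
pose m1phi : {measure set T2 -> \bar R} :=
  measure_function_pushforward__canonical__measure_function_Measure m1 mphi.
apply: (@ge0_le_measure_integral _ _ _ m1phi (mscale (NngNum c0) m2)).
- exact: le.
- exact: measurableT.
- by move=> y; rewrite lee_fin powR_ge0.
- exact: mg.
Qed.

Lemma push_le_in_Lp phi c p (p1 : 1 <= p) (f : T2 -> R[i]) :
  push_le phi c -> in_Lp m2 p f -> in_Lp m1 p (f \o phi).
Proof.
move=> h hf; have [mphi c0 _] := h; apply: in_LpP => //.
  by apply: cmeasurable_comp => //; case: hf.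
apply: le_lt_trans (push_le_power p h hf.1) _.
by rewrite lte_mul_pinfty// (in_Lp_power p1 hf).
Qed.

End PushLe.

Lemma push_le_comp (R : realType) d1 (T1 : measurableType d1) d2
    (T2 : measurableType d2) d3 (T3 : measurableType d3)
    (m1 : {measure set T1 -> \bar R}) (m2 : {measure set T2 -> \bar R})
    (m3 : {measure set T3 -> \bar R}) phi psi (c e : R) :
  push_le m1 m2 phi c -> push_le m2 m3 psi e -> push_le m1 m3 (psi \o phi) (c * e).
Proof.
move=> [mphi c0 le] [mpsi e0 le']; split.
- exact: measurableT_comp.
- exact: mulr_ge0.
move=> K mK; rewrite comp_preimage.
have mpK : measurable (psi @^-1` K).
  by rewrite -[X in measurable X]setTI; exact: mpsi.
apply: le_trans (le _ mpK) _.
by rewrite EFinM -muleA lee_wpmul2l ?lee_fin// le'.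
Qed.

Section Domination.
Context d (T : measurableType d) (R : realType).
Variables (mu : {measure set T -> \bar R}) (p : R) (p1 : 1 <= p).

Let p0 : 0 < p. Proof. exact: lt_le_trans p1. Qed.

Lemma Lp_power_le (f g : T -> R[i]) C : cmeasurable f -> cmeasurable g -> 0 <= C ->
  (forall x, Normc.normc (f x) <= C * Normc.normc (g x)) ->
  (Lp_power mu p f <= (C `^ p)%:E * Lp_power mu p g)%E.
Proof.
move=> mf mg C0 fg; rewrite /Lp_power -ge0_integralZl//; last 3 first.
- exact: measurable_Lp_power.
- by move=> x _; rewrite lee_fin powR_ge0.
- by rewrite lee_fin powR_ge0.
apply: ge0_le_integral => //.
- by move=> x _; rewrite lee_fin powR_ge0.
- exact: measurable_Lp_power.
- apply: measurable_funeM; exact: measurable_Lp_power.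
- move=> x _; rewrite -EFinM lee_fin -powRM ?normc_ge0//.
  by rewrite (ler_powR_ge0 p0) ?mulr_ge0 ?normc_ge0.
Qed.

Lemma in_Lp_le (f g : T -> R[i]) C : cmeasurable f -> in_Lp mu p g -> 0 <= C ->
  (forall x, Normc.normc (f x) <= C * Normc.normc (g x)) -> in_Lp mu p f.
Proof.
move=> mf hg C0 fg; apply: in_LpP => //.
apply: le_lt_trans (Lp_power_le mf hg.1 C0 fg) _.
by rewrite lte_mul_pinfty ?lee_fin ?powR_ge0// (in_Lp_power p1 hg).
Qed.

Lemma cmeasurableM (f g : T -> R[i]) : cmeasurable f -> cmeasurable g ->
  cmeasurable (fun x => f x * g x).
Proof.
move=> [fr fi] [gr gi]; split.
  rewrite (_ : _ \o _ = (fun x => (@complex.Re R \o f) x * (@complex.Re R \o g) x) \-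
    (fun x => (@complex.Im R \o f) x * (@complex.Im R \o g) x)); last first.
    by apply/funext => x /=; case: (f x) (g x) => ? ? [].
  by apply: measurable_funB; exact: measurable_funM.
rewrite (_ : _ \o _ = (fun x => (@complex.Re R \o f) x * (@complex.Im R \o g) x) \+
    (fun x => (@complex.Im R \o f) x * (@complex.Re R \o g) x)); last first.
  by apply/funext => x /=; case: (f x) (g x) => ? ? [].
by apply: measurable_funD; exact: measurable_funM.
Qed.

Lemma cmeasurable_bool (b : T -> bool) : measurable [set x | b x] ->
  cmeasurable (fun x => (b x)%:R : R[i]).
Proof.
move=> mb; split; last first.
  by rewrite (_ : _ \o _ = cst 0)//; apply/funext => x /=; case: (b x).
rewrite (_ : _ \o _ = \1_[set x | b x]).
  exact: measurable_indic.
apply/funext => x /=; rewrite indicE.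
by case: (boolP (b x)) => bx; [rewrite mem_set|rewrite memNset//; exact/negP].
Qed.

Lemma in_Lp_bool (b : T -> bool) f : measurable [set x | b x] -> in_Lp mu p f ->
  in_Lp mu p (fun x => (b x)%:R * f x).
Proof.
move=> mb hf; apply: (in_Lp_le (C := 1) _ hf) => //.
  by apply: cmeasurableM hf.1; exact: cmeasurable_bool.
move=> x; rewrite mul1r; case: (b x); rewrite ?mul1r// mul0r Normc.normc0.
exact: normc_ge0.
Qed.

End Domination.

Section WeightedComposition.
Context d (T : measurableType d) (R : realType).
Variables (mu : {measure set T -> \bar R}) (p : R) (p1 : 1 <= p).
Variables (b : T -> bool) (phi : T -> T) (c : R).
Hypothesis mb : measurable [set x | b x].
Hypothesis phi_le : push_le mu mu phi c.
Local Notation L := (Lp mu p1).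

Definition weighted_comp (g : L) : L := Lp_of mu p1 (fun x => (b x)%:R * g (phi x)).

Lemma in_Lp_weighted_comp f : in_Lp mu p f -> in_Lp mu p (fun x => (b x)%:R * f (phi x)).
Proof. by move=> hf; apply: in_Lp_bool => //; exact: push_le_in_Lp phi_le hf. Qed.

Lemma weighted_compE g :
  {ae mu, forall x, weighted_comp g x = (b x)%:R * g (phi x)}.
Proof. by apply/Lp_ofE/in_Lp_weighted_comp/Lp_in_Lp. Qed.

Lemma weighted_comp_linear : linear weighted_comp.
Proof.
move=> a f g; apply: Lp_ext.
have h1 := push_le_ae phi_le (LpDE (a *: f) g).
have h2 := push_le_ae phi_le (LpZE a f).
have h3 := LpDE (a *: weighted_comp f) (weighted_comp g).
have h4 := LpZE a (weighted_comp f).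
have h5 := weighted_compE (a *: f + g).
have h6 := weighted_compE f; have h7 := weighted_compE g.
apply: filterS2 (filterI h1 (filterI h2 h5)) (filterI (filterI h3 h4) (filterI h6 h7)).
move=> x [e1 [e2 e5]] [[e3 e4] [e6 e7]].
by rewrite e5 e3 e4 e6 e7 e1 e2 mulrDr; congr (_ + _); rewrite mulrCA.
Qed.

Lemma weighted_comp_bounded : bounded_operator weighted_comp.
Proof.
have p0 : 0 < p by exact: lt_le_trans p1.
apply/bounded_operatorP; split; first exact: weighted_comp_linear.
have [mphi c0 _] := phi_le.
exists (c `^ p^-1); first exact: powR_ge0.
move=> /= g0; pose g : L := g0; rewrite -/g.
rewrite -(ler_powR_ge0 p0) ?mulr_ge0 ?rnorm_ge0 ?powR_ge0//.
rewrite powRM ?rnorm_ge0 ?powR_ge0// -powRrM mulVf ?gt_eqF// powRr1//.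
have hg := Lp_in_Lp g; have hr := in_Lp_weighted_comp hg.
rewrite -lee_fin EFinM rnorm_Lp_of// rnorm_power.
have mrep : cmeasurable (fun x => g (phi x)).
  by apply: cmeasurable_comp hg.1.
apply: le_trans (push_le_power p phi_le hg.1).
have := @Lp_power_le _ _ _ mu _ p1 _ _ 1 hr.1 mrep ler01.
rewrite powR1 mul1e; apply => x; rewrite mul1r.
by case: (b x); rewrite ?mul1r// mul0r Normc.normc0 normc_ge0.
Qed.

End WeightedComposition.

(** * Replacing prefixes of infinite words *)

Section Words.
Context (R : realType) (d : nat) (hd : (1 < d)%N).
Local Notation Z := (Zset hd).
Local Notation X0 := (X0 hd).
Local Notation mu0 := (mu0 hd R : {measure set X0 -> \bar R}).
Implicit Types (w u : nat -> Z) (x y : X0).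

Definition cons_word (s : Z) (x : X0) : X0 := fun i => if i is j.+1 then x j else s.
Definition tail_word (x : X0) : X0 := fun i => x i.+1.

Lemma muX_cylinderE (k : nat) (K : set X0) : measurable K ->
  muX R hd ([set k] `*` K) = mu0 K.
Proof.
move=> mK; rewrite [LHS](product_measure1E (@counting nat R) (Defs.mu0 hd R))//.
rewrite [X in (X * _)%E](_ : _ = 1%E) ?mul1e//.
by rewrite /= /counting asboolT// fset_set1 finmap.cardfs1.
Qed.

Lemma measurable_cons s : measurable_fun setT (cons_word s).
Proof.
have := measurableT_comp (@measurable_h d hd) (@pair1_measurable _ _ nat X0 s).
move=> /(measurableT_comp measurable_snd); apply: eq_measurable_fun => x _ /=.
apply/funext => -[|i] //=; apply: val_inj => /=.
by rewrite modn_small//; exact: (ltn_ord (s : 'I_d)).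
Qed.

(* Compare h^-1({0} x K), of measure d * mu0 K, with its slice {s} x K_s. *)
Lemma push_le_cons s : push_le mu0 mu0 (cons_word s) d%:R.
Proof.
split => // [|K mK]; first exact: measurable_cons.
have m0 : measurable ([set 0%N] : set nat) by [].
have := @muX_h R d hd _ (measurableX m0 mK).
rewrite muX_cylinderE// => <-.
have mh : measurable (@h d hd @^-1` ([set 0%N] `*` K)).
  rewrite -[X in measurable X]setTI; apply: measurable_h => //.
  exact: measurableX.
have mc : measurable (cons_word s @^-1` K).
  by rewrite -[X in measurable X]setTI; exact: measurable_cons.
rewrite -(muX_cylinderE s mc); apply: le_measure; rewrite ?inE//.
  exact: measurableX.
have sd := ltn_ord (s : 'I_d).
move=> [k x] /= [-> Kx]; split; first by rewrite divn_small.
rewrite (_ : (fun i => _) = cons_word s x)//.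
by apply/funext => -[|i] //=; apply: val_inj => /=; rewrite modn_small.
Qed.

(* {0} x tail^-1(K) is contained in h_inv^-1({0, .., d-1} x K), of measure
   mu0 K. *)
Lemma push_le_tail : push_le mu0 mu0 tail_word 1.
Proof.
split => // [|K mK]; first exact: measurable_shift.
have ms : measurable (tail_word @^-1` K).
  by rewrite -[X in measurable X]setTI; exact: measurable_shift.
have mI : measurable (`I_d `*` K) by exact: measurableX.
rewrite mul1e -(muX_cylinderE 0 ms).
apply: le_trans (_ : muX R hd (@h_inv d hd @^-1` (`I_d `*` K)) <= _)%E.
  apply: le_measure; rewrite ?inE.
  - exact: measurableX.
  - by rewrite -[X in measurable X]setTI; apply: measurable_h_inv.
  - move=> [k x] /= [-> Kx]; split => //.
    by rewrite muln0 add0n; exact: (ltn_ord (x 0%N : 'I_d)).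
rewrite muX_h_inv//.
have -> : muX R hd (`I_d `*` K) = (d%:R%:E * mu0 K)%E.
  rewrite [LHS](product_measure1E (@counting nat R) (Defs.mu0 hd R))//.
  congr (_ * _)%E; rewrite /= /counting asboolT// fset_set_II.
  by rewrite finmap.card_imfset//=; [rewrite -cardE card_ord|exact: val_inj].
rewrite muleA -EFinM mulVf ?mul1e//.
by rewrite pnatr_eq0 -lt0n ltnW.
Qed.

Definition cat_word (r : nat) (w : nat -> Z) (y : X0) : X0 :=
  fun i => if (i < r)%N then w i else y (i - r)%N.

Definition replace (r : nat) (w : nat -> Z) (x : X0) : X0 :=
  fun i => if (i < r)%N then w i else x i.

Lemma replaceE r w : replace r w = cat_word r w \o @drop_seq d hd r.
Proof.
apply/funext => x; apply/funext => i; rewrite /replace /cat_word /drop_seq /=.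
by case: ltnP => // ri; rewrite subnKC.
Qed.

Lemma push_le_drop r : push_le mu0 mu0 (@drop_seq d hd r) 1.
Proof.
elim: r => [|r IH].
  rewrite (_ : drop_seq 0 = id); last by apply/funext => x; apply/funext.
  split => // K mK; by rewrite preimage_id mul1e.
rewrite (_ : drop_seq _ = tail_word \o @drop_seq d hd r); last first.
  by apply/funext => x; apply/funext => i; rewrite /drop_seq /tail_word /= addSnnS.
by rewrite -[1]mulr1; apply: push_le_comp IH push_le_tail.
Qed.

(** Each letter put in front concentrates the measure on a cylinder of measure 1/d, hence one factor
    d per letter. *)
Lemma push_le_cat r w : push_le mu0 mu0 (cat_word r w) (d%:R ^+ r).
Proof.
elim: r w => [w|r IH w].
  rewrite (_ : cat_word 0 w = id); last first.
    by apply/funext => x; apply/funext => i; rewrite /cat_word /= subn0.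
  by split => // K mK; rewrite preimage_id expr0 mul1e.
rewrite (_ : cat_word _ _ = cons_word (w 0%N) \o cat_word r (w \o S)).
  by rewrite exprSr; apply: push_le_comp (IH _) (push_le_cons _).
by apply/funext => x; apply/funext => -[|i] //.
Qed.

Lemma push_le_replace r w : push_le mu0 mu0 (replace r w) (d%:R ^+ r).
Proof.
rewrite replaceE -[_ ^+ r]mul1r.
exact: push_le_comp (push_le_drop r) (push_le_cat r w).
Qed.

(** A boolean form of [cylinder], so that it can serve as the weight of [weighted_comp]. *)
Definition in_cyl (r : nat) (w : nat -> Z) (x : X0) : bool :=
  all (fun i => x i == w i) (iota 0 r).

Lemma in_cylP r w x : reflect (forall i, (i < r)%N -> x i = w i) (in_cyl r w x).
Proof.
apply: (iffP allP) => h i; first by move=> ir; apply/eqP/h; rewrite mem_iota.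
by rewrite mem_iota => /andP[_ ir]; apply/eqP/h.
Qed.

Lemma measurable_in_cyl r w : measurable [set x | in_cyl r w x].
Proof.
rewrite (_ : [set x | _] = cylinder r w); first exact: measurable_cylinder.
by apply/seteqP; split => x /= /in_cylP.
Qed.

Section ReplaceOperator.
Context (p : R) (p1 : 1 <= p).
Local Notation L := (Lp mu0 p1).

(* The matrix unit of D_ r sending the word u to the word w, tensored with 1;
   only the first r letters of w and u matter. *)
Definition replace_op r w u : L -> L :=
  weighted_comp (in_cyl r w) (replace r u).

Lemma replace_opE r w u g : {ae mu0, forall x,
  replace_op r w u g x = (in_cyl r w x)%:R * g (replace r u x)}.
Proof.
exact: (weighted_compE (measurable_in_cyl r w) (push_le_replace r u)).
Qed.

Lemma replace_op_bounded r w u : bounded_operator (replace_op r w u).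
Proof.
exact: (weighted_comp_bounded p1 (measurable_in_cyl r w) (push_le_replace r u)).
Qed.

End ReplaceOperator.
End Words.

(** * Elementary tensors *)

Section LpSums.
Context d (T : measurableType d) (R : realType).
Variables (mu : {measure set T -> \bar R}) (p : R) (p1 : 1 <= p).
Local Notation L := (Lp mu p1).

Lemma Lp_sumE (I : Type) (s : seq I) (g : I -> L) :
  {ae mu, forall x, (\sum_(i <- s) g i : L) x = \sum_(i <- s) g i x}.
Proof.
elim: s => [|i s IH].
  by rewrite big_nil; apply: filterS (Lp0E mu p1) => x ->; rewrite big_nil.
rewrite big_cons; apply: filterS2 IH (LpDE (g i) (\sum_(j <- s) g j)) => x IH ->.
by rewrite big_cons IH.
Qed.

Lemma Lp_sumZE (I : finType) (c : I -> R[i]) (g : I -> L) :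
  {ae mu, forall x, (\sum_i c i *: g i : L) x = \sum_i c i * g i x}.
Proof.
have h : {ae mu, forall x, forall i, (c i *: g i : L) x = c i * g i x}.
  by apply: filter_forall => i; exact: LpZE.
apply: filterS2 (Lp_sumE (index_enum I) (fun i => c i *: g i)) h => x -> h.
by apply: eq_bigr => i _.
Qed.

Lemma in_Lp_ae f g : cmeasurable f -> in_Lp mu p g ->
  {ae mu, forall x, f x = g x} -> in_Lp mu p f.
Proof.
move=> mf hg fg; apply: in_LpP => //.
by rewrite (eq_Lp_power p1 mf hg.1 fg) (in_Lp_power p1 hg).
Qed.

Lemma cmeasurable_sum (I : Type) (s : seq I) (f : I -> T -> R[i]) :
  (forall i, cmeasurable (f i)) -> cmeasurable (fun x => \sum_(i <- s) f i x).
Proof.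
move=> mf; elim: s => [|i s IH].
  rewrite (_ : (fun x => _) = cst 0); first exact: cmeasurable_cst.
  by apply/funext => x; rewrite big_nil.
rewrite (_ : (fun x => _) = (fun x => f i x + \sum_(j <- s) f j x)).
  exact: cmeasurableD.
by apply/funext => x; rewrite big_cons.
Qed.

End LpSums.

Section CountingLp.
Context (R : realType) (p : R) (p1 : 1 <= p).
Local Notation lp := (Lp (@counting nat R) p1).

Let p0 : 0 < p. Proof. exact: lt_le_trans p1. Qed.

(** Only the empty set is null for counting measure, so elements of l^p can be evaluated
    pointwise. *)
Lemma ae_counting (P : nat -> Prop) :
  {ae @counting nat R, forall k, P k} -> forall k, P k.
Proof.
move=> [N [mN N0 PN]] k; apply: contrapT => nP; have Nk := PN _ nP.
have : (@counting nat R [set k] <= @counting nat R N)%E.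
  by apply: le_measure; rewrite ?inE// => _ ->.
rewrite [X in (_ <= X)%E]N0 /= /counting asboolT// fset_set1 finmap.cardfs1.
by rewrite lee_fin ler10.
Qed.

Lemma lp_ext (f g : lp) : (forall k, f k = g k) -> f = g.
Proof. by move=> fg; apply: Lp_ext; exact: aeW. Qed.

Lemma lp_linE a (f g : lp) k : (a *: f + g : lp) k = a * f k + g k.
Proof.
by rewrite (ae_counting (LpDE (a *: f) g)) (ae_counting (LpZE a f)).
Qed.

Lemma lp_sumZE (I : finType) (c : I -> R[i]) (g : I -> lp) k :
  (\sum_i c i *: g i : lp) k = \sum_i c i * g i k.
Proof. exact: (ae_counting (Lp_sumZE c g)). Qed.

Lemma Lp_power_counting (f : nat -> R[i]) : Lp_power (@counting nat R) p f =
  (\esum_(k in [set: nat]) (Normc.normc (f k) `^ p)%:E)%E.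
Proof.
rewrite /Lp_power ge0_integral_count => [|k]; last by rewrite lee_fin powR_ge0.
by rewrite nneseries_esumT// => k; rewrite lee_fin powR_ge0.
Qed.

Lemma rnorm_lp (f : lp) :
  ((rnorm f `^ p)%:E = \esum_(k in [set: nat]) (Normc.normc (f k) `^ p)%:E)%E.
Proof. by rewrite rnorm_power Lp_power_counting. Qed.

Lemma in_lp_delta k : in_Lp (@counting nat R) p (fun i => (i == k)%:R).
Proof.
apply: in_LpP => //; rewrite Lp_power_counting (esumID [set k])//=; last first.
  by move=> *; rewrite lee_fin powR_ge0.
rewrite setTI esum_set1 ?lee_fin ?powR_ge0// [X in (_ + X)%E]esum1 ?adde0 ?ltry//.
by move=> i [_ /= /eqP/negbTE ->]; rewrite Normc.normc0 powR0// gt_eqF.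
Qed.

Definition lp_delta k : lp := Lp_of (@counting nat R) p1 (fun i => (i == k)%:R).

Lemma lp_deltaE k i : lp_delta k i = (i == k)%:R.
Proof. exact: (ae_counting (Lp_ofE p1 (in_lp_delta k))). Qed.

End CountingLp.

Section Tensor.
Context d (T : measurableType d) (R : realType).
Variables (nu : {sigma_finite_measure set T -> \bar R}) (p : R) (p1 : 1 <= p).
Local Notation lp := (Lp (@counting nat R) p1).
Local Notation L := (Lp nu p1).
Local Notation M := (count_prod nu).
Local Notation LM := (Lp M p1).

Let p0 : 0 < p. Proof. exact: lt_le_trans p1. Qed.

(** Given by its slices, on which all later identities are checked; [tensorE] identifies it with the
    class of the product function. *)
Definition tensor (f : lp) (g : L) : LM := join (fun k => f k *: g).

Lemma psummable_tensor (f : lp) (g : L) : psummable (fun k => f k *: g).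
Proof.
rewrite /psummable (eq_esum (b := fun k =>
    ((rnorm g `^ p)%:E * (Normc.normc (f k) `^ p)%:E)%E)); last first.
  by move=> k _; rewrite -EFinM rnormZ powRM ?normc_ge0 ?rnorm_ge0// mulrC.
rewrite esumZl_nat ?powR_ge0//; last by move=> k; rewrite lee_fin powR_ge0.
by rewrite -rnorm_lp -EFinM ltry.
Qed.

Lemma slice_tensor k f g : slice k (tensor f g) = f k *: g.
Proof. by rewrite slice_join//; exact: psummable_tensor. Qed.

Lemma in_Lp_tensor (f : lp) (g : L) : in_Lp M p (fun z => f z.1 * g z.2).
Proof.
apply: in_Lp_ae (in_Lp_join (psummable_tensor f g)) _ => //.
  by apply: cmeasurable_sections => k; exact: (cmeasurableZ (f k) (Lp_measurable g)).
by apply/ae_sections => k; apply: filterS (LpZE (f k) g) => y ->.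
Qed.

Lemma tensorE (f : lp) (g : L) :
  Lp_of M p1 (fun z => f z.1 * g z.2) = tensor f g.
Proof.
apply: slice_ext => k; rewrite slice_tensor; apply: Lp_ext.
have h := (ae_sections _ _).1 (Lp_ofE p1 (in_Lp_tensor f g)) k.
have h' := sliceE k (Lp_of M p1 (fun z => f z.1 * g z.2)).
by apply: filterS2 (filterI h' h) (LpZE (f k) g) => y [e1 e2] e3; rewrite e1 e2 e3.
Qed.

Lemma tensor_linear_l g : linear (tensor^~ g).
Proof.
move=> a f f'; apply: slice_ext => k; rewrite slice_linear !slice_tensor.
by rewrite lp_linE scalerDl scalerA.
Qed.

Lemma tensor_linear_r f : linear (tensor f).
Proof.
move=> a g g'; apply: slice_ext => k; rewrite slice_linear !slice_tensor.
by rewrite scalerDr !scalerA [f k * a]mulrC.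
Qed.

Lemma inject_tensor k g : inject k g = tensor (lp_delta p1 k) g.
Proof.
apply: slice_ext => i; rewrite slice_inject slice_tensor lp_deltaE.
by case: eqP => _; rewrite ?scale1r ?scale0r.
Qed.

(** Slice k of the sum is a combination of the g_m with scalars f_m(k), so b acts on each slice
    separately. Finite sums are needed because a bound on single tensors would not bound an
    operator. *)
Lemma rnorm_tensor_right n (f : 'I_n -> lp) (g : 'I_n -> L) (b : L -> L) C :
  0 <= C -> linear b -> bound_by C b ->
  rnorm (\sum_m tensor (f m) (b (g m))) <= C * rnorm (\sum_m tensor (f m) (g m)).
Proof.
move=> C0 lb bC; pose eta := \sum_m tensor (f m) (g m).
rewrite -[X in rnorm X](join_slice); apply: (join_bound C0 _).2 => k.
rewrite [X in rnorm X <= _](_ : _ = b (slice k eta)); first exact: bC.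
rewrite (lin_sum (slice_linear (p1:=p1) k)) /eta (lin_sum (slice_linear (p1:=p1) k)).
rewrite (lin_sum lb); apply: eq_bigr => m _.
by rewrite !slice_tensor (linZ lb).
Qed.

Section SumTensor.
Variables (n : nat) (f : 'I_n -> lp) (g : 'I_n -> L).

Let H k y := (Normc.normc (\sum_m f m k * g m y) `^ p)%:E.

Let mF k : cmeasurable (fun y => \sum_m f m k * g m y).
Proof.
by apply: cmeasurable_sum => m; exact: (cmeasurableZ (f m k) (Lp_measurable (g m))).
Qed.

Let H0 k y : (0 <= H k y)%E. Proof. by rewrite lee_fin powR_ge0. Qed.

Let mH k : measurable_fun setT (H k).
Proof. exact: measurable_Lp_power (mF k). Qed.

Let HE y : ((rnorm (\sum_m g m y *: f m) `^ p)%:E = \sum_(k <oo) H k y)%E.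
Proof.
rewrite rnorm_lp nneseries_esumT//; apply: eq_esum => k _.
rewrite lp_sumZE /H; congr (Normc.normc _ `^ p)%:E.
by apply: eq_bigr => m _; rewrite mulrC.
Qed.

Lemma measurable_rnorm_sum :
  measurable_fun setT (fun y => (rnorm (\sum_m g m y *: f m) `^ p)%:E).
Proof.
rewrite (_ : (fun y => _) = (fun y => \sum_(k <oo) H k y)%E).
  by apply: ge0_emeasurable_sum.
by apply/funext => y; exact: HE.
Qed.

(** Tonelli: the sum over k and the integral over y of |sum_m f_m(k) g_m(y)|^p are exchanged, and
    the sum inside is then a p-th power of an l^p norm. *)
Lemma rnorm_sum_tensor :
  ((rnorm (\sum_m tensor (f m) (g m)) `^ p)%:E =
   \int[nu]_y (rnorm (\sum_m g m y *: f m) `^ p)%:E)%E.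
Proof.
rewrite rnorm_slices (eq_integral (fun y => \sum_(k <oo) H k y)%E) => [|y _]; last first.
  exact: HE.
rewrite integral_nneseries// nneseries_esumT; last first.
  by move=> k; apply: integral_ge0 => y _; exact: H0.
apply: eq_esum => k _; rewrite (lin_sum (slice_linear (p1:=p1) k)).
rewrite (eq_bigr (fun m => f m k *: g m)); last by move=> m _; rewrite slice_tensor.
rewrite rnorm_power; apply: (@eq_Lp_power _ _ _ nu p p1).
- exact: Lp_measurable.
- exact: mF.
exact: Lp_sumZE.
Qed.

End SumTensor.

(* Fubini: the norm is the L^p norm of y |-> || sum_m g_m(y) f_m ||, on which
   the operator a acts fibrewise. *)
Lemma rnorm_tensor_left n (f : 'I_n -> lp) (g : 'I_n -> L) (a : lp -> lp) C :
  0 <= C -> linear a -> bound_by C a ->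
  rnorm (\sum_m tensor (a (f m)) (g m)) <= C * rnorm (\sum_m tensor (f m) (g m)).
Proof.
move=> C0 la aC; rewrite -(ler_powR_ge0 p0) ?mulr_ge0 ?rnorm_ge0//.
rewrite powRM ?rnorm_ge0// -lee_fin EFinM !rnorm_sum_tensor.
rewrite -ge0_integralZl//; last 3 first.
- exact: measurable_rnorm_sum.
- by move=> y _; rewrite lee_fin powR_ge0.
- by rewrite lee_fin powR_ge0.
apply: ge0_le_integral => //.
- by move=> y _; rewrite lee_fin powR_ge0.
- exact: measurable_rnorm_sum.
- by apply: measurable_funeM; exact: measurable_rnorm_sum.
move=> y _; rewrite -EFinM lee_fin -powRM ?rnorm_ge0//.
rewrite (ler_powR_ge0 p0) ?mulr_ge0 ?rnorm_ge0//.
rewrite (_ : \sum_m _ = a (\sum_m g m y *: f m)); first exact: aC.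
by rewrite (lin_sum la); apply: eq_bigr => m _; rewrite (linZ la).
Qed.

End Tensor.

#[global] Opaque tensor.

(** * The finite levels of the UHF algebra *)

Section FiniteLevels.
Context (R : realType) (p : R) (p1 : 1 <= p) (d : nat) (hd : (1 < d)%N) (r : nat).
Local Notation Z := (Zset hd).
Local Notation X0 := (X0 hd).
Local Notation mu0 := (mu0 hd R : {measure set X0 -> \bar R}).
Local Notation tZ := (r.-tuple Z).
Local Notation lam := (lambda R hd r).
Local Notation L := (Lp mu0 p1).
Local Notation Lt := (Lp lam p1).
Local Notation rep := (@replace_op R d hd p p1 r).
Local Notation Dr := (@D_ R p p1 d hd r).

Lemma measurable_tuple_set (A : set tZ) : measurable A.
Proof.
have m1 (t : tZ) : measurable [set t].
  rewrite (_ : [set t] = \bigcap_(i in [set: 'I_r]) ((fun s => tnth s i) @^-1` [set tnth t i])).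
    apply: fin_bigcap_measurable => // i _; rewrite -[X in measurable X]setTI.
    exact: measurable_tnth.
  apply/seteqP; split => [s -> i|s /= h]//.
  by apply: eq_from_tnth => i; exact: h.
rewrite (_ : A = \bigcup_(t in A) [set t]).
  by apply: fin_bigcup_measurable.
by apply/seteqP; split => [t At|t [s As ->]]//; exists t.
Qed.

Lemma lambda_point (t : tZ) : lam [set t] = (d%:R ^- r)%:E.
Proof.
rewrite /lambda /= /mscale /= /counting asboolT// fset_set1 finmap.cardfs1.
by rewrite mule1.
Qed.

Lemma lambda_fin : exists2 C : R, 0 <= C & lam setT = C%:E.
Proof.
rewrite /lambda /= /mscale /= /counting asboolT; last exact: finite_finset.
by eexists; last by rewrite -EFinM; reflexivity.
Qed.

Let dr0 : 0 < d%:R ^- r :> R.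
Proof. by rewrite invr_gt0 exprn_gt0// ltr0n ltnW. Qed.

Lemma ae_lambda (P : tZ -> Prop) : {ae lam, forall t, P t} -> forall t, P t.
Proof.
move=> [N [mN N0 PN]] t; apply: contrapT => nP; have Nt := PN _ nP.
have : (lam [set t] <= lam N)%E.
  by apply: le_measure; rewrite ?inE//; [exact: measurable_tuple_set|move=> _ ->].
by rewrite N0 lambda_point lee_fin leNgt dr0.
Qed.

Lemma cmeasurable_tuple (f : tZ -> R[i]) : cmeasurable f.
Proof. by split => _ K _; rewrite setTI; exact: measurable_tuple_set. Qed.

Definition tuple_bound (f : tZ -> R[i]) : R := \sum_t Normc.normc (f t).

Lemma tuple_boundP (f : tZ -> R[i]) t : Normc.normc (f t) <= tuple_bound f.
Proof.
rewrite /tuple_bound (bigD1 t)//= lerDl sumr_ge0// => s _; exact: normc_ge0.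
Qed.

Lemma tuple_bound_ge0 f : 0 <= tuple_bound f.
Proof. by apply: sumr_ge0 => t _; exact: normc_ge0. Qed.

Lemma in_Lp_tuple (f : tZ -> R[i]) : in_Lp lam p f.
Proof.
have h1 : in_Lp lam p (cst 1).
  apply: in_LpP; first exact: cmeasurable_tuple.
  rewrite /Lp_power (eq_integral (cst 1%E)) => [|t _]; last first.
    by rewrite /= expr1n expr0n/= addr0 sqrtr1 powR1.
  rewrite integral_cst; last exact: (measurable_tuple_set setT).
  by have [C _ ->] := lambda_fin; rewrite mul1e ltry.
apply: (in_Lp_le p1 (cmeasurable_tuple f) h1 (tuple_bound_ge0 f)) => t.
by rewrite /= expr1n expr0n/= addr0 sqrtr1 mulr1 tuple_boundP.
Qed.

Lemma Lt_ofE f t : Lp_of lam p1 f t = f t.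
Proof. exact: (ae_lambda (Lp_ofE p1 (in_Lp_tuple f))). Qed.

Definition word (t : tZ) : nat -> Z := nth point t.

Definition prefix (w : nat -> Z) : tZ := [tuple w i | i < r].

Lemma word_prefix w i : (i < r)%N -> word (prefix w) i = w i.
Proof.
move=> ir; rewrite /word -(tnth_nth point _ (Ordinal ir)).
by rewrite tnth_mktuple.
Qed.

Lemma prefix_word t : prefix (word t) = t.
Proof.
apply: eq_from_tnth => i; rewrite tnth_mktuple /word.
by rewrite -tnth_nth.
Qed.

Lemma take_seqE (x : X0) : take_seq r x = prefix x.
Proof. by []. Qed.

Lemma prefix_eqP (w u : nat -> Z) :
  reflect (forall i, (i < r)%N -> w i = u i) (prefix w == prefix u).
Proof.
apply: (iffP eqP) => [h i ir|h].
  by rewrite -(word_prefix w ir) h word_prefix.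
by apply: eq_from_tnth => i; rewrite !tnth_mktuple h.
Qed.

Lemma in_cyl_prefix w (x : X0) : in_cyl r w x = (prefix x == prefix w).
Proof. by apply/in_cylP/prefix_eqP. Qed.

Lemma prefix_replace u (x : X0) : prefix (replace r u x) = prefix u.
Proof. by apply/eqP/prefix_eqP => i ir; rewrite /replace ir. Qed.

Lemma drop_replace u (x : X0) : @drop_seq d hd r (replace r u x) = @drop_seq d hd r x.
Proof.
by apply/funext => i; rewrite /drop_seq /replace ltnNge leq_addr.
Qed.

Lemma measurable_take : measurable_fun setT (@take_seq d hd r).
Proof.
move=> _ A0 _; pose A : set tZ := A0; rewrite setTI.
rewrite (_ : _ @^-1` _ = \bigcup_(t in A) cylinder r (word t)).
  by apply: fin_bigcup_measurable => // t _; exact: measurable_cylinder.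
apply/seteqP; split => [x /= Ax|x [t At /= xt]].
  by exists (take_seq r x) => //= i ir; rewrite word_prefix.
suff -> : take_seq r x = t by [].
by rewrite take_seqE -[RHS]prefix_word; apply/eqP/prefix_eqP.
Qed.

Lemma in_Lp_elementary (f : tZ -> R[i]) (g : L) :
  in_Lp mu0 p (fun x => f (take_seq r x) * g (drop_seq r x)).
Proof.
have hg := push_le_in_Lp p1 (push_le_drop R hd r) (Lp_in_Lp g).
apply: (in_Lp_le p1 _ hg (tuple_bound_ge0 f)).
  apply: cmeasurableM hg.1.
  by apply: cmeasurable_comp; [exact: measurable_take|exact: cmeasurable_tuple].
move=> x; rewrite Normc.normcM /= ler_wpM2r ?normc_ge0//.
exact: tuple_boundP.
Qed.

Definition elementary (f : tZ -> R[i]) (g : L) : L :=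
  Lp_of mu0 p1 (fun x => f (take_seq r x) * g (drop_seq r x)).

Lemma elementaryE f g : {ae mu0, forall x,
  elementary f g x = f (take_seq r x) * g (drop_seq r x)}.
Proof. by apply: Lp_ofE; exact: in_Lp_elementary. Qed.

(** The first r letters are frozen to those of u, which leaves a function of the remaining
    coordinates. *)
Definition section_word (u : nat -> Z) (g : L) : L :=
  Lp_of mu0 p1 (fun y => g (cat_word r u y)).

Lemma section_wordE u g : {ae mu0, forall x,
  section_word u g (drop_seq r x) = g (replace r u x)}.
Proof.
have h := Lp_ofE p1 (push_le_in_Lp p1 (push_le_cat R r u) (Lp_in_Lp g)).
have := push_le_ae (push_le_drop R hd r) h.
by apply: filterS => x; rewrite replaceE.
Qed.

(** Exactly one of the finitely many words t of length r is the prefix of x, so g splits into the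
    tensors of the indicator of t with the section of g at t. *)
Lemma elementary_decomposition (g : L) :
  g = \sum_t elementary (fun s => (s == t)%:R) (section_word (word t) g).
Proof.
apply: Lp_ext.
have h1 := Lp_sumE (index_enum tZ)
  (fun t => elementary (fun s => (s == t)%:R) (section_word (word t) g)).
have h2 : {ae mu0, forall x, forall t, elementary (fun s => (s == t)%:R)
    (section_word (word t) g) x =
    (take_seq r x == t)%:R * section_word (word t) g (drop_seq r x)}.
  by apply: filter_forall => t; exact: elementaryE.
have h3 : {ae mu0, forall x, forall t,
    section_word (word t) g (drop_seq r x) = g (replace r (word t) x)}.
  by apply: filter_forall => t; exact: section_wordE.
apply: filterS2 h1 (filterI h2 h3) => x -> [e2 e3].
rewrite (bigD1 (take_seq r x))//= e2 e3 eqxx mul1r big1 ?addr0 => [|t tx].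
  congr (g _); apply/funext => i; rewrite /replace; case: ifP => // ir.
  by rewrite take_seqE word_prefix.
by rewrite e2 eq_sym (negbTE tx) mul0r.
Qed.

Lemma elementary_replace (f : tZ -> R[i]) u (g : L) :
  elementary f (section_word u g) =
  \sum_s f s *: rep (word s) u g.
Proof.
apply: Lp_ext.
have h1 := Lp_sumZE f (fun s => rep (word s) u g).
have h2 : {ae mu0, forall x, forall s, rep (word s) u g x =
    (in_cyl r (word s) x)%:R * g (replace r u x)}.
  by apply: filter_forall => s; exact: replace_opE.
have h3 := section_wordE u g; have h4 := elementaryE f (section_word u g).
apply: filterS2 (filterI h1 h2) (filterI h3 h4) => x [-> e2] [e3 ->].
rewrite e3 (bigD1 (take_seq r x))//= e2 in_cyl_prefix prefix_word eqxx mul1r.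
rewrite big1 ?addr0// => s sx; rewrite e2 in_cyl_prefix prefix_word -take_seqE.
by rewrite eq_sym (negbTE sx) mul0r mulr0.
Qed.

(** Applying a (x) 1 to the decomposition of g over the words t produces the matrix of a: the
    coefficient of the unit sending t to s is a(delta_t)(s). *)
Lemma D_span c : Dr c ->
  lspan [set o | exists w u, o = rep w u] c.
Proof.
move=> [bc [a ba ac]].
pose dl t : Lt := Lp_of lam p1 (fun s => (s == t)%:R).
rewrite (_ : c = \sum_t \sum_s a (dl t) s *: rep (word s) (word t)).
  apply: lspan_sum => t; apply: lspan_sum => s; rewrite -[X in lspan _ X]addr0.
  apply: lspan_lin; last exact: lspan0.
  by apply: lspan_sub; exists (word s), (word t).
apply/funext => g; rewrite {1}(elementary_decomposition g).
have [lc _] := bc; rewrite (lin_sum lc) fct_sumE; apply: eq_bigr => t _.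
rewrite fct_sumE -[RHS]elementary_replace -[RHS]ac; congr c.
rewrite /elementary; apply: eq_Lp_of.
- exact: (in_Lp_elementary (fun s => (s == t)%:R) (section_word (word t) g)).
- exact: (in_Lp_elementary (dl t) (section_word (word t) g)).
by apply: aeW => x; rewrite Lt_ofE.
Qed.

Lemma replace_op_D w u : Dr (rep w u).
Proof.
split; first exact: replace_op_bounded.
have mb : measurable [set t : tZ | t == prefix w] by exact: measurable_tuple_set.
have [C C0 CE] := lambda_fin.
(* The preimage of K under a constant map is empty or everything, of mass C; in the second case K
   contains a point, of mass d^-r, whence the constant C d^r. *)
have cst_le : push_le lam lam (cst (prefix u)) (C * d%:R ^+ r).
  split => [||K mK]; first exact: measurable_cst.
    by rewrite mulr_ge0// exprn_ge0.
  have [Ku|Ku] := pselect (K (prefix u)); last first.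
    by rewrite preimage_cst memNset// measure0 mule_ge0// lee_fin mulr_ge0// exprn_ge0.
  rewrite preimage_cst mem_set// CE EFinM -muleA -[leLHS]mule1 lee_wpmul2l ?lee_fin//.
  apply: le_trans (_ : (d%:R ^+ r)%:E * lam [set prefix u] <= _)%E; last first.
    rewrite lee_wpmul2l ?lee_fin ?exprn_ge0//; apply: le_measure; rewrite ?inE//.
    - exact: measurable_tuple_set.
    - by move=> _ ->.
  by rewrite lambda_point -EFinM mulfV// gt_eqF// exprn_gt0// ltr0n ltnW.
exists (weighted_comp (fun t => t == prefix w) (cst (prefix u))).
  exact: weighted_comp_bounded mb cst_le.
move=> f g; apply: Lp_ext.
pose af : Lt := weighted_comp (fun t => t == prefix w) (cst (prefix u)) f.
have h1 := @replace_opE R d hd p p1 r w u (elementary f g).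
have h2 := push_le_ae (push_le_replace R r u) (elementaryE f g).
have h3 := elementaryE af g.
apply: filterS2 (filterI h1 h2) h3 => x [-> ->] ->.
rewrite /af Lt_ofE take_seqE prefix_replace drop_replace in_cyl_prefix.
by rewrite mulrA.
Qed.

Lemma id_D : Dr (@id L).
Proof.
split; first exact: bounded_operator_id.
by exists id; [exact: bounded_operator_id|].
Qed.

End FiniteLevels.

(** * Powers of a conjugation *)

Section IntIteration.
Context (T : Type) (f g : T -> T).
Hypotheses (fK : cancel f g) (gK : cancel g f).

Definition int_iter (n : int) : T -> T :=
  match n with Posz k => iter k f | Negz k => iter k.+1 g end.

Lemma int_iterS n x : int_iter (n + 1) x = f (int_iter n x).
Proof.
case: n => [k|[|k]]; first by rewrite -PoszD addn1.
- by rewrite [Negz 0 + 1]addrC /= gK.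
- by rewrite (_ : Negz k.+1 + 1 = Negz k) ?NegzE; [rewrite /= gK|lia].
Qed.

Lemma int_iterD m n x : int_iter (m + n) x = int_iter m (int_iter n x).
Proof.
elim: m => [|m IH|m IH]; first by rewrite add0r.
  by rewrite -addn1 PoszD addrAC !int_iterS IH.
have h : int_iter (- m.+1%:Z + n) x = g (int_iter (- m%:Z + n) x).
  rewrite (_ : - m%:Z + n = - m.+1%:Z + n + 1) ?int_iterS ?fK//; lia.
rewrite h IH (_ : - m%:Z = - m.+1%:Z + 1) ?int_iterS ?fK//; lia.
Qed.

(** All integer powers are reached from the identity by composing with f or g on the left; each
    property of [beta_pow] then needs a check for [beta] and [beta_inv] only. *)
Lemma int_iter_ind (P : (T -> T) -> Prop) : P id ->
  (forall u, P u -> P (f \o u)) -> (forall u, P u -> P (g \o u)) ->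
  forall n, P (int_iter n).
Proof.
move=> Pid Pf Pg [k|k] /=.
  by elim: k => [|k IH]; [exact: Pid|exact: (Pf _ IH)].
by elim: k => [|k IH]; [exact: (Pg _ Pid)|exact: (Pg _ IH)].
Qed.

End IntIteration.

Section IsometricConjugation.
Context (R : realType) (E : normedModType R[i]) (V W : E -> E).
Hypotheses (VK : cancel V W) (WK : cancel W V) (lV : linear V).
Hypothesis Viso : forall x, rnorm (V x) = rnorm x.

Lemma linear_inverse : linear W.
Proof. by move=> a x y; rewrite -[LHS]/(W _) -{1}(WK x) -{1}(WK y) -lV VK. Qed.

Lemma isometric_inverse x : rnorm (W x) = rnorm x.
Proof. by rewrite -Viso WK. Qed.

(** With (V, W) equal to [(v, v_inv)] this is [beta], with the roles exchanged it is [beta_inv], so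
    each fact below serves twice. *)
Definition conjugate (b : E -> E) : E -> E := V \o b \o W.

Lemma conjugate_opnorm b : (opnorm (conjugate b) <= opnorm b)%E.
Proof.
apply: ge_ereal_sup => _ [x /= x1 <-]; rewrite /conjugate /= Viso.
by apply: ereal_sup_ubound; exists (W x) => //=; rewrite isometric_inverse.
Qed.

Lemma conjugate_lin c a b : conjugate (c *: a + b) = c *: conjugate a + conjugate b.
Proof. by apply/funext => x; rewrite /conjugate /= -[RHS]lV. Qed.

Lemma conjugate_comp a b : conjugate (a \o b) = conjugate a \o conjugate b.
Proof. by apply/funext => x; rewrite /conjugate /= VK. Qed.

Lemma conjugate_bounded b : bounded_operator b -> bounded_operator (conjugate b).
Proof.
have bV : bounded_operator V.
  by apply/bounded_operatorP; split => //; exists 1 => // x; rewrite Viso mul1r.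
have bW : bounded_operator W.
  apply/bounded_operatorP; split; first exact: linear_inverse.
  by exists 1 => // x; rewrite isometric_inverse mul1r.
by move=> bb; exact: (bounded_operator_comp (bounded_operator_comp bV bb) bW).
Qed.

(** Conjugation by an isometric bijection leaves approximation errors unchanged, so stability of S
    passes to its closure. *)
Lemma conjugate_opclosure S : S `<=` @bounded_operator R E ->
  (forall b, S b -> S (conjugate b)) ->
  forall b, opclosure S b -> opclosure S (conjugate b).
Proof.
move=> bS SV b; have lS : forall g, S g -> linear g by move=> g /bS[].
move=> /(opclosureP _ lS)[bb bapp]; apply/opclosureP => //; split.
  exact: conjugate_bounded.
move=> e /bapp[g Sg bg]; exists (conjugate g); first exact: SV.
move=> x; rewrite -[X in rnorm X]/(V (b (W x)) - V (g (W x))) -(linB lV) Viso.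
by rewrite -(isometric_inverse x); exact: bg.
Qed.

Lemma conjugate_lspan S : (forall b, S b -> lspan S (conjugate b)) ->
  forall b, lspan S b -> lspan S (conjugate b).
Proof.
move=> SV; apply: lspan_min => //.
- rewrite (_ : conjugate 0 = 0); first exact: lspan0.
  by apply/funext => x; rewrite /conjugate /= -[0 (W x)]/(0 : E) (lin0 lV).
- by move=> a f g hf hg; rewrite conjugate_lin; exact: lspan_lin.
Qed.

End IsometricConjugation.

(** * Products of matrix units of D *)

Section ReplaceComposition.
Context (R : realType) (p : R) (p1 : 1 <= p) (d : nat) (hd : (1 < d)%N).
Local Notation X0 := (X0 hd).
Local Notation mu0 := (mu0 hd R : {measure set X0 -> \bar R}).
Local Notation L := (Lp mu0 p1).
Local Notation rep := (@replace_op R d hd p p1).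
Implicit Types (w u : nat -> Zset hd).

Lemma replace_op_linear r w u : linear (rep r w u).
Proof. by have [] := replace_op_bounded p1 r w u. Qed.

Lemma replace_op0 w u : rep 0 w u = id.
Proof.
apply/funext => g; apply: Lp_ext; apply: filterS (@replace_opE R d hd p p1 0 w u g) => x ->.
by rewrite mul1r; congr (g _); apply/funext.
Qed.

Lemma replace_op1_sum g : g = \sum_(s : Zset hd) rep 1 (fun=> s) (fun=> s) g :> L.
Proof.
apply: Lp_ext.
have h1 := Lp_sumE (index_enum (Zset hd)) (fun s => rep 1 (fun=> s) (fun=> s) g).
have h2 : {ae mu0, forall x, forall s, rep 1 (fun=> s) (fun=> s) g x =
    (in_cyl 1 (fun=> s) x)%:R * g (replace 1 (fun=> s) x)}.
  by apply: filter_forall => s; exact: replace_opE.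
apply: filterS2 h1 h2 => x -> e2; rewrite (bigD1 (x 0%N))//= e2 /in_cyl /= eqxx mul1r.
rewrite big1 ?addr0 => [|s sx]; last first.
  by rewrite e2 /in_cyl /= eq_sym (negbTE sx) mul0r.
by congr (g _); apply/funext => -[|i].
Qed.

(** The levels may differ. The product is nonzero only if u and w' agree on their common length, and
    then it is a matrix unit of the larger level. *)
Lemma replace_op_comp r w u r' w' u' :
  (rep r w u \o rep r' w' u' = 0) \/
  exists r'' w'' u'', rep r w u \o rep r' w' u' = rep r'' w'' u''.
Proof.
have compE g : {ae mu0, forall x, (rep r w u (rep r' w' u' g)) x =
    (in_cyl r w x && in_cyl r' w' (replace r u x : X0))%:R *
    g (replace r' u' (replace r u x))}.
  have h1 := @replace_opE R d hd p p1 r w u (rep r' w' u' g).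
  have h2 := push_le_ae (push_le_replace R r u) (@replace_opE R d hd p p1 r' w' u' g).
  by apply: filterS2 h1 h2 => x -> ->; rewrite mulrA -natrM mulnb.
have [agree|disagree] := pselect (forall i, (i < r)%N -> (i < r')%N -> u i = w' i).
  (* The shorter prefix is completed by the letters that the other factor tests or writes beyond
     it. *)
  right; pose w'' i := if (i < r)%N then w i else w' i.
  pose u'' i := if (i < r')%N then u' i else u i; exists (maxn r r'), w'', u''.
  apply/funext => g; apply: Lp_ext.
  apply: filterS2 (compE g) (@replace_opE R d hd p p1 (maxn r r') w'' u'' g) => x -> ->.
  rewrite /w'' /u''.
  congr ((_ : bool)%:R * g _).
    apply/andP/in_cylP => [[/in_cylP xw /in_cylP xw'] i|h].
      rewrite leq_max; case: ifPn => [ir _|]; first exact: xw.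
      by move=> /negbTE ir /= /xw'; rewrite /replace ir.
    split; apply/in_cylP => i ir.
      by rewrite h ?leq_max ?ir.
    rewrite /replace; case: ifPn => ir'; first exact: agree.
    by rewrite h ?leq_max ?ir ?orbT// (negbTE ir').
  apply/funext => i; rewrite /replace leq_max.
  by case: (i < r')%N; case: (i < r)%N.
left; apply/funext => g; apply: Lp_ext.
apply: filterS2 (compE g) (Lp0E mu0 p1) => x -> ->.
case: andP => [[_ /in_cylP h]|]; last by rewrite mul0r.
case: disagree => i ir ir'; rewrite -h// /replace ir.
by [].
Qed.

End ReplaceComposition.

(** * Matrix units of B *)

Section MatrixUnits.
Context (R : realType) (p : R) (p1 : 1 <= p) (d : nat) (hd : (1 < d)%N).
Local Notation Z := (Zset hd).
Local Notation X0 := (X0 hd).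
Local Notation mu0 := (mu0 hd R).
Local Notation muX := (muX R hd).
Local Notation L := (Lp mu0 p1).
Local Notation LX := (Lp muX p1).
Local Notation lp := (Lp (@counting nat R) p1).
Local Notation rep := (@replace_op R d hd p p1).
Implicit Types (w u : nat -> Z) (xi : LX).

Let p0 : 0 < p. Proof. exact: lt_le_trans p1. Qed.

(** The operator e_{jk} (x) b, defined on every vector by slices, whereas [is_tensor] prescribes
    values on elementary tensors only. *)
Definition block_op (j k : nat) (b : L -> L) : LX -> LX :=
  fun xi => inject j (b (slice k xi)).

Lemma block_op_bounded j k b : bounded_operator b -> bounded_operator (block_op j k b).
Proof.
move=> /bounded_operatorP[lb [C C0 bC]]; apply/bounded_operatorP; split.
  move=> a x y; rewrite /block_op (slice_linear (nu := mu0)) lb.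
  exact: (inject_linear (nu := mu0)).
exists C => // x; rewrite /block_op (rnorm_inject (nu := mu0)).
by apply: le_trans (bC _) _; rewrite ler_wpM2l// (slice_le (nu := mu0)).
Qed.

Lemma block_op_comp j k j' k' b c : linear b ->
  block_op j k b \o block_op j' k' c =
  if k == j' then block_op j k' (b \o c) else 0.
Proof.
move=> lb; apply/funext => xi; rewrite /block_op /= (slice_inject (nu := mu0)).
case: eqP => // _; rewrite (lin0 lb).
exact: (lin0 (inject_linear (nu := mu0) (p1 := p1) j)).
Qed.

Lemma block_op_tensor j k (b : L -> L) (f : lp) (g : L) : linear b ->
  block_op j k b (tensor f g) = tensor (f k *: lp_delta p1 j) (b g).
Proof.
move=> lb; rewrite /block_op (slice_tensor (nu := mu0)) (linZ lb) (inject_tensor (nu := mu0)).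
rewrite (linZ (tensor_linear_l (nu := mu0) (b g))).
by rewrite (linZ (tensor_linear_r (nu := mu0) (lp_delta p1 j))).
Qed.

(* e_{jk} tensored with the matrix unit u |-> w of D_ r. *)
Definition unit_op r j w k u : LX -> LX := block_op j k (rep r w u).

Definition unit_ops : set (LX -> LX) :=
  [set o | exists r j w k u, o = unit_op r j w k u].

Lemma unit_op_bounded r j w k u : bounded_operator (unit_op r j w k u).
Proof. exact/block_op_bounded/replace_op_bounded. Qed.

Lemma unit_opE r j w k u xi : {ae muX, forall z, unit_op r j w k u xi z =
  ((z.1 == j) && in_cyl r w z.2)%:R * xi (k, replace r u z.2)}.
Proof.
apply/(ae_sections mu0) => i.
have h1 := sliceE (nu := mu0) i (unit_op r j w k u xi).
have h2 := @replace_opE R d hd p p1 r w u (slice (nu := mu0) k xi).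
have h3 := push_le_ae (push_le_replace R r u) (sliceE (nu := mu0) k xi).
have h4 := Lp0E mu0 p1.
rewrite /unit_op /block_op (slice_inject (nu := mu0)) in h1.
apply: filterS2 (filterI h1 h2) (filterI h3 h4) => x [<- e2] [e3 e4] /=.
case: eqP => _ /=; last by rewrite mul0r.
by rewrite e2 e3.
Qed.

Lemma unit_op_comp f g : unit_ops f -> unit_ops g -> lspan unit_ops (f \o g).
Proof.
move=> [r [j [w [k [u ->]]]]] [r' [j' [w' [k' [u' ->]]]]].
rewrite /unit_op block_op_comp; last exact: replace_op_linear.
case: eqP => _; last exact: lspan0.
have [->|[r'' [w'' [u'' ->]]]] := replace_op_comp p1 r w u r' w' u'; last first.
  by apply: lspan_sub; exists r'', j, w'', k', u''.
rewrite (_ : block_op _ _ _ = 0); first exact: lspan0.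
apply/funext => xi; exact: (lin0 (inject_linear (nu := mu0) (p1 := p1) j)).
Qed.

(* beta_inv lowers the level by one, so level 0 is first refined to level 1. *)
Lemma unit_op0_sum j w k u : unit_op 0 j w k u =
  \sum_(s : Z) unit_op 1 j (fun=> s) k (fun=> s).
Proof.
apply/funext => xi; rewrite fct_sumE /unit_op /block_op replace_op0.
rewrite {1}(replace_op1_sum (slice (nu := mu0) k xi)).
exact: (lin_sum (inject_linear (nu := mu0) (p1 := p1) j)).
Qed.

Lemma v_inv_scalar :
  (d%:R `^ p^-1)%:C%C * (d%:R `^ (- p^-1))%:C%C = 1 :> R[i].
Proof.
have d0 : 0 < d%:R :> R by rewrite ltr0n ltnW.
by rewrite -rmorphM/= -powRD ?subrr ?powRr0// ?(gt_eqF d0) ?implybT.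
Qed.

Definition digit (m : nat) : Z := Ordinal (ltn_pmod m (ltnW hd)).

(** Uniqueness of Euclidean division by d; it turns the test on the integer coordinate of [h_inv]
    into one on the quotient and one on the first letter. *)
Lemma eq_divn_digit m s j : (d * m + (s : Z) == j)%N =
  (m == j %/ d)%N && (s == digit j).
Proof.
have d0 : (0 < d)%N by exact: ltnW.
have sd := ltn_ord (s : 'I_d).
apply/eqP/andP => [<-|[/eqP -> /eqP ->]]; last by rewrite mulnC -divn_eq.
rewrite mulnC divnMDl// divn_small// addn0 eqxx; split => //.
by apply/eqP/val_inj; rewrite /= modnMDl modn_small.
Qed.

Lemma in_cyl_cons r s w (x : X0) :
  in_cyl r.+1 (cons_word (s : Z) (w : X0)) x = (x 0%N == s) && in_cyl r w (tail_word x).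
Proof.
apply/in_cylP/andP => [h|[/eqP h0 /in_cylP h] [|i] ir]//; last exact: h.
split; first by apply/eqP; exact: (h 0%N).
by apply/in_cylP => i ir; exact: (h i.+1).
Qed.

Lemma in_cylS r w (x : X0) :
  in_cyl r.+1 w x = (x 0%N == w 0%N) && in_cyl r (w \o S) (tail_word x).
Proof.
rewrite -[in LHS](_ : cons_word (w 0%N) (w \o S : X0) = w) ?in_cyl_cons//.
by apply/funext => -[|i].
Qed.

Lemma push_le_tail_replace r u :
  push_le mu0 mu0 (replace r u \o @tail_word d hd) (1 * d%:R ^+ r).
Proof. exact: push_le_comp (push_le_tail R hd) (push_le_replace R r u). Qed.

(** Conjugation by [v] moves the last base d digits of j and k to the front of the words; the
    scalars d^(1/p) and d^(-1/p) cancel. *)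
Lemma beta_unit_op r j w k u : beta (unit_op r j w k u) =
  unit_op r.+1 (j %/ d) (cons_word (digit j) (w : X0))
    (k %/ d) (cons_word (digit k) (u : X0)).
Proof.
apply/funext => xi; rewrite /beta /=; apply: Lp_ext.
have h1 := vE (unit_op r j w k u (v_inv xi)).
have h2 := ae_comp (measurable_h_inv (hd := hd)) (@muX_h_inv R d hd)
  (unit_opE r j w k u (v_inv xi)).
(* The formula for [v_inv xi] holds almost everywhere only. It is restricted to the fibre over k and
   pulled back along a map that preserves null sets under preimage. *)
have h3 : {ae muX, forall z, v_inv xi (k, replace r u (tail_word z.2)) =
    (d%:R `^ (- p^-1))%:C%C * xi (h (k, replace r u (tail_word z.2)))}.
  apply/(ae_sections mu0) => m /=.
  exact: (push_le_ae (push_le_tail_replace r u)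
    ((ae_sections mu0 _).1 (v_invE xi) k)).
have h4 := unit_opE r.+1 (j %/ d) (cons_word (digit j) (w : X0))
    (k %/ d) (cons_word (digit k) (u : X0)) xi.
apply: filterS2 (filterI h1 h2) (filterI h3 h4) => -[m x] /= [e1 e2] [e3 e4].
rewrite e1 e2 e4 (_ : (fun i => x i.+1) = tail_word x)// e3.
rewrite mulrCA [X in _ * X = _]mulrA v_inv_scalar mul1r.
rewrite eq_divn_digit in_cyl_cons andbA; congr (_ * xi (_, _)).
by apply/funext => -[|i].
Qed.

Lemma push_le_cons_replace r u s : push_le mu0 mu0 (replace r u \o @cons_word d hd s)
  (d%:R * d%:R ^+ r).
Proof. exact: push_le_comp (push_le_cons R s) (push_le_replace R r u). Qed.

(** The inverse move absorbs the first letters of the words as new last digits of j and k, so the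
    level must be at least 1. *)
Lemma beta_inv_unit_op r j w k u : beta_inv (unit_op r.+1 j w k u) =
  unit_op r (d * j + w 0%N) (w \o S) (d * k + u 0%N) (u \o S).
Proof.
apply/funext => xi; rewrite /beta_inv /=; apply: Lp_ext.
have h1 := v_invE (unit_op r.+1 j w k u (v xi)).
have h2 := ae_comp (measurable_h (hd := hd)) (@muX_h R d hd)
  (unit_opE r.+1 j w k u (v xi)).
have h3 : {ae muX, forall z, v xi (k, replace r.+1 u (cons_word (digit z.1) z.2)) =
    (d%:R `^ p^-1)%:C%C *
    xi (h_inv (k, replace r.+1 u (cons_word (digit z.1) z.2)))}.
  apply/(ae_sections mu0) => m /=.
  exact: (push_le_ae (push_le_cons_replace r.+1 u (digit m))
    ((ae_sections mu0 _).1 (vE xi) k)).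
have h4 := unit_opE r (d * j + w 0%N) (w \o S) (d * k + u 0%N) (u \o S) xi.
apply: filterS2 (filterI h1 h2) (filterI h3 h4) => -[m x] /= [e1 e2] [e3 e4].
rewrite e1 e2 e4.
rewrite (_ : (fun i => _) = cons_word (digit m) x); last by apply/funext => -[|i].
rewrite e3 mulrCA [X in _ * X = _]mulrA [X in _ * (X * _) = _]mulrC v_inv_scalar mul1r.
rewrite in_cylS andbA.
rewrite (_ : _ && (_ == w 0%N) = (m == d * j + w 0)%N); last first.
  by rewrite [RHS]eq_sym eq_divn_digit; congr (_ && _); exact: eq_sym.
by congr (_ * xi (_, _)); apply/funext => i; rewrite /replace /= ltnS.
Qed.

Lemma beta_unit_ops b : unit_ops b -> lspan unit_ops (beta b).
Proof.
move=> [r [j [w [k [u ->]]]]]; rewrite beta_unit_op.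
apply: lspan_sub; by eexists _, _, _, _, _.
Qed.

Lemma beta_inv_lin c (a b : LX -> LX) :
  beta_inv (c *: a + b) = c *: beta_inv a + beta_inv b.
Proof.
apply/funext => xi; rewrite /beta_inv /=.
exact: (linear_inverse (@vK R p p1 d hd) (@v_invK R p p1 d hd) (@v_linear R p p1 d hd)).
Qed.

Lemma beta_inv_unit_ops b : unit_ops b -> lspan unit_ops (beta_inv b).
Proof.
move=> [[|r] [j [w [k [u ->]]]]]; last first.
  by rewrite beta_inv_unit_op; apply: lspan_sub; eexists _, _, _, _, _.
rewrite unit_op0_sum; elim/big_rec: _ => [|s f _ hf].
  rewrite (_ : beta_inv 0 = 0); first exact: lspan0.
  have := beta_inv_lin (-1) 0 0; by rewrite scaler0 addr0 scaleN1r addNr.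
rewrite -[X in X + _]scale1r beta_inv_lin; apply: lspan_lin => //.
by rewrite beta_inv_unit_op; apply: lspan_sub; eexists _, _, _, _, _.
Qed.

End MatrixUnits.

(** * B as the closed span of its matrix units *)

Section StabilizedAlgebra.
Context (R : realType) (p : R) (p1 : 1 <= p) (d : nat) (hd : (1 < d)%N).
Local Notation X0 := (X0 hd).
Local Notation mu0 := (mu0 hd R).
Local Notation muX := (muX R hd).
Local Notation L := (Lp mu0 p1).
Local Notation LX := (Lp muX p1).
Local Notation lp := (Lp (@counting nat R) p1).
Local Notation rep := (@replace_op R d hd p p1).
Local Notation units := (@unit_ops R p p1 d hd).
Local Notation Dset := (@D R p p1 d hd).
Local Notation Mb := (@Mbar R p p1).
Local Notation bt := (@beta R p p1 d hd).
Local Notation bti := (@beta_inv R p p1 d hd).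
Local Notation mxunit := (@matrix_unit R p p1).

Let p0 : 0 < p. Proof. exact: lt_le_trans p1. Qed.

Lemma matrix_unitE j k (f : lp) : mxunit j k f = f k *: lp_delta p1 j.
Proof.
apply: (lp_ext (p1 := p1)) => i; rewrite -[RHS]addr0.
have -> : (f k *: lp_delta p1 j : lp) i = f k * (i == j)%:R.
  by rewrite (ae_counting (LpZE (f k) (lp_delta p1 j))) lp_deltaE.
rewrite addr0 /matrix_unit.
have h := in_LpZ p1 (f k) (in_lp_delta p1 j).
rewrite (_ : (fun i => _) = (fun i => f k * (i == j)%:R)).
  exact: (ae_counting (Lp_ofE p1 h)).
by apply/funext => i'; rewrite mulrC.
Qed.

Lemma coordinate_le (f : lp) k : Normc.normc (f k) <= rnorm f.
Proof.
rewrite -(ler_powR_ge0 p0) ?rnorm_ge0 ?normc_ge0// -lee_fin rnorm_lp.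
rewrite (esumID [set k])//=; last by move=> *; rewrite lee_fin powR_ge0.
rewrite setTI esum_set1 ?lee_fin ?powR_ge0// leeDl// esum_ge0// => ? _.
by rewrite lee_fin powR_ge0.
Qed.

Lemma matrix_unit_bounded j k : bounded_operator (mxunit j k).
Proof.
apply/bounded_operatorP; split.
  by move=> a f g; rewrite !matrix_unitE lp_linE scalerDl scalerA.
exists (rnorm (lp_delta p1 j)); first exact: rnorm_ge0.
move=> f; rewrite matrix_unitE rnormZ mulrC ler_wpM2l ?rnorm_ge0//.
exact: coordinate_le.
Qed.

Lemma units_bounded : units `<=` @bounded_operator R LX.
Proof. by move=> _ [r [j [w [k [u ->]]]]]; exact: unit_op_bounded. Qed.

Lemma lspan_bounded (E : normedModType R[i]) (S : set (E -> E)) :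
  S `<=` @bounded_operator R E -> lspan S `<=` @bounded_operator R E.
Proof.
move=> bS; apply: lspan_min => //; first exact: bounded_operator0.
by move=> a f g; exact: bounded_operator_lin.
Qed.

Definition tensor_op (a : lp -> lp) (b : L -> L) (c : LX -> LX) :=
  forall f g, c (tensor f g) = tensor (a f) (b g).

Lemma is_tensorP a b c : is_tensor fst snd a b c <-> tensor_op a b c.
Proof.
by split=> h f g; have := h f g; rewrite !(tensorE (nu := mu0)).
Qed.

Lemma unit_op_tensor r j w k u : tensor_op (mxunit j k) (rep r w u) (unit_op r j w k u).
Proof.
move=> f g; rewrite matrix_unitE; apply: block_op_tensor.
exact: replace_op_linear.
Qed.

Lemma replace_op_in_D r w u : Dset (rep r w u).
Proof.
apply: opclosure_sub; first by move=> c [s _ []].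
(* The union defining D starts at level 1; the matrix unit of level 0 is the identity, which is
   found at level 1. *)
case: r => [|r]; last by exists r.+1 => //; exact: replace_op_D.
by exists 1%N => //; rewrite replace_op0; exact: id_D.
Qed.

Lemma matrix_unit_in_Mbar j k : Mb (mxunit j k).
Proof.
apply: opclosure_sub; last by apply: lspan_sub; exists j, k.
by apply: lspan_bounded => _ [i [l ->]]; exact: matrix_unit_bounded.
Qed.

(** [tensor_op] is a relation, so an operator representing a (x) b has to be exhibited; bilinearity
    reduces this to matrix units. *)
Lemma algebraic_tensor a b : lspan [set e | exists j k, e = mxunit j k] a ->
  lspan [set o | exists r w u, o = rep r w u] b ->
  exists2 c, lspan units c & tensor_op a b c.
Proof.
move=> ha hb; move: a ha; apply: lspan_min; last 2 first.
- exists 0; first exact: lspan0.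
  by move=> f g; exact: (esym (lin0 (tensor_linear_l (nu := mu0) (b g)))).
- move=> x a a' [c hc ac] [c' hc' ac']; exists (x *: c + c'); first exact: lspan_lin.
  move=> f g; rewrite -[LHS]/(x *: c (tensor f g) + c' (tensor f g)) ac ac'.
  by rewrite -[LHS](tensor_linear_l (nu := mu0) (b g)).
move=> _ [j [k ->]]; move: b hb; apply: lspan_min; last 2 first.
- exists 0; first exact: lspan0.
  by move=> f g; exact: (esym (lin0 (tensor_linear_r (nu := mu0) (mxunit j k f)))).
- move=> x b b' [c hc bc] [c' hc' bc']; exists (x *: c + c'); first exact: lspan_lin.
  move=> f g; rewrite -[LHS]/(x *: c (tensor f g) + c' (tensor f g)) bc bc'.
  by rewrite -[LHS](tensor_linear_r (nu := mu0) (mxunit j k f)).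
move=> _ [r [w [u ->]]]; exists (unit_op r j w k u); last exact: unit_op_tensor.
by apply: lspan_sub; exists r, j, w, k, u.
Qed.

(** Vectors with finitely many nonzero slices are dense, and c is continuous with some constant C,
    so the constant K passes to all vectors. *)
Lemma bound_on_truncations (c : LX -> LX) K : bounded_operator c -> 0 <= K ->
  (forall n (g : 'I_n -> L), rnorm (c (\sum_(m < n) inject m (g m))) <=
     K * rnorm (\sum_(m < n) inject m (g m))) -> bound_by K c.
Proof.
move=> /bounded_operatorP[lc [C C0 cC]] K0 cK x.
apply/ler_addgt0Pr => e e0; pose t := e / (C + K + 1).
have CK : 0 < C + K + 1 by rewrite ltr_wpDl// addr_ge0.
have t0 : 0 < t by rewrite divr_gt0.
have [n xn] := trunc_dense (nu := mu0) x t0.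
set y := \sum_(k < n) _ in xn; have h1 := cK n (fun k => slice k x).
rewrite -/y in h1.
have h2 : rnorm (c x) <= rnorm (c x - c y) + rnorm (c y).
  by have := rnormD (c x - c y) (c y); rewrite subrK.
have h3 : rnorm (c x - c y) <= C * t.
  rewrite -(linB lc); apply: le_trans (cC _) _; rewrite ler_wpM2l//; exact: ltW.
have h4 : rnorm y <= rnorm x + t.
  have := rnormB x (x - y); rewrite subKr => h; apply: le_trans h _.
  by rewrite lerD2l ltW.
have h5 : K * rnorm y <= K * rnorm x + K * t by rewrite -mulrDr ler_wpM2l.
have h6 : C * t + K * t <= e.
  rewrite -mulrDl mulrC /t mulrAC ler_pdivrMr// ler_pM2l//.
  by rewrite lerDl.
move: h1 h2 h3 h5 h6; set a1 := C * t; set a2 := K * t; set a3 := K * _; set a4 := K * _.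
lra.
Qed.

(** The splitting c - c' = (a - a') (x) b + a' (x) (b - b'), each term bounded by the left and right
    tensor estimates in turn. The sums of the tensors delta_m (x) g_m are exactly the truncated
    vectors. *)
Lemma tensor_op_diff_bound a b c a' b' c' (ea eb A' Bb : R) :
  linear a -> linear b -> linear a' -> linear b' ->
  bounded_operator c -> bounded_operator c' ->
  0 <= ea -> 0 <= eb -> 0 <= A' -> 0 <= Bb ->
  bound_by ea (a - a') -> bound_by eb (b - b') ->
  bound_by A' a' -> bound_by Bb b ->
  tensor_op a b c -> tensor_op a' b' c' ->
  bound_by (ea * Bb + A' * eb) (c - c').
Proof.
move=> la lb la' lb' bc bc' ea0 eb0 A0 B0 ha hb ha' hb' tc tc'.
have [lc _] := bc; have [lc' _] := bc'.
apply: bound_on_truncations.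
- by rewrite addrC -scaleN1r; apply: bounded_operator_lin.
- by rewrite addr_ge0// mulr_ge0.
move=> n g; pose dl m := lp_delta p1 m; set x := \sum_m _.
have xE : x = \sum_(m < n) tensor (dl m) (g m).
  by apply: eq_bigr => m _; exact: (inject_tensor (nu := mu0)).
have -> : (c - c') x = \sum_(m < n) tensor ((a - a') (dl m)) (b (g m)) +
    \sum_(m < n) tensor (a' (dl m)) ((b - b') (g m)).
  rewrite -[LHS]/(c x - c' x) xE (lin_sum lc) (lin_sum lc') -sumrB -big_split.
  apply: eq_bigr => m _; rewrite tc tc'.
  rewrite -[(a - a') _]/(a (dl m) - a' (dl m)) -[(b - b') _]/(b (g m) - b' (g m)).
  rewrite (linB (tensor_linear_l (nu := mu0) (b (g m)))).
  rewrite (linB (tensor_linear_r (nu := mu0) (a' (dl m)))).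
  by rewrite /= addrA subrK.
apply: le_trans (rnormD _ _) _; rewrite mulrDl xE; apply: lerD.
  apply: le_trans (rnorm_tensor_left (nu := mu0) _ _ ea0 (linear_sub la la') ha) _.
  rewrite -mulrA ler_wpM2l//.
  exact: (rnorm_tensor_right (nu := mu0) _ _ B0 lb hb').
apply: le_trans (rnorm_tensor_left (nu := mu0) _ _ A0 la' ha') _.
rewrite -mulrA ler_wpM2l//.
exact: (rnorm_tensor_right (nu := mu0) _ _ eb0 (linear_sub lb lb') hb).
Qed.

Let gens : set (LX -> LX) := [set c | bounded_operator c /\
  exists a b, [/\ Mb a, Dset b & is_tensor fst snd a b c]].

Lemma gens_sub : gens `<=` opclosure (lspan units).
Proof.
move=> c [bc [a [b [Ma Db /is_tensorP abc]]]].
have lmu a' : lspan [set e | exists j k, e = mxunit j k] a' -> bounded_operator a'.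
  by apply: lspan_bounded => _ [i [l ->]]; exact: matrix_unit_bounded.
have lD b' : (\bigcup_(r in [set r | (1 <= r)%N]) @D_ R p p1 d hd r) b' -> bounded_operator b'.
  by move=> [s _ []].
have lun c' : lspan units c' -> bounded_operator c'.
  by apply: lspan_bounded; exact: units_bounded.
have /opclosureP[|ba aapp] := Ma; first by move=> a' /lmu[].
have /opclosureP[|bb bapp] := Db; first by move=> b' /lD[].
apply/opclosureP; first by move=> c' /lun[].
split => // e e0.
have e20 : 0 < e / 2 by rewrite divr_gt0.
have /bounded_operatorP[lb [Bb B0 hB]] := bb.
have B10 : 0 < Bb + 1 by rewrite ltr_wpDl.
have ea0 : 0 < e / 2 / (Bb + 1) by rewrite divr_gt0.
have [a' Ma' haa'] := aapp _ ea0.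
have /bounded_operatorP[la' [A' A0 hA']] := lmu _ Ma'.
have A10 : 0 < A' + 1 by rewrite ltr_wpDl.
have eb0 : 0 < e / 2 / (A' + 1) by rewrite divr_gt0.
(* The error term a' (x) (b - b') involves the bound A' of a', so b' is chosen after a'. *)
have [b' Db' hbb'] := bapp _ eb0.
have [lb' _] := lD _ Db'; have [s _ Ds] := Db'.
have sb' : lspan [set o | exists r w u, o = rep r w u] b'.
  apply: lspan_min (D_span Ds) => [_ [w [u ->]]||]; last 2 first.
  - exact: lspan0.
  - exact: lspan_lin.
  by apply: lspan_sub; exists s, w, u.
have [c' hc' abc'] := algebraic_tensor Ma' sb'.
exists c' => //; have [la _] := ba.
have h := tensor_op_diff_bound la lb la' lb' bc (lun _ hc') (ltW ea0) (ltW eb0)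
  A0 B0 haa' hbb' hA' hB abc abc'.
move=> x; apply: le_trans (h x) _; rewrite ler_wpM2r ?rnorm_ge0// [leRHS]splitr.
apply: lerD.
  by rewrite mulrAC ler_pdivrMr// ler_pM2l// lerDl.
by rewrite mulrA [A' * _]mulrC ler_pdivrMr// ler_pM2l// lerDl.
Qed.

Lemma units_sub_gens : units `<=` gens.
Proof.
move=> _ [r [j [w [k [u ->]]]]]; split; first exact: unit_op_bounded.
exists (mxunit j k), (rep r w u); split.
- exact: matrix_unit_in_Mbar.
- exact: replace_op_in_D.
- exact/is_tensorP/unit_op_tensor.
Qed.

Lemma lspan_units_bounded : lspan units `<=` @bounded_operator R LX.
Proof. exact/lspan_bounded/units_bounded. Qed.

(** Idempotence of [opclosure] reduces the two inclusions to generators: [gens_sub] for one,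
    [units_sub_gens] for the other. *)
Lemma B_E : B p1 hd = opclosure (lspan units).
Proof.
have bg : gens `<=` @bounded_operator R LX by move=> c [].
apply/seteqP; split.
  apply: opclosure_idem; last by move=> g /lspan_units_bounded[].
  apply: lspan_min; first exact: gens_sub.
    by apply: opclosure_sub; [exact: lspan_units_bounded|exact: lspan0].
  apply: opclosure_lin; first exact: lspan_units_bounded.
  by move=> a f g; exact: lspan_lin.
apply: opclosure_idem; last by move=> g /(lspan_bounded bg)[].
apply: subset_trans (opclosure_sub (lspan_bounded bg)).
apply: lspan_min; last 2 first.
- exact: lspan0.
- by move=> a f g; exact: lspan_lin.
by move=> f /units_sub_gens; exact: lspan_sub.
Qed.

Lemma B_bounded : B p1 hd `<=` @bounded_operator R LX.
Proof. by move=> b []. Qed.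

Lemma B_lin c a b : B p1 hd a -> B p1 hd b -> B p1 hd (c *: a + b).
Proof.
rewrite B_E; apply: opclosure_lin; first exact: lspan_units_bounded.
by move=> x f g; exact: lspan_lin.
Qed.

Lemma B_zero : B p1 hd 0.
Proof.
rewrite B_E; apply: opclosure_sub; first exact: lspan_units_bounded.
exact: lspan0.
Qed.

Lemma B_comp a b : B p1 hd a -> B p1 hd b -> B p1 hd (a \o b).
Proof.
rewrite B_E; apply: opclosure_comp; first exact: lspan_units_bounded.
apply: lspan_comp; first by move=> g /units_bounded[].
exact: unit_op_comp.
Qed.

Local Notation vK := (@vK R p p1 d hd).
Local Notation v_invK := (@v_invK R p p1 d hd).
Local Notation v_linear := (@v_linear R p p1 d hd).
Local Notation v_isometric := (@v_isometric R p p1 d hd).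

Lemma B_beta b : B p1 hd b -> B p1 hd (beta b).
Proof.
rewrite B_E.
apply: (conjugate_opclosure vK v_invK v_linear v_isometric) => [|f].
  exact: lspan_units_bounded.
apply: (conjugate_lspan v_linear) => g; exact: beta_unit_ops.
Qed.

Let l_inv := linear_inverse vK v_invK v_linear.
Let i_inv := isometric_inverse v_invK v_isometric.

Lemma B_beta_inv b : B p1 hd b -> B p1 hd (beta_inv b).
Proof.
rewrite B_E.
apply: (conjugate_opclosure v_invK vK l_inv i_inv) => [|f].
  exact: lspan_units_bounded.
apply: (conjugate_lspan l_inv) => g; exact: beta_inv_unit_ops.
Qed.

Lemma betaK : cancel bt bti.
Proof. by move=> b; apply/funext => x; rewrite /beta_inv /beta /= !vK. Qed.

Lemma beta_invK : cancel bti bt.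
Proof. by move=> b; apply/funext => x; rewrite /beta_inv /beta /= !v_invK. Qed.

Lemma beta_powE n : beta_pow p1 hd n = int_iter bt bti n.
Proof. by []. Qed.

Lemma B_beta_pow n b : B p1 hd b -> B p1 hd (beta_pow p1 hd n b).
Proof.
rewrite beta_powE; move: b.
apply: (@int_iter_ind _ bt bti (fun u => forall b, B p1 hd b -> B p1 hd (u b))).
- by move=> b.
- by move=> u hu b /hu; exact: B_beta.
- by move=> u hu b /hu; exact: B_beta_inv.
Qed.

Lemma beta_pow_lin n c a b : beta_pow p1 hd n (c *: a + b) =
  c *: beta_pow p1 hd n a + beta_pow p1 hd n b.
Proof.
rewrite beta_powE; move: c a b.
apply: (@int_iter_ind _ bt bti (fun u => forall c a b, u (c *: a + b) = c *: u a + u b)).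
- by move=> c a b.
- move=> u hu c a b; rewrite -[LHS]/(bt (u (c *: a + b))) hu.
  exact: (conjugate_lin _ v_linear).
- move=> u hu c a b; rewrite -[LHS]/(bti (u (c *: a + b))) hu.
  exact: (conjugate_lin _ l_inv).
Qed.

Lemma beta_pow_comp n a b : beta_pow p1 hd n (a \o b) =
  beta_pow p1 hd n a \o beta_pow p1 hd n b.
Proof.
rewrite beta_powE; move: a b.
apply: (@int_iter_ind _ bt bti (fun u => forall a b, u (a \o b) = u a \o u b)).
- by move=> a b.
- move=> u hu a b; rewrite -[LHS]/(bt (u (a \o b))) hu.
  exact: (conjugate_comp vK).
- move=> u hu a b; rewrite -[LHS]/(bti (u (a \o b))) hu.
  exact: (conjugate_comp v_invK).
Qed.

Lemma beta_pow_opnorm n a : (opnorm (beta_pow p1 hd n a) <= opnorm a)%E.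
Proof.
rewrite beta_powE; move: a.
apply: (@int_iter_ind _ bt bti (fun u => forall a, (opnorm (u a) <= opnorm a)%E)).
- by move=> a.
- move=> u hu a; apply: le_trans (hu a).
  exact: (conjugate_opnorm v_invK v_isometric).
- move=> u hu a; apply: le_trans (hu a).
  exact: (conjugate_opnorm vK i_inv).
Qed.

End StabilizedAlgebra.

Theorem corollary7p16 (R : realType) (d : nat) (hd : (2 <= d)%N)
    (p : R) (p1 : 1 <= p) (p2 : p != 2)
    (F : Fp p1 (B p1 hd) (beta_pow p1 hd))
    (Fr : Fp_r p1 (B p1 hd) (beta_pow p1 hd)) :
  exists kappa : F -> Fr,
    [/\ is_kappa_r kappa,
        forall kappa' : F -> Fr, is_kappa_r kappa' -> kappa' = kappa,
        forall x : F, `|kappa x| = `|x| &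
        bijective kappa].
Proof.
apply: kappa_r_isometric_bijection.
- exact: B_zero.
- exact: B_bounded.
- exact: B_lin.
- exact: B_comp.
- exact: B_beta_pow.
- by [].
- by move=> m n b; apply: int_iterD; [exact: betaK|exact: beta_invK].
- exact: beta_pow_lin.
- exact: beta_pow_comp.
- exact: beta_pow_opnorm.
Qed.
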